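(* Let $\beta:\mathbb R\to[0,\infty)$ be a Lipschitz periodic function. (i) Suppose $\beta$ is $1$-periodic and $$\max\beta-\min\beta<V_0\kappa\sin\alpha .$$ Then there exists a unique (up to translation in time) pulsating traveling solution $U$ of the sliding drop problem. Furthermore, for any solution $u$ of the sliding drop problem (for $t\ge0$) with support $(a(t),b(t))$, there is $t_0$ with $b'(t)>0$ for all $t\ge t_0$, and $u$ converges to the pulsating traveling solution as $t\to\infty$: there is $\tau\in\mathbb R$ such that $\sup_{x\in\mathbb R}|u(x,t)-U(x,t+\tau)|\to0$ as $t\to\infty$. (ii) Suppose $$\max\beta-\min\beta>V_0\kappa\sin\alpha .$$ Then there exists $\delta>0$, depending on $\beta$ only through $\max\beta$ and $\min\beta$ (and depending on $V_0,\kappa,\alpha$), such that if the period of $\beta$ is less than $\delta$, then any solution sticks to the inclined plane: for any solution of the sliding drop problem with support $(a(t),b(t))$ there is a constant $C$, independent of $t$, such that $$\text{either } a(t)\le a(0)+C \text{ for all } t\ge0,\quad\text{or}\quad b(t)\le b(0)+C\text{ for all } t\ge0 .$$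
   Context: Fix constants $V_0>0$ (volume), $\kappa>0$ and $0<\alpha<\pi/2$. The downhill direction is that of increasing $x$. Functions in $H^1_0(a,b)$ are extended by $0$ to $\mathbb R$. Set $$\mathcal F(v)=\int_{\mathbb R}\frac12|v_x|^2+\frac{v^2}{2}\kappa\cos\alpha-v\,x\,\kappa\sin\alpha\,dx .$$ Admissible initial datum: a function $u_0$ for which there are $a_0<b_0$ with $\{u_0>0\}=(a_0,b_0)$ and $u_0=\mathrm{argmin}\{\mathcal F(v): v\in H^1_0(a_0,b_0),\ v\ge 0,\ \int v\,dx=V_0\}$. Solution of the sliding drop problem with initial datum $u_0$: a function $u(x,t)$, $t\ge0$, for which there exist Lipschitz functions $a(t),b(t)$ on $[0,\infty)$ with $a(0)=a_0$, $b(0)=b_0$ such that, for all $t\ge 0$, $\{x: u(x,t)>0\}=(a(t),b(t))$ and $$u(\cdot,t)=\mathrm{argmin}\Big\{\mathcal F(v): v\in H^1_0(a(t),b(t)),\ v\ge0,\ \int_{a(t)}^{b(t)} v\,dx=V_0\Big\},$$ and, for a.e. $t\ge0$, $$\min\{a'(t)+\tfrac12|u_x(a(t),t)|^2-\beta(a(t)),\ |u_x(a(t),t)|\}=0,$$ $$\min\{-b'(t)+\tfrac12|u_x(b(t),t)|^2-\beta(b(t)),\ |u_x(b(t),t)|\}=0,$$ where $u_x(a(t),t)$, $u_x(b(t),t)$ are one-sided derivatives taken from inside $(a(t),b(t))$. A pulsating traveling solution (for $1$-periodic $\beta$) is a global-in-time solution $U(x,t)$, $t\in\mathbb R$, i.e.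 a function for which there exist Lipschitz functions $a(t),b(t)$ on $\mathbb R$ such that, for all $t\in\mathbb R$, $\{x: U(x,t)>0\}=(a(t),b(t))$ and $$U(\cdot,t)=\mathrm{argmin}\Big\{\mathcal F(v): v\in H^1_0(a(t),b(t)),\ v\ge0,\ \int_{a(t)}^{b(t)} v\,dx=V_0\Big\},$$ and, for a.e. $t\in\mathbb R$, $$\min\{a'(t)+\tfrac12|U_x(a(t),t)|^2-\beta(a(t)),\ |U_x(a(t),t)|\}=0,$$ $$\min\{-b'(t)+\tfrac12|U_x(b(t),t)|^2-\beta(b(t)),\ |U_x(b(t),t)|\}=0$$ (one-sided derivatives taken from inside $(a(t),b(t))$, no initial condition imposed), such that for some $T>0$, $U(x+1,t+T)=U(x,t)$ for all $x,t\in\mathbb R$. *)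

(* Defs.v *)
From HB Require Import structures.
From mathcomp Require Import all_boot all_order all_algebra.
From mathcomp Require Import all_classical all_reals all_analysis.

Set Implicit Arguments.
Unset Strict Implicit.
Unset Printing Implicit Defensive.

Import Order.TTheory GRing.Theory Num.Theory.
Import numFieldNormedType.Exports.

Local Open Scope classical_set_scope.
Local Open Scope ring_scope.

Definition Lebesgue (R : realType) :
    {measure set (measurableTypeR R) -> \bar R} := @lebesgue_measure R.

Definition is_maximum (R : realType) (f : R -> R) (M : R) : Prop :=
  (exists x, f x = M) /\ forall x, f x <= M.

Definition is_minimum (R : realType) (f : R -> R) (m : R) : Prop :=
  (exists x, f x = m) /\ forall x, m <= f x.

Definition has_right_derivative (R : realType) (f : R -> R) (x p : R) : Prop :=
  h^-1 * (f (x + h) - f x) @[h --> 0^'+] --> p.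

Definition has_left_derivative (R : realType) (f : R -> R) (x p : R) : Prop :=
  h^-1 * (f (x + h) - f x) @[h --> 0^'-] --> p.

Definition test_function (R : realType) (a b : R) (f : R -> R) : Prop :=
  [/\ forall x, derivable f x 1,
      continuous (derive1 f) &
      exists K : set R, [/\ compact K, K `<=` `]a, b[ &
        forall x, ~ K x -> f x = 0]].

(* v, extended by 0 to the whole line, belongs to H^1_0(a,b) and has weak
   derivative vx: H^1_0(a,b) is the closure of C^1_c(a,b) for the H^1 norm.
   Since the problem involves point values of v, elements of H^1_0(a,b) are
   always given by their continuous representative; vx is only determined
   almost everywhere. *)
Definition H10 (R : realType) (a b : R) (v vx : R -> R) : Prop :=
  [/\ continuous v,
      v \in Lfun (@Lebesgue R) 2%:E,
      vx \in Lfun (@Lebesgue R) 2%:E &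
      exists phi : nat -> R -> R,
        [/\ forall n, test_function a b (phi n),
            Lnorm (@Lebesgue R) 2%:E (fun x => (phi n x - v x)%:E)
              @[n --> \oo] --> 0%E &
            Lnorm (@Lebesgue R) 2%:E (fun x => (derive1 (phi n) x - vx x)%:E)
              @[n --> \oo] --> 0%E]].

Definition energy (R : realType) (kappa alpha : R) (v vx : R -> R) : R :=
  \int[@Lebesgue R]_x
    (2^-1 * `|vx x| ^+ 2 + v x ^+ 2 / 2 * (kappa * cos alpha)
     - v x * x * (kappa * sin alpha)).

Definition competitor (R : realType) (V0 a b : R) (v vx : R -> R) : Prop :=
  [/\ H10 a b v vx,
      forall x, 0 <= v x &
      \int[@Lebesgue R]_x v x = V0].

(* The choice of the representative ux of the weak derivative is immaterial,
   as energy only depends on its class. *)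
Definition is_argmin (R : realType) (V0 kappa alpha a b : R) (u : R -> R) :
    Prop :=
  exists2 ux, competitor V0 a b u ux &
    forall v vx, competitor V0 a b v vx ->
      energy kappa alpha u ux <= energy kappa alpha v vx.

Definition drop_on (R : realType) (V0 kappa alpha a b : R) (u : R -> R) :
    Prop :=
  [set x | 0 < u x] = [set` `]a, b[] /\ is_argmin V0 kappa alpha a b u.

Definition admissible_datum (R : realType) (V0 kappa alpha a0 b0 : R)
    (u0 : R -> R) : Prop :=
  a0 < b0 /\ drop_on V0 kappa alpha a0 b0 u0.

Definition contact_laws (R : realType) (beta : R -> R)
    (u : R -> R -> R) (a b : R -> R) (t : R) : Prop :=
  [/\ derivable a t 1, derivable b t 1 &
    exists p q : R,
      [/\ has_right_derivative (u ^~ t) (a t) p,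
          has_left_derivative (u ^~ t) (b t) q,
          Num.min (derive1 a t + 2^-1 * `|p| ^+ 2 - beta (a t)) `|p| = 0 &
          Num.min (- derive1 b t + 2^-1 * `|q| ^+ 2 - beta (b t)) `|q| = 0]].

Definition sliding_drop_on (R : realType) (V0 kappa alpha : R) (beta : R -> R)
    (I : set R) (u : R -> R -> R) (a b : R -> R) : Prop :=
  [/\ [lipschitz a t | t in I],
      [lipschitz b t | t in I],
      forall t, I t -> drop_on V0 kappa alpha (a t) (b t) (u ^~ t) &
      {ae @Lebesgue R, forall t, I t -> contact_laws beta u a b t}].

(* u x t is the height at position x and time t; the functions a and b are
   only relevant on [0, +oo[. *)
Definition sliding_drop_solution (R : realType) (V0 kappa alpha : R)
    (beta u0 : R -> R) (u : R -> R -> R) (a b : R -> R) : Prop :=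
  admissible_datum V0 kappa alpha (a 0) (b 0) u0 /\
  sliding_drop_on V0 kappa alpha beta `[0, +oo[ u a b.

Definition pulsating_traveling_solution (R : realType) (V0 kappa alpha : R)
    (beta : R -> R) (U : R -> R -> R) : Prop :=
  (exists a b : R -> R, sliding_drop_on V0 kappa alpha beta setT U a b) /\
  exists2 T : R, 0 < T & forall x t, U (x + 1) (t + T) = U x t.

(* Main.v *)
Require Import Defs.
From HB Require Import structures.
From mathcomp Require Import all_boot all_order all_algebra.
From mathcomp Require Import all_classical all_reals all_analysis.
From mathcomp Require Import measurable_realfun ring lra.
Import Order.TTheory GRing.Theory Num.Theory.
Import numFieldNormedType.Exports.
Set Implicit Arguments.
Unset Strict Implicit.
Unset Printing Implicit Defensive.
Local Open Scope classical_set_scope.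
Local Open Scope ring_scope.

(** The proof reduces the sliding drop to an ordinary differential system for its
    two contact points, and studies that system by comparison.

    Reduction. On a given interval the energy is a convex quadratic functional and
    the volume a linear constraint, so that the minimizer is the solution of a
    linear equation with constant coefficients, the explicit function [profile].
    [argmin_profile] shows that a minimizer is the profile: a minimizer is positive
    inside its support, hence it can be perturbed by test functions of zero mass.
    Conversely [energy_profile] shows that a nonnegative profile minimizes. The
    profile is nonnegative exactly when the length of the drop does not exceed the
    critical length [Lm] at which the slope at the back vanishes. With [P l] half
    the squared slope at the back of a drop of length [l], and [F0] its weight
    along the incline, half the squared slope at the front is [P l + F0]
    ([slope_balance]); the contact laws become
      [b' = P (b - a) + F0 - beta b] and [a' >= beta a - P (b - a)],
    with equality in the second one when [b - a < Lm] ([sliding_drop_slides]). All that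
    matters below is that [P] is locally Lipschitz and decreases strictly from
    infinity to zero on the lengths between [0] and [Lm].

    Comparison. Since [P] decreases, a drop whose contact points are both behind
    those of another one remains behind ([slide_comparison]): the larger of the two
    excesses satisfies Gronwall's inequality, even when a drop has its maximal
    length, because both of its ends then have the same velocity.

    Part (ii) follows by comparison with drops at rest. A drop with its back at a
    minimum and its front at a maximum of [beta] is pinned if its length lies in
    some interval [[l1, l2]], nonempty as [max beta - min beta] exceeds [F0]. If
    the period is less than [l2 - l1], there are such drops arbitrarily far
    downhill, and nothing slides past them ([slides_stick]).

    Part (i). While the front does not advance, gravity makes the back advance
    faster, so that the front must start to move; it cannot stop again, since its
    velocity could then decrease only through the Lipschitz function [beta b]
    ([front_eventually_moves]). To construct a pulsating wave, the length is
    written as a function [Z] of [x = a + b], which always increases. It solves a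
    scalar equation with a right-hand side of period [2] and the obstacle [Lm]; the
    largest subsolution is a solution, and it is periodic because it is the largest
    ([periodic_obstacle_ode]). Integrating the inverse of the velocity of [x]
    recovers time ([wave_exists]). For the convergence ([wave_attracts]), let [y]
    be the time at which the front of the wave is where the front of the given drop
    is. As [P] decreases, [y - t] moves in a direction given by the sign of the
    difference of the positions of the backs, which never changes; comparison bounds
    [y - t], which therefore converges, and this forces the difference to tend to
    zero. Uniqueness of the wave is a consequence of the attraction
    ([wave_unique]). *)

(** * Monotonicity of Lipschitz functions *)

Section real_analysis.
Variable R : realType.
Implicit Types (f g : R -> R) (x y t K : R).
Notation mu := (@lebesgue_measure R).

(** The supremum of the points where [g] has not exceeded [g x] is such a point
    by continuity, and local monotonicity pushes it to [y]. *)
Lemma lip_locally_nonincreasing g x y K :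
  x <= y ->
  (forall s t, x <= s <= y -> x <= t <= y -> `|g s - g t| <= K * `|s - t|) ->
  (forall t, x <= t < y ->
     exists2 d, 0 < d & forall h, 0 < h < d -> g (t + h) <= g t) ->
  g y <= g x.
Proof.
move=> xy glip gloc.
pose A := [set t | x <= t <= y /\ g t <= g x].
have Ax : A x by split; rewrite ?lexx.
have supA : has_sup A by split; [exists x | exists y => t [/andP[]]].
set s := sup A.
have xs : x <= s by apply: ub_le_sup => //; case: supA.
have sy : s <= y by apply: ge_sup; [exists x | move=> t [/andP[]]].
have K0 : 0 <= Num.max K 0 by rewrite le_max lexx orbT.
have gs : g s <= g x.
  apply/ler_addgt0Pl => e e0.
  have e'0 : 0 < e / (Num.max K 0 + 1) by rewrite divr_gt0// ltr_wpDl.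
  have [t [txy gt]] := sup_adherent e'0 supA.
  rewrite -/s => st.
  have ts : t <= s by apply: ub_le_sup => //; case: supA.
  have := glip s t; rewrite xs sy => /(_ isT txy) /ler_normlW.
  rewrite [`|s - t|]ger0_norm ?subr_ge0// => gst.
  have : K * (s - t) <= e.
    have st0 : 0 <= s - t by rewrite subr_ge0.
    apply: (@le_trans _ _ ((Num.max K 0 + 1) * (s - t))).
      by rewrite ler_wpM2r// (le_trans (y := Num.max K 0)) ?le_max ?lexx// lerDl.
    rewrite mulrC -ler_pdivlMr ?ltr_wpDl//; lra.
  lra.
have [sly|] := ltP s y; last first.
  by move=> ys; have <- : s = y by apply/le_anti; rewrite sy ys.
have [d d0 dP] := gloc s (introT andP (conj xs sly)).
pose h := Num.min (d / 2) (y - s).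
have h0 : 0 < h by rewrite lt_min divr_gt0//= subr_gt0.
have hd : h < d by rewrite gt_min ltr_pdivrMr// ltr_pMr// ltr1n.
have hy : s + h <= y.
  by rewrite -lerBrDl ge_min lexx orbT.
have As : A (s + h).
  split; last by rewrite (le_trans _ gs)// dP// h0 hd.
  by rewrite hy (le_trans xs)// lerDl ltW.
have : s + h <= s by apply: ub_le_sup => //; case: supA.
by rewrite gerDl leNgt h0.
Qed.

(** A null set is hidden in an open set [U] of small measure; subtracting a
    large multiple of the measure of [U] to the left of [t] makes the function
    decrease near the exceptional points, where nothing but the Lipschitz bound
    is known. *)
Lemma lip_ae_nonincreasing f x y K :
  x <= y ->
  (forall s t, x <= s <= y -> x <= t <= y -> `|f s - f t| <= K * `|s - t|) ->
  {ae mu, forall t, x <= t < y ->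
     forall e, 0 < e -> \forall h \near 0^'+, f (t + h) <= f t + e * h} ->
  f y <= f x.
Proof.
move=> xy flip [N [mN N0 NP]].
wlog K0 : K flip / 0 <= K.
  move=> wl; apply: (wl (Num.max K 0)); last by rewrite le_max lexx orbT.
  move=> s t sxy txy; rewrite (le_trans (flip _ _ sxy txy))//.
  by rewrite ler_wpM2r// le_max lexx.
apply/ler_addgt0Pl => eps eps0.
pose e := eps / 2 / (y - x + 1).
have yx0 : 0 < y - x + 1 by rewrite ltr_wpDl// subr_ge0.
have e0 : 0 < e by rewrite divr_gt0// divr_gt0.
pose eta := eps / 2 / (K + 1).
have eta0 : 0 < eta by rewrite divr_gt0// ?divr_gt0// ltr_wpDl.
have [U [oU NU Ueta]] := outer_measure_open_le N eta0.
have Nneg : mu.-negligible N by exists N; split.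
have {}Ueta : (mu U <= eta%:E)%E.
  by rewrite (le_trans Ueta)// (negligible_outer_measure N).1// add0e.
have mU : measurable U by exact: open_measurable.
have mUI (i : interval R) : measurable (U `&` [set` i]).
  by apply: measurableI => //; exact: measurable_itv.
have muUI (i : interval R) : (mu (U `&` [set` i]) <= eta%:E)%E.
  apply: (le_trans _ Ueta); apply: le_measure; rewrite ?inE; [exact: mUI|exact: mU|exact: subIsetl].
have muUIfin (i : interval R) : mu (U `&` [set` i]) \is a fin_num.
  by rewrite ge0_fin_numE ?measure_ge0// (le_lt_trans (muUI i))// ltry.
pose m t := fine (mu (U `&` `[x, t])).
have mS t u : x <= t -> t <= u ->
    m u = m t + fine (mu (U `&` `]t, u])).
  move=> xt tu; rewrite /m -fineD//; congr fine.
  rewrite -measureU; [|exact: mUI|exact: mUI|]; last first.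
    rewrite -subset0 => z [[_ /=]]; rewrite in_itv/= => /andP[_ zt] [_ /=].
    by rewrite in_itv/= ltNge zt.
  congr (mu _); rewrite -setIUr; congr (_ `&` _).
  by rewrite -itv_bndbnd_setU ?bnd_simp.
have mS0 t u : t <= u -> 0 <= fine (mu (U `&` `]t, u])) <= u - t.
  move=> tu; rewrite fine_ge0 ?measure_ge0//= -lee_fin fineK//.
  have -> : (u - t)%:E = mu `]t, u].
    rewrite lebesgue_measure_itv/= lte_fin; case: ltP => //.
    by move=> ut; have -> : t = u; [apply/le_anti; rewrite tu ut|rewrite subrr].
  by apply: le_measure; rewrite ?inE; [exact: mUI|exact: measurable_itv|exact: subIsetr].
pose g t := f t - e * t - (K + 1) * m t.
have mlip s t : x <= s <= y -> x <= t <= y -> `|m s - m t| <= `|s - t|.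
  wlog ts : s t / t <= s.
    move=> wl sxy txy; case: (leP t s) => ts; first exact: wl.
    by rewrite distrC [leRHS]distrC; apply: wl => //; exact: ltW.
  move=> /andP[xs sy] /andP[xt ty].
  rewrite (mS t s)// addrAC subrr add0r.
  have /andP[m0 m1] := mS0 _ _ ts.
  by rewrite ger0_norm// ger0_norm ?subr_ge0.
have gyx : g y <= g x.
  apply: (@lip_locally_nonincreasing g x y (K + e + (K + 1))) => //.
    move=> s t sxy txy.
    have -> : g s - g t = (f s - f t) - e * (s - t) - (K + 1) * (m s - m t).
      by rewrite /g; ring.
    rewrite (le_trans (ler_normB _ _))// [leRHS]mulrDl lerD//.
      rewrite (le_trans (ler_normB _ _))// [leRHS]mulrDl lerD ?flip//.
      by rewrite normrM (gtr0_norm e0).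
    by rewrite normrM ger0_norm ?addr_ge0// ler_wpM2l ?addr_ge0// mlip.
  move=> t /andP[xt ty].
  have [Nt|Nt] := pselect (N t).
    have /= := open_nbhs_nbhs (conj oU (NU _ Nt)).
    move=> /nbhs_ballP[d /= d0 dU].
    exists (Num.min d (y - t)); first by rewrite lt_min d0 subr_gt0.
    move=> h /andP[h0]; rewrite lt_min => /andP[hd hy].
    rewrite /g (mS t (t + h)) ?lerDl ?(ltW h0)//.
    have -> : U `&` `]t, t + h] = `]t, t + h]%classic.
      apply/seteqP; split => [z []//|z zth]; split => //; apply: dU.
      rewrite /ball/= distrC; move: zth; rewrite /= in_itv/= => /andP[tz zth].
      by rewrite gtr0_norm ?subr_gt0//; lra.
    rewrite lebesgue_measure_itv/= lte_fin ltrDl h0 -EFinD/=.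
    (* on [U] the Lipschitz growth [K * h] is beaten by [(K + 1) * h] *)
    have := flip (t + h) t.
    have -> : x <= t + h <= y by apply/andP; split; lra.
    have -> : x <= t <= y by rewrite xt ltW.
    move=> /(_ isT isT) /ler_normlW.
    rewrite addrAC subrr add0r (gtr0_norm h0).
    have eh0 : 0 < e * h by rewrite mulr_gt0.
    nra.
  have Ft : forall e, 0 < e -> \forall h \near 0^'+, f (t + h) <= f t + e * h.
    apply: contrapT => H; apply: Nt; apply: NP => /= H1; apply: H.
    by apply: H1; rewrite xt ty.
  have [d d0 dF] := Ft e e0.
  exists d => // h /andP[h0 hd].
  have fth : f (t + h) <= f t + e * h.
    by apply: dF => //=; rewrite sub0r normrN gtr0_norm.
  rewrite /g (mS t (t + h)) ?lerDl ?(ltW h0)//.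
  have /andP[m0 _] := mS0 t (t + h) ltac:(by rewrite lerDl ltW).
  have : 0 <= (K + 1) * fine (mu (U `&` `]t, t + h])) by rewrite mulr_ge0// addr_ge0.
  lra.
have mx0 : 0 <= m x by rewrite fine_ge0 ?measure_ge0.
have my : (K + 1) * m y <= eps / 2.
  rewrite mulrC -ler_pdivlMr ?ltr_wpDl//.
  by rewrite -lee_fin fineK.
have ey : e * (y - x) <= eps / 2.
  rewrite /e -mulrA ler_piMr ?divr_ge0 ?(ltW eps0)//.
  by rewrite ler_pdivrMl// mulr1 lerDl.
have : 0 <= (K + 1) * m x by rewrite mulr_ge0// addr_ge0.
by move: gyx; rewrite /g; lra.
Qed.

(** A cover by intervals is mapped to a cover by intervals whose lengths have
    grown at most by the factor [2 * K]. *)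
Lemma negligible_lip_image f K (N : set R) :
  (forall s t, `|f s - f t| <= K * `|s - t|) ->
  mu.-negligible N -> mu.-negligible (f @` N).
Proof.
move=> flip /negligible_outer_measure N0; apply/negligible_outer_measure.
apply/eqP; rewrite eq_le outer_measure_ge0 andbT.
have K0 : 0 <= K.
  by have := flip 1 0; rewrite subr0 normr1 mulr1; apply: le_trans.
apply/lee_addgt0Pr => eps eps0; rewrite add0e.
pose e := eps / (2 * K + 1).
have K20 : 0 < 2 * K + 1 by rewrite ltr_wpDl// mulr_ge0.
have e0 : 0 < e by rewrite divr_gt0.
have [F [FI NF] Fe] : exists2 I_, open_itv_cover N I_ &
    (\sum_(0 <= k <oo) @wlength R idfun (I_ k) <= e%:E)%E.
  have : ((wlength idfun)^* N)%mu \is a fin_num by rewrite N0.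
  rewrite outer_measure_open_itv_cover.
  move=> /lb_ereal_inf_adherent-/(_ _ e0)[_/= [F]] AF <- Fe.
  exists F => //; rewrite ltW//.
  by move: Fe; rewrite -outer_measure_open_itv_cover N0 add0e.
pose G k := f @` (N `&` F k).
have NG : f @` N `<=` \bigcup_k G k.
  by move=> _ [z Nz <-]; have [k _ Fkz] := NF _ Nz; exists k => //; exists z.
apply: (@le_trans _ _ ((wlength idfun)^* (\bigcup_k G k))%mu).
  exact: le_outer_measure.
apply: (@le_trans _ _ (\sum_(0 <= k <oo) (wlength idfun)^* (G k))%mu%E).
  exact: outer_measure_sigma_subadditive.
have GF k : (((wlength idfun)^* (G k))%mu <= (2 * K)%:E * wlength idfun (F k))%E.
  have [->|/set0P[_ [c [Nc Fc] _]]] := eqVneq (G k) set0.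
    by rewrite outer_measure0 mule_ge0// ?lee_fin ?mulr_ge0.
  have [[u v] /= Fuv] := FI k.
  have uv : u < c < v by move: Fc; rewrite Fuv/= in_itv.
  rewrite Fuv wlength_itv/= lte_fin.
  have -> : u < v by case/andP: uv; exact: lt_trans.
  have GI : G k `<=` `[f c - K * (v - u), f c + K * (v - u)]%classic.
    move=> _ [z [_ Fz] <-]; rewrite /= in_itv/= -ler_distl distrC.
    rewrite distrC (le_trans (flip _ _))// ler_wpM2l//.
    have : u < z < v by move: Fz; rewrite Fuv/= in_itv.
    move: uv => /andP[? ?] /andP[? ?].
    by rewrite ler_norml; apply/andP; split; lra.
  apply: (@le_trans _ _ (mu `[f c - K * (v - u), f c + K * (v - u)]%classic)).
    exact: le_outer_measure.
  rewrite lebesgue_measure_itv/=.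
  case: ifPn => _; rewrite -?EFinD -?EFinM lee_fin; last first.
    by rewrite mulr_ge0 ?mulr_ge0// subr_ge0; case/andP: uv => /ltW ? /ltW; exact: le_trans.
  lra.
apply: (@le_trans _ _ (\sum_(0 <= k <oo) ((2 * K)%:E * wlength idfun (F k)))%E).
  by apply: lee_nneseries => k * ; [exact: outer_measure_ge0|exact: GF].
rewrite nneseriesZl//.
apply: (@le_trans _ _ ((2 * K)%:E * e%:E)%E).
  by rewrite lee_wpmul2l// lee_fin mulr_ge0.
rewrite -EFinM lee_fin /e mulrCA ler_piMr ?(ltW eps0)//.
by rewrite ler_pdivrMr// mul1r lerDl.
Qed.
End real_analysis.

(** * First-order expansions *)

Section first_order.
Variable R : realType.
Implicit Types (f g : R -> R) (x y t l : R).

Lemma near0_norm_lt (d : R) : 0 < d -> \forall h \near (0 : R), `|h| < d.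
Proof.
move=> d0; apply/nbhs_ballP; exists d => //= h.
by rewrite /ball/= sub0r normrN.
Qed.

Lemma is_derive1_nearP f t l :
  is_derive t 1 f l <->
  forall e, 0 < e -> \forall h \near 0, `|f (t + h) - f t - l * h| <= e * `|h|.
Proof.
split=> [/is_derive1_caratheodory [g [fg cg gl]] e e0|H].
  have : \forall h \near 0, `|g t - g (t + h)| <= e.
    have : \forall z \near t, `|g t - g z| <= e.
      by move/cvgrPdist_le : cg; apply.
    move=> /nbhs_ballP[d /= d0 dP]; near=> h; apply: dP.
    rewrite /ball/= opprD addrA subrr sub0r normrN.
    by near: h; apply: near0_norm_lt.
  apply: filterS => h; rewrite gl => gh.
  rewrite (_ : _ - l * h = (g (t + h) - l) * h); last first.
    by rewrite fg [t + h]addrC addrK mulrBl.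
  by rewrite normrM ler_wpM2r// distrC.
apply/is_derive1_caratheodory.
exists (fun z => if z == t then l else (f z - f t) / (z - t)).
split; last by rewrite eqxx.
- by move=> z; case: eqVneq => [->|zt]; rewrite ?subrr ?mulr0// divfK// subr_eq0.
- rewrite /prop_for /continuous_at eqxx; apply/cvgrPdist_le => e e0.
  have /nbhs_ballP[d /= d0 dP] := H e e0.
  apply/nbhs_ballP; exists d => //= z; rewrite /ball/= => tz.
  case: eqVneq => [_|zt]; first by rewrite subrr normr0 ltW.
  have zt0 : z - t != 0 by rewrite subr_eq0.
  have /dP : ball 0 d (z - t) by rewrite /ball/= sub0r normrN distrC.
  rewrite subrKC => h.
  rewrite -(ler_pM2r (x := `|z - t|)) ?normr_gt0// -normrM mulrBl divfK//.
  by rewrite distrC.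
Unshelve. all: by end_near. Qed.

Lemma derivable_is_derive1 f t : derivable f t 1 -> is_derive t 1 f (derive1 f t).
Proof. by move=> ft; apply: DeriveDef => //; rewrite derive1E. Qed.

Definition right_dini_le0 f t :=
  forall e, 0 < e -> \forall h \near 0^'+, f (t + h) <= f t + e * h.

Lemma is_derive_right_dini f t l : is_derive t 1 f l -> l <= 0 ->
  right_dini_le0 f t.
Proof.
move=> /is_derive1_nearP ft l0 e e0.
near=> h.
have h0 : 0 < h by near: h; exact: nbhs_right_gt.
have : `|f (t + h) - f t - l * h| <= e * `|h|.
  by near: h; apply: cvg_within; exact: ft.
move=> /ler_normlW; rewrite (gtr0_norm h0) => H.
have : l * h <= 0 by rewrite mulr_le0_ge0// ltW.
by lra.
Unshelve. all: by end_near. Qed.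

(** Only the functions that attain the maximum at [t] matter, as the other one
    stays below for a short time by continuity. *)
Lemma right_dini_max f g t : {for t, continuous f} -> {for t, continuous g} ->
  (g t <= f t -> right_dini_le0 f t) -> (f t <= g t -> right_dini_le0 g t) ->
  right_dini_le0 (fun s => Num.max (f s) (g s)) t.
Proof.
wlog gf : f g / g t <= f t.
  move=> wl cf cg Hf Hg; case: (leP (g t) (f t)) => gf; first exact: wl.
  move=> e e0; have := wl g f (ltW gf) cg cf Hg Hf e e0.
  by apply: filterS => h; rewrite ![Num.max (g _) _]maxC.
move=> cf cg /(_ gf) Hf Hg e e0.
have [fg|fg] := leP (f t) (g t).
  have {}Hg := Hg fg.
  have fgt : f t = g t by apply/le_anti; rewrite fg gf.
  have := Hf e e0; have := Hg e e0; apply: filterS2 => h.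
  by move=> Hgh Hfh; rewrite /= ge_max -{1}fgt Hfh Hgh.
have gnear : \forall h \near 0^'+, g (t + h) <= f t.
  have : \forall z \near t, g z < f t by apply: cvgr_lt cg _ fg.
  move=> /nbhs_ballP[d /= d0 dP]; near=> h; apply/ltW/dP.
  rewrite /ball/= opprD addrA subrr sub0r normrN.
  by near: h; apply: cvg_within; exact: near0_norm_lt.
near=> h.
have h0 : 0 < h by near: h; exact: nbhs_right_gt.
rewrite /= ge_max; apply/andP; split.
  by near: h; exact: Hf.
rewrite (@le_trans _ _ (f t))//; first by near: h.
by rewrite lerDl mulr_ge0// ltW.
Unshelve. all: by end_near. Qed.

Lemma lip_continuous f (I : set R) K t : (forall s u, I s -> I u -> `|f s - f u| <= K * `|s - u|) ->
  nbhs t I -> {for t, continuous f}.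
Proof.
move=> fL It; apply/cvgrPdist_le => e e0.
have It' := nbhs_singleton It.
have Kp : 0 < Num.max K 0 + 1 by rewrite ltr_wpDl// le_max lexx orbT.
near=> s.
have Is : I s by near: s.
apply: (le_trans (fL _ _ It' Is)).
apply: (@le_trans _ _ ((Num.max K 0 + 1) * `|t - s|)).
  by rewrite ler_wpM2r// (@le_trans _ _ (Num.max K 0)) ?le_max ?lexx// lerDl.
rewrite mulrC -ler_pdivlMr//.
near: s; apply/nbhs_ballP; exists (e / (Num.max K 0 + 1)) => /=.
  by rewrite divr_gt0.
by move=> s /ltW.
Unshelve. all: by end_near. Qed.

Lemma is_derive_MVT f df x y : x < y ->
  (forall t, x <= t <= y -> is_derive t 1 f (df t)) ->
  exists2 c, x < c < y & f y - f x = df c * (y - x).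
Proof.
move=> xy fdf.
have df' t : t \in `]x, y[ -> is_derive t 1 f (df t).
  by rewrite in_itv/= => /andP[/ltW xt /ltW ty]; apply: fdf; rewrite xt.
have cf : {within `[x, y], continuous f}.
  apply: continuous_in_subspaceT => t; rewrite inE/= in_itv/= => txy.
  by have [/derivable1_diffP/differentiable_continuous] := fdf _ txy.
have [c cxy E] := MVT xy df' cf.
by exists c => //; move: cxy; rewrite in_itv.
Qed.

End first_order.

(** * The sliding system and its comparison principle *)

Section slide_system.
Variable R : realType.
Notation mu := (@lebesgue_measure R).

Definition lip_on (I : set R) (f : R -> R) :=
  exists K, forall s t, I s -> I t -> `|f s - f t| <= K * `|s - t|.

Lemma lip_onW (I : set R) f : lip_on I f ->
  exists2 K, 0 <= K & forall s t, I s -> I t -> `|f s - f t| <= K * `|s - t|.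
Proof.
move=> [K KP]; exists (Num.max K 0); first by rewrite le_max lexx orbT.
move=> s t Is It; apply: (le_trans (KP _ _ Is It)).
by rewrite ler_wpM2r// le_max lexx.
Qed.

Lemma lip_onS (I J : set R) f : I `<=` J -> lip_on J f -> lip_on I f.
Proof. by move=> IJ [K KP]; exists K => s t /IJ Js /IJ; exact: KP. Qed.

Lemma lip_onB (I : set R) f g : lip_on I f -> lip_on I g ->
  lip_on I (fun t => f t - g t).
Proof.
move=> [K KP] [J JP]; exists (K + J) => s t Is It.
have -> : f s - g s - (f t - g t) = (f s - f t) - (g s - g t) by ring.
by rewrite (le_trans (ler_normB _ _))// mulrDl lerD ?KP// JP.
Qed.

Lemma lip_on_max (I : set R) f g : lip_on I f -> lip_on I g ->
  lip_on I (fun t => Num.max (f t) (g t)).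
Proof.
move=> /lip_onW[K K0 KP] /lip_onW[J J0 JP]; exists (K + J) => s t Is It.
rewrite mulrDl.
have KJ : 0 <= K * `|s - t| by rewrite mulr_ge0.
have JK : 0 <= J * `|s - t| by rewrite mulr_ge0.
have := KP _ _ Is It; have := JP _ _ Is It.
rewrite !ler_norml => /andP[? ?] /andP[? ?]; apply/andP.
by case: (leP (f s) (g s)) => ?; case: (leP (f t) (g t)) => ?; split; lra.
Qed.

Lemma lip_on_mul (x y : R) f g : lip_on `[x, y] f -> lip_on `[x, y] g ->
  lip_on `[x, y] (fun t => f t * g t).
Proof.
have [xy|yx] := leP x y; last first.
  by move=> _ _; exists 0 => s t /=; rewrite in_itv/= => /andP[xs sy]; lra.
move=> /lip_onW[K K0 KP] /lip_onW[J J0 JP].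
have Ix : `[x, y]%classic x by rewrite /= in_itv/= lexx.
pose M (h : R -> R) C := `|h x| + C * (y - x).
have bnd h C s : 0 <= C -> (forall s t, `[x, y]%classic s -> `[x, y]%classic t ->
    `|h s - h t| <= C * `|s - t|) -> `[x, y]%classic s -> `|h s| <= M h C.
  move=> C0 hC Is.
  have -> : h s = h x + (h s - h x) by rewrite subrKC.
  rewrite (le_trans (ler_normD _ _))// lerD2l (le_trans (hC _ _ Is Ix))//.
  rewrite ler_wpM2l//; move: Is; rewrite /= in_itv/= => /andP[? ?].
  by rewrite ger0_norm ?subr_ge0// lerD2r.
exists (M g J * K + M f K * J) => s t Is It.
have -> : f s * g s - f t * g t = (f s - f t) * g s + f t * (g s - g t) by ring.
rewrite (le_trans (ler_normD _ _))// !normrM mulrDl lerD//.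
- rewrite -mulrA mulrC ler_pM//; [exact: bnd|exact: KP].
- rewrite -mulrA ler_pM//; [exact: bnd|exact: JP].
Qed.

Lemma lip_on_expN (t0 C : R) : 0 <= C ->
  lip_on `[t0, +oo[ (fun t => expR (- (C * (t - t0)))).
Proof.
move=> C0; exists C => s t.
wlog st : s t / s <= t.
  move=> wl Is It; case: (leP s t) => st; first exact: wl.
  by rewrite distrC [`|s - t|]distrC; apply: wl => //; exact: ltW.
rewrite /= !in_itv/= !andbT => ts tt.
have -> : - (C * (t - t0)) = - (C * (s - t0)) + (- (C * (t - s))) by ring.
set u := C * (s - t0); set v := C * (t - s).
have u0 : 0 <= u by rewrite mulr_ge0// subr_ge0.
have v0 : 0 <= v by rewrite mulr_ge0// subr_ge0.
rewrite expRD -[X in X - _]mulr1 -mulrBr normrM distrC (ger0_norm (expR_ge0 _)).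
rewrite [`|s - t|]distrC (ger0_norm (_ : 0 <= t - s)) ?subr_ge0// -/v.
have eu : expR (- u) <= 1 by rewrite -expR0 ler_expR oppr_le0.
have ev : expR (- v) <= 1 by rewrite -expR0 ler_expR oppr_le0.
have ev1 := expR_ge1Dx (- v).
rewrite distrC ger0_norm ?subr_ge0//.
by rewrite (@le_trans _ _ (1 - expR (- v)))// ?ler_piMl ?subr_ge0//; lra.
Qed.

(** Differentiability forces both one-sided slopes, which have opposite signs
    at a maximum, to agree. *)
Lemma is_derive1_max (f : R -> R) (t l : R) : is_derive t 1 f l ->
  (\forall z \near t, f z <= f t) -> l = 0.
Proof.
move=> /is_derive1_nearP fl /nbhs_ballP[d /= d0 dP].
apply/eqP; rewrite -normr_eq0 eq_le normr_ge0 andbT.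
apply/ler_addgt0Pl => e e0; rewrite addr0.
have /nbhs_ballP[d' /= d'0 d'P] := fl _ e0.
pose h := Num.min d d' / 2.
have h0 : 0 < h by rewrite divr_gt0// lt_min d0.
have hm : h < Num.min d d' by rewrite ltr_pdivrMr// ltr_pMr ?ltr1n// lt_min d0.
have [hd hd'] : h < d /\ h < d' by move: hm; rewrite lt_min => /andP.
have ball1 s : `|s| = h -> f (t + s) <= f t.
  by move=> sh; apply: dP; rewrite /ball/= opprD addrA subrr sub0r normrN sh.
have ball2 s : `|s| = h -> `|f (t + s) - f t - l * s| <= e * `|s|.
  by move=> sh; apply: d'P; rewrite /ball/= sub0r normrN sh.
have nh : `|h| = h by rewrite gtr0_norm.
have nNh : `|- h| = h by rewrite normrN.
have := ball1 _ nh; have := ball2 _ nh; have := ball1 _ nNh; have := ball2 _ nNh.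
rewrite nh nNh !ler_norml => /andP[A1 A2] B1 /andP[A3 A4] B2.
by apply/andP; split; rewrite -(ler_pM2r h0); lra.
Qed.

Lemma aeS (A B : R -> Prop) : {ae mu, forall t, A t} ->
  (forall t, A t -> B t) -> {ae mu, forall t, B t}.
Proof.
move=> aeA AB; have FF := @ae_filter_ringOfSetsType _ _ _ mu.
exact: filterS aeA.
Qed.

Lemma aeI (A B : R -> Prop) : {ae mu, forall t, A t} ->
  {ae mu, forall t, B t} -> {ae mu, forall t, A t /\ B t}.
Proof.
move=> aeA aeB; have FF := @ae_filter_ringOfSetsType _ _ _ mu.
exact: filterI aeA aeB.
Qed.

Lemma ae_neq (t0 : R) : {ae mu, forall t, t != t0}.
Proof.
exists [set t0]; split; first exact: measurable_set1.
  by rewrite lebesgue_measure_set1.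
by move=> t /= /negP; rewrite negbK => /eqP.
Qed.

Variables (P : R -> R) (Lm F0 : R) (beta : R -> R).

(** The motion of the contact points [a] and [b] of a drop: [P l] is half the
    squared slope at the back of a drop of length [l], and [F0] its weight along
    the incline, so that [P l + F0] is half the squared slope at the front. At
    the maximal length [Lm] the slope at the back vanishes, and the law only
    bounds the velocity of [a] from below. *)
Definition slide_law (a b : R -> R) (t : R) :=
  exists a' b', [/\ is_derive t 1 a a', is_derive t 1 b b',
    b' = P (b t - a t) + F0 - beta (b t),
    beta (a t) - P (b t - a t) <= a' &
    b t - a t < Lm -> a' = beta (a t) - P (b t - a t)].

(** Both velocities are only bounded from below, so that a pinned drop at rest
    qualifies. *)
Definition slide_superlaw (a b : R -> R) (t : R) :=
  exists a' b', [/\ is_derive t 1 a a', is_derive t 1 b b',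
    P (b t - a t) + F0 - beta (b t) <= b' &
    beta (a t) - P (b t - a t) <= a'].

Definition slide_gen (law : (R -> R) -> (R -> R) -> R -> Prop) (I : set R)
    (a b : R -> R) :=
  [/\ lip_on I a, lip_on I b, forall t, I t -> 0 < b t - a t <= Lm &
      {ae mu, forall t, I t -> law a b t}].

Definition slides := slide_gen slide_law.
Definition superslides := slide_gen slide_superlaw.

Lemma slides_super I a b : slides I a b -> superslides I a b.
Proof.
case=> la lb L ae; split => //; apply: aeS ae _ => t H It.
by have [a' [b' [da db bE ab _]]] := H It; exists a', b'; split => //; rewrite bE.
Qed.

Hypothesis P_nincr : forall l l', 0 < l -> l <= l' -> l' <= Lm -> P l' <= P l.
Variable K : R.
Hypothesis K_ge0 : 0 <= K.
Hypothesis beta_lip : forall x y, `|beta x - beta y| <= K * `|x - y|.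

Let beta_diff x y : y <= x -> beta x - beta y <= K * (x - y).
Proof.
move=> yx; rewrite -[x - y in leRHS]ger0_norm ?subr_ge0//.
exact: le_trans (ler_norm _) (beta_lip _ _).
Qed.

(** The length is maximal there, so that its derivative vanishes. *)
Lemma contact_derive (a b : R -> R) t0 t a' b' :
  (forall t, t0 <= t -> 0 < b t - a t <= Lm) -> t0 < t ->
  is_derive t 1 a a' -> is_derive t 1 b b' -> b t - a t = Lm -> a' = b'.
Proof.
move=> L t0t da db tL.
have db' : is_derive t 1 (b \- a) (b' - a') by exact: is_deriveB.
apply/esym/eqP; rewrite -subr_eq0; apply/eqP.
apply: (is_derive1_max db'); near=> z; rewrite /= tL.
suff /L/andP[] : t0 <= z by [].
by apply/ltW; near: z; exact: lt_nbhsr.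
Unshelve. all: by end_near. Qed.

(** The system is cooperative: [b - a] decreases the driving term of [b] and
    increases that of [a], so that the larger of the two excesses, [a1 - a2]
    and [b1 - b2], obeys Gronwall's inequality. Where the first drop has
    maximal length and the excess of [a] is the larger one, the second drop has
    maximal length as well; both drops then move rigidly, with the velocity of
    their front. *)
Theorem slide_comparison (t0 : R) a1 b1 a2 b2 :
  slides `[t0, +oo[ a1 b1 -> superslides `[t0, +oo[ a2 b2 ->
  a1 t0 <= a2 t0 -> b1 t0 <= b2 t0 ->
  forall t, t0 <= t -> a1 t <= a2 t /\ b1 t <= b2 t.
Proof.
move=> [la1 lb1 L1 ae1] [la2 lb2 L2 ae2] a12 b12 T t0T.
have L1' t : t0 <= t -> 0 < b1 t - a1 t <= Lm.
  by move=> ?; apply: L1; rewrite /= in_itv/= andbT.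
have L2' t : t0 <= t -> 0 < b2 t - a2 t <= Lm.
  by move=> ?; apply: L2; rewrite /= in_itv/= andbT.
(* the weight [e] absorbs the Gronwall growth, at rate [K] *)
pose e t := expR (- (K * (t - t0))).
pose f t := e t * (a1 t - a2 t).
pose g t := e t * (b1 t - b2 t).
pose phi t := Num.max (Num.max (f t) (g t)) 0.
have sub : `[t0, T] `<=` `[t0, +oo[%classic.
  by move=> t /=; rewrite !in_itv/= => /andP[->].
have le_ : lip_on `[t0, T] e by apply: lip_onS sub _; exact: lip_on_expN.
have lf : lip_on `[t0, T] f.
  by apply: lip_on_mul => //; apply: lip_onB; apply: lip_onS sub _.
have lg : lip_on `[t0, T] g.
  by apply: lip_on_mul => //; apply: lip_onB; apply: lip_onS sub _.
have lphi : lip_on `[t0, T] phi.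
  by do 2?[apply: lip_on_max => //]; exists 0 => s t _ _; rewrite subrr normr0 mul0r.
suff : phi T <= phi t0.
  have -> : phi t0 = 0.
    rewrite /phi /f /g /e subrr mulr0 oppr0 expR0 !mul1r.
    by apply/max_idPr; rewrite ge_max !subr_le0 a12.
  rewrite /phi !ge_max => /andP[/andP[fT gT] _]; move: fT gT.
  by rewrite /f /g !pmulr_rle0 ?expR_gt0// !subr_le0.
case: lphi => C phiC.
apply: (@lip_ae_nonincreasing _ phi t0 T C) => //.
apply: aeS (aeI (aeI ae1 ae2) (ae_neq t0)) _.
move=> t [[{}ae1 {}ae2] tt0] /andP[t0t tT].
have {}t0t : t0 < t by rewrite lt_neqAle eq_sym tt0.
have It : `[t0, +oo[%classic t by rewrite /= in_itv/= andbT ltW.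
have [a1' [b1' [da1 db1 b1E a1ge a1E]]] := ae1 It.
have [a2' [b2' [da2 db2 b2ge a2ge]]] := ae2 It.
have nb : nbhs t (`[t0, T]%classic : set R).
  apply: filterS (near_in_itvoo (_ : t \in `]t0, T[)) => [z|].
    by rewrite /= !in_itv/= => /andP[/ltW -> /ltW ->].
  by rewrite in_itv/= t0t.
have cf : {for t, continuous f} by case: lf => C' fC'; exact: (lip_continuous fC' nb).
have cg : {for t, continuous g} by case: lg => C' gC'; exact: (lip_continuous gC' nb).
have de : is_derive t 1 e (- K * e t).
  by rewrite /e; apply: is_derive_eq; rewrite /GRing.scale/=; ring.
have df : is_derive t 1 f (e t * ((a1' - a2') - K * (a1 t - a2 t))).
  rewrite /f; apply: is_derive_eq.
  by rewrite /GRing.scale/=; ring.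
have dg : is_derive t 1 g (e t * ((b1' - b2') - K * (b1 t - b2 t))).
  rewrite /g; apply: is_derive_eq.
  by rewrite /GRing.scale/=; ring.
have e0 : 0 < e t by exact: expR_gt0.
have /andP[L1p L1m] := L1' _ (ltW t0t).
have /andP[L2p L2m] := L2' _ (ltW t0t).
have cmax : {for t, continuous (fun s => Num.max (f s) (g s))}.
  by have [C' C'P] := lip_on_max lf lg; exact: (lip_continuous C'P nb).
apply: (@right_dini_max _ (fun s => Num.max (f s) (g s)) (cst 0) t) => //.
- exact: cst_continuous.
- rewrite /= le_max => fg0.
  apply: (@right_dini_max _ f g t) => // [gf|fg].
    have {fg0}f0 : 0 <= f t by case/orP : fg0 => // /le_trans; exact.
    apply: (is_derive_right_dini df); rewrite pmulr_rle0//.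
    move: f0 gf; rewrite /f /g (pmulr_rge0 _ e0) (ler_pM2l e0) => f0 gf.
    have [L1lt|L1ge] := ltP (b1 t - a1 t) Lm.
      rewrite (a1E L1lt).
      have := P_nincr L1p _ L2m; have := @beta_diff (a1 t) (a2 t); lra.
    have L1e : b1 t - a1 t = Lm by apply/le_anti; rewrite L1m.
    have L2e : b2 t - a2 t = Lm by apply/le_anti; rewrite L2m; lra.
    have a1b1 : a1' = b1' := contact_derive L1' t0t da1 db1 L1e.
    have a2b2 : a2' = b2' := contact_derive L2' t0t da2 db2 L2e.
    rewrite a1b1 a2b2; move: b2ge; rewrite b1E L1e L2e.
    have bb : b1 t - b2 t = a1 t - a2 t by lra.
    have := beta_lip (b1 t) (b2 t).
    by rewrite ler_norml bb (ger0_norm f0) => /andP[]; lra.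
  have {fg0}g0 : 0 <= g t by case/orP : fg0 => // ?; exact: le_trans fg.
  apply: (is_derive_right_dini dg); rewrite pmulr_rle0//.
  move: g0 fg; rewrite /f /g (pmulr_rge0 _ e0) (ler_pM2l e0) => g0 fg.
  rewrite b1E.
  have := P_nincr L2p _ L1m.
  have := beta_lip (b1 t) (b2 t).
  by rewrite ler_norml (ger0_norm g0) => /andP[]; lra.
- move=> _; apply: (is_derive_right_dini (is_derive_cst _ _ _)); exact: lexx.
Qed.

End slide_system.

(** * The front eventually advances *)

Section slide_velocity.
Variable R : realType.
Notation mu := (@lebesgue_measure R).
Implicit Types (a b f : R -> R) (s t x y : R).

Lemma lip_ae_derive_le f x y C : x <= y -> lip_on `[x, y] f ->
  {ae mu, forall t, x < t < y -> exists2 l, is_derive t 1 f l & l <= C} ->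
  f y - f x <= C * (y - x).
Proof.
move=> xy lf ae.
suff : f y - C * y <= f x - C * x by lra.
have [K KP] : lip_on `[x, y] (fun t => f t - C * t).
  apply: lip_onB => //; exists `|C| => s t _ _.
  by rewrite -mulrBr normrM.
apply: (@lip_ae_nonincreasing _ (fun t => f t - C * t) x y K) => //.
apply: aeS (aeI ae (ae_neq x)) _ => t [{}ae tx] /andP[xt ty].
have {}xt : x < t by rewrite lt_neqAle eq_sym tx.
have [l dl lC] := ae (introT andP (conj xt ty)).
apply: (@is_derive_right_dini _ (fun t => f t - C * t) t (l - C)); last lra.
by apply: is_derive_eq; rewrite /GRing.scale/=; ring.
Qed.

Variables (P : R -> R) (Lm F0 : R) (beta : R -> R) (K : R).
Hypothesis P_nincr : forall l l', 0 < l -> l <= l' -> l' <= Lm -> P l' <= P l.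
Hypothesis P_cont : forall l, 0 < l -> {for l, continuous P}.
Hypothesis beta_lip : forall x y, `|beta x - beta y| <= K * `|x - y|.

Definition front_speed a b t := P (b t - a t) + F0 - beta (b t).
Local Notation slides := (slides P Lm F0 beta).

Lemma beta_cont : continuous beta.
Proof.
move=> x; apply: (@lip_continuous _ beta setT K) => //.
exact: filterT.
Qed.

Lemma slides_cont t0 a b t : slides `[t0, +oo[ a b -> t0 < t ->
  {for t, continuous a} /\ {for t, continuous b}.
Proof.
move=> [[Ka la] [Kb lb] _ _] t0t.
have nb : nbhs t (`[t0, +oo[%classic : set R).
  near=> z; rewrite /= in_itv/= andbT ltW//; near: z; exact: lt_nbhsr.
by split; [exact: (lip_continuous la nb)|exact: (lip_continuous lb nb)].
Unshelve. all: by end_near. Qed.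

Lemma front_speed_cont t0 a b t : slides `[t0, +oo[ a b -> t0 < t ->
  {for t, continuous (front_speed a b)}.
Proof.
move=> sab t0t; have [ca cb] := slides_cont sab t0t.
have [_ _ L _] := sab.
have /andP[L0 _] : 0 < b t - a t <= Lm by apply: L; rewrite /= in_itv/= andbT ltW.
apply: cvgB; last by apply: continuous_comp; [exact: cb|exact: beta_cont].
apply: cvgD; last exact: cvg_cst.
apply: (@continuous_comp _ _ _ (fun t => b t - a t) P); last exact: P_cont.
by apply: cvgB; [exact: cb|exact: ca].
Qed.

(** Although [a] may jump from one speed to another, the speed of the front is
    a continuous function of the position, so that its equation holds at every
    time. *)
Lemma front_derive t0 a b t : slides `[t0, +oo[ a b -> t0 < t ->
  is_derive t 1 b (front_speed a b t).
Proof.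
move=> sab t0t; have gc := front_speed_cont sab t0t.
have [_ lb _ ae] := sab.
set g := front_speed a b in gc *.
apply/is_derive1_nearP => e e0.
have /nbhs_ballP[d /= d0 dP] : \forall z \near t, `|g t - g z| <= e /\ t0 < z.
  apply: filterI; last exact: lt_nbhsr.
  by move/cvgrPdist_le : gc; apply.
have main x y : t - d < x -> x <= y -> y < t + d ->
    t0 <= x -> `|b y - b x - g t * (y - x)| <= e * (y - x).
  move=> tdx xy ytd t0x.
  have sub : `[x, y] `<=` `[t0, +oo[%classic.
    move=> z /=; rewrite !in_itv/= andbT => /andP[+ _].
    exact: le_trans.
  have lb' : lip_on `[x, y] b by apply: lip_onS sub _.
  have dgz z : x < z < y -> `|g t - g z| <= e.
    move=> /andP[xz zy]; suff /dP[] : ball t d z by [].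
    by rewrite /ball/= ltr_norml; apply/andP; split; lra.
  have It z : x < z < y -> `[t0, +oo[%classic z.
    by move=> /andP[xz zy]; apply: sub; rewrite /= in_itv/= !ltW.
  rewrite ler_norml; apply/andP; split.
    have lNb : lip_on `[x, y] (fun t => - b t).
      case: lb' => C CP; exists C => z w Iz Iw.
      by rewrite -opprD normrN; exact: CP.
    have := @lip_ae_derive_le (fun t => - b t) x y (- (g t - e)) xy lNb.
    suff : {ae mu, forall z, x < z < y ->
      exists2 l, is_derive z 1 (fun t => - b t) l & l <= - (g t - e)}.
      by move=> H /(_ H); lra.
    apply: aeS ae _ => z ae xzy; have [a' [b' [_ db b'E _ _]]] := ae (It _ xzy).
    exists (- b'); first by apply: is_deriveN.
    by rewrite b'E -/(front_speed a b z) -/g; move: (dgz _ xzy); rewrite ler_norml; lra.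
  have := @lip_ae_derive_le b x y (g t + e) xy lb'.
  suff : {ae mu, forall z, x < z < y ->
      exists2 l, is_derive z 1 b l & l <= g t + e}.
    by move=> H /(_ H); lra.
  apply: aeS ae _ => z ae xzy; have [a' [b' [_ db b'E _ _]]] := ae (It _ xzy).
  exists b' => //.
  by rewrite b'E -/(front_speed a b z) -/g; move: (dgz _ xzy); rewrite ler_norml; lra.
have t0d : \forall h \near (0:R), `|h| < d /\ t0 < t + h.
  apply: filterI; first exact: near0_norm_lt.
  apply: filterS (near0_norm_lt (_ : 0 < t - t0)); last by rewrite subr_gt0.
  by move=> h; rewrite ltr_norml; lra.
apply: filterS t0d => h; rewrite ltr_norml => -[/andP[dh hd] t0h].
have [h0|h0] := leP 0 h.
  have := @main t (t + h); rewrite (_ : t + h - t = h); last by ring.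
  rewrite (ger0_norm h0); apply; lra.
have := @main (t + h) t; rewrite (_ : t - (t + h) = - h); last by ring.
rewrite (ltr0_norm h0) => H.
rewrite -normrN (_ : - (b (t + h) - b t - g t * h) = b t - b (t + h) - g t * - h);
  last by ring.
apply: H; lra.
Qed.

Variables (M m : R).
Hypothesis beta_le : forall x, beta x <= M.
Hypothesis beta_ge : forall x, m <= beta x.
Hypothesis gravity : M - m < F0.

(** As long as the front does not advance, the drop is so long that its back
    advances with a speed bounded from below: the length decreases linearly. *)
Lemma front_starts t0 a b : slides `[t0, +oo[ a b ->
  exists2 t, t0 < t & 0 < front_speed a b t.
Proof.
move=> sab; apply: contrapT => H.
have gle t : t0 < t -> front_speed a b t <= 0.
  by move=> t0t; rewrite leNgt; apply/negP => gt; apply: H; exists t.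
pose c0 := F0 - (M - m).
have c00 : 0 < c0 by rewrite subr_gt0.
have [la lb L ae] := sab.
pose T := t0 + (Lm + 1) / c0.
have /L/andP[L00 L0m] : `[t0, +oo[%classic t0 by rewrite /= in_itv/= lexx.
have Lm0 : 0 < Lm by apply: lt_le_trans L0m.
have t0T : t0 <= T by rewrite lerDl divr_ge0 ?ltW// addr_gt0.
have /L/andP[LT0 _] : `[t0, +oo[%classic T by rewrite /= in_itv/= t0T.
have : (b T - a T) - (b t0 - a t0) <= - c0 * (T - t0).
  apply: (@lip_ae_derive_le (fun t => b t - a t)) => //.
    by apply: lip_onB; apply: lip_onS _; [|exact: lb| |exact: la];
      move=> t /=; rewrite !in_itv/= => /andP[->].
  apply: aeS ae _ => t ae /andP[t0t tT].
  have [|a' [b' [da db b'E a'ge _]]] := ae; first by rewrite /= in_itv/= ltW.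
  exists (b' - a'); first exact: is_deriveB.
  have := gle _ t0t; have := beta_le (b t); have := beta_ge (a t).
  by rewrite /front_speed -b'E /c0; lra.
have -> : - c0 * (T - t0) = - (Lm + 1).
  by rewrite /T; field; rewrite gt_eqF.
lra.
Qed.

(** If the speed vanished for the first time at [t], then, just before, the
    back would be the faster end, so that [P (b - a)] would increase and the
    speed could decrease through [beta (b)] only: [b' <= K * (b t - b)]. Then
    [b] could not reach [b t] in finite time. *)
Lemma front_keeps_moving t0 a b t1 : slides `[t0, +oo[ a b -> t0 < t1 ->
  0 < front_speed a b t1 -> forall t, t1 <= t -> 0 < front_speed a b t.
Proof.
move=> sab t0t1 g1 t2 t12; rewrite ltNge; apply/negP => g2.
set g := front_speed a b in g1 g2.
have gc t : t0 < t -> {for t, continuous g} by exact: front_speed_cont.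
have db t : t0 < t -> is_derive t 1 b (g t) by exact: front_derive.
pose A := [set t | t1 <= t /\ g t <= 0].
have iA : has_inf A by split; [exists t2 | exists t1 => t []].
set ts := inf A.
have t1ts : t1 <= ts by apply: lb_le_inf; [case: iA|move=> t []].
have t0ts : t0 < ts by apply: lt_le_trans t1ts.
have gpos t : t1 <= t -> t < ts -> 0 < g t.
  move=> t1t tts; rewrite ltNge; apply/negP => gt.
  by have := ge_inf (proj2 iA) (conj t1t gt : A t); rewrite leNgt tts.
have gts : g ts <= 0.
  rewrite leNgt; apply/negP => gts0.
  have /nbhs_ballP[d /= d0 dP] : \forall z \near ts, 0 < g z.
    by apply: cvgr_gt (gc _ t0ts) _ gts0.
  have [t [t1t gt]] := inf_adherent d0 iA.
  rewrite -/ts => ttsd; have tst : ts <= t by apply: ge_inf => //; case: iA.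
  have /dP : ball ts d t by rewrite /ball/= distrC ger0_norm ?subr_ge0//; lra.
  by rewrite ltNge gt.
have t1ltts : t1 < ts.
  by rewrite lt_neqAle t1ts andbT; apply: contraTneq gts => <-; rewrite -ltNge.
pose eps := (F0 - (M - m)) / 2.
have eps0 : 0 < eps by rewrite divr_gt0// subr_gt0.
(* while the speed is at most [eps], the back is faster than the front *)
have [s [t1s sts geps]] : exists s, [/\ t1 <= s, s < ts &
    forall t, s <= t <= ts -> g t <= eps].
  have /nbhs_ballP[d /= d0 dP] : \forall z \near ts, g z < eps.
    by apply: cvgr_lt (gc _ t0ts) _ _; apply: le_lt_trans gts eps0.
  exists (Num.max t1 (ts - d / 2)); split.
  - by rewrite le_max lexx.
  - by rewrite gt_max t1ltts/= ltrBlDr ltrDl divr_gt0.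
  - move=> t; rewrite ge_max => /andP[/andP[t1t dt] tts]; apply/ltW/dP.
    by rewrite /ball/= ger0_norm ?subr_ge0//; lra.
have [la lb L ae] := sab.
have sI x y : s <= x -> `[x, y] `<=` `[t0, +oo[%classic.
  by move=> sx z /=; rewrite !in_itv/= andbT => /andP[xz _]; lra.
have It x : s <= x -> `[t0, +oo[%classic x.
  by move=> sx; rewrite /= in_itv/= andbT; lra.
have Ldec x y : s <= x -> x <= y -> y <= ts -> b y - a y <= b x - a x.
  move=> sx xy yts.
  suff : (b y - a y) - (b x - a x) <= 0 * (y - x) by lra.
  apply: (@lip_ae_derive_le (fun t => b t - a t)) => //.
    by apply: lip_onB; apply: lip_onS (sI _ _ sx) _.
  apply: aeS ae _ => t ae /andP[xt ty].
  have [|a' [b' [da db' b'E a'ge _]]] := ae; first by apply: It; lra.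
  exists (b' - a'); first exact: is_deriveB.
  have : g t <= eps by apply: geps; lra.
  have := beta_le (b t); have := beta_ge (a t).
  by rewrite /g /front_speed -b'E /eps; lra.
have bmono x y : s <= x -> x < y -> y <= ts -> b x < b y.
  move=> sx xy yts; rewrite -subr_gt0.
  have dbxy t : x <= t <= y -> is_derive t 1 b (g t) by move=> ?; apply: db; lra.
  have [c cxy ->] := is_derive_MVT xy dbxy.
  by apply: mulr_gt0; [apply: gpos; lra|rewrite subr_gt0].
have key t : s <= t <= ts -> g t <= K * (b ts - b t).
  move=> /andP[st]; rewrite le_eqVlt => /predU1P[->|tts].
    by rewrite subrr mulr0.
  have bt := bmono _ _ st tts (lexx _).
  have Lt := Ldec _ _ st (ltW tts) (lexx _).
  have /andP[? ?] := L _ (It _ st).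
  have /andP[? ?] := L _ (It _ (ltW sts)).
  have PL : P (b t - a t) <= P (b ts - a ts) by exact: P_nincr.
  have := beta_lip (b ts) (b t); rewrite ler_norml (gtr0_norm (_ : 0 < b ts - b t)) ?subr_gt0//.
  by move: gts; rewrite /g /front_speed; lra.
(* [K * (b ts - b)] bounds the speed, so that [D] is nondecreasing; but it ends at zero *)
pose D t := expR (K * t) * (b ts - b t).
have dD t : s <= t -> is_derive t 1 D (expR (K * t) * (K * (b ts - b t) - g t)).
  move=> st; have dbt : is_derive t 1 b (g t) by apply: db; lra.
  rewrite /D; apply: is_derive_eq.
  by rewrite /GRing.scale/=; ring.
have : D s <= D ts.
  rewrite -subr_ge0.
  have dDs t : s <= t <= ts ->
    is_derive t 1 D (expR (K * t) * (K * (b ts - b t) - g t)) by move=> /andP[/dD].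
  have [c cI ->] := is_derive_MVT sts dDs.
  apply: mulr_ge0; last by rewrite subr_ge0 ltW.
  by apply: mulr_ge0; [exact: expR_ge0|rewrite subr_ge0; apply: key; lra].
rewrite /D subrr mulr0 pmulr_rle0 ?expR_gt0// subr_le0 leNgt.
by rewrite bmono.
Qed.

Theorem front_eventually_moves t0 a b : slides `[t0, +oo[ a b ->
  exists2 t1, t0 < t1 & forall t, t1 <= t ->
    0 < front_speed a b t /\ is_derive t 1 b (front_speed a b t).
Proof.
move=> sab; have [t1 t01 g1] := front_starts sab.
exists t1 => // t t1t; split; first exact: (front_keeps_moving sab t01 g1).
by apply: front_derive sab _; apply: lt_le_trans t1t.
Qed.

End slide_velocity.

(** * Attraction and uniqueness of waves *)

Section wave.
Variable R : realType.
Notation mu := (@lebesgue_measure R).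
Implicit Types (a b A B f : R -> R) (s t x y T : R).

Lemma ae_shift (Q : R -> Prop) s : {ae mu, forall t, Q t} ->
  {ae mu, forall t, Q (t + s)}.
Proof.
move=> aeQ; have sh x y : `|(x - s) - (y - s)| <= 1 * `|x - y|.
  by rewrite mul1r opprB addrA subrK.
have := negligible_lip_image sh aeQ.
apply: negligibleS => t /= Qts; exists (t + s) => //.
by rewrite addrK.
Qed.

Lemma lip_on_shift (I J : set R) f s : (forall t, J t -> I (t + s)) ->
  lip_on I f -> lip_on J (fun t => f (t + s)).
Proof.
move=> JI [C CP]; exists C => t u /JI Jt /JI Ju.
by rewrite (le_trans (CP _ _ Jt Ju))// opprD addrACA subrr addr0.
Qed.

Lemma is_derive1_shift f t s l : is_derive (t + s) 1 f l ->
  is_derive t 1 (fun u => f (u + s)) l.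
Proof.
move=> df; rewrite -[X in is_derive _ _ _ X]mulr1.
apply: (@is_derive1_comp R f (fun u => u + s) t l 1) => //.
by apply: is_derive_eq; rewrite addr0.
Qed.

Lemma nondecreasing_limit f t0 C :
  (forall s t, t0 <= s -> s <= t -> f s <= f t) ->
  (forall t, t0 <= t -> f t <= C) ->
  exists l, forall e, 0 < e -> exists2 t1, t0 <= t1 &
    forall t, t1 <= t -> `|f t - l| <= e.
Proof.
move=> fi fC; pose S := [set f t | t in [set t | t0 <= t]].
have supS : has_sup S.
  by split; [exists (f t0), t0 => /=|exists C => _ [t t0t <-]; exact: fC].
exists (sup S) => e e0.
have [_ [t1 t01 <-] t1e] := sup_adherent e0 supS.
exists t1 => // t t1t.
have ft : f t <= sup S.
  by apply: ub_le_sup; [case: supS|exists t => //=; apply: le_trans t1t].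
rewrite distrC ger0_norm ?subr_ge0//.
by have := fi _ _ t01 t1t; lra.
Qed.

Lemma periodicE f T c : (forall t, f (t + T) = f t + c) ->
  forall (n : nat) t, f (t + T *+ n) = f t + c *+ n.
Proof.
move=> fT; elim=> [|n IH] t; first by rewrite !mulr0n !addr0.
by rewrite !mulrSr !addrA fT IH.
Qed.

Lemma nat_ge x : exists n : nat, x <= n%:R.
Proof.
by exists (Num.trunc (Num.max x 0)).+1; rewrite ltW//
  (le_lt_trans _ (truncnS_gt _))// le_max lexx.
Qed.

Lemma expanding_inverse f v : 0 < v -> continuous f ->
  (forall s t, s <= t -> v * (t - s) <= f t - f s) ->
  exists g : R -> R, [/\ cancel g f, cancel f g &
    forall s t, `|g s - g t| <= v^-1 * `|s - t|].
Proof.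
move=> v0 cf fv.
have fnorm s t : v * `|s - t| <= `|f s - f t|.
  wlog st : s t / t <= s.
    move=> wl; case: (leP t s) => st; first exact: wl.
    by rewrite distrC [`|f s - _|]distrC; apply: wl; exact: ltW.
  by rewrite ger0_norm ?subr_ge0// (le_trans (fv _ _ st))// ler_norm.
have surj x : exists y, f y = x.
  pose r := `|x - f 0| / v.
  have r0 : 0 <= r by rewrite divr_ge0// ltW.
  have rr : - r <= r by lra.
  have vr : v * r = `|x - f 0| by rewrite /r mulrC divfK// gt_eqF.
  have := fv 0 r r0; have := fv (- r) 0; rewrite oppr_le0 => /(_ r0).
  rewrite opprK add0r subr0 vr => f1 f2.
  have /ler_normlP[n1 n2] := lexx `|x - f 0|.
  have [|y _ fy] := @IVT R f _ _ x rr (continuous_subspaceT cf); last by exists y.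
  by rewrite ge_min le_max; apply/andP; split; apply/orP; [left|right]; lra.
pose g x := projT1 (cid (surj x)).
have gK : cancel g f by move=> x; rewrite /g; case: cid.
exists g; split => // [x|s t].
  have := fnorm (g (f x)) x.
  by rewrite gK subrr normr0 pmulr_rle0// normr_le0 subr_eq0 => /eqP.
by rewrite ler_pdivlMl// (le_trans (fnorm _ _))// !gK.
Qed.

Variables (P : R -> R) (Lm F0 : R) (beta : R -> R) (K : R).
Hypothesis P_nincr : forall l l', 0 < l -> l <= l' -> l' <= Lm -> P l' <= P l.
Hypothesis P_decr_unif : forall e, 0 < e -> exists2 eta, 0 < eta &
  forall l l', 0 < l -> l + e <= l' -> l' <= Lm -> P l' + eta <= P l.
Hypothesis P_cont : forall l, 0 < l -> {for l, continuous P}.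
Hypothesis K_ge0 : 0 <= K.
Hypothesis beta_lip : forall x y, `|beta x - beta y| <= K * `|x - y|.
Variables (M m : R).
Hypothesis beta_le : forall x, beta x <= M.
Hypothesis beta_ge : forall x, m <= beta x.
Hypothesis gravity : M - m < F0.
Hypothesis beta_per : forall x, beta (x + 1) = beta x.
Local Notation slides := (slides P Lm F0 beta).
Local Notation front_speed := (front_speed P F0 beta).

Lemma slidesS (I J : set R) a b : I `<=` J -> slides J a b -> slides I a b.
Proof.
move=> IJ [la lb L ae]; split.
- exact: lip_onS IJ _.
- exact: lip_onS IJ _.
- by move=> t /IJ; exact: L.
- by apply: aeS ae _ => t H /IJ.
Qed.

Lemma slides_shift (I J : set R) a b s : (forall t, J t -> I (t + s)) ->
  slides I a b -> slides J (fun t => a (t + s)) (fun t => b (t + s)).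
Proof.
move=> JI [la lb L ae]; split.
- exact: lip_on_shift la.
- exact: lip_on_shift lb.
- by move=> t /JI; exact: L.
- apply: aeS (ae_shift s ae) _ => t H /JI /H [a' [b' [da db bE ab aE]]].
  by exists a', b'; split => //; exact: is_derive1_shift.
Qed.

Definition slide_wave A B T := [/\ slides setT A B, 0 < T,
  forall t, A (t + T) = A t + 1 & forall t, B (t + T) = B t + 1].

Lemma wave_slides A B T t0 : slide_wave A B T -> slides `[t0, +oo[ A B.
Proof. by case=> sAB _ _ _; exact: slidesS sAB. Qed.

Lemma wave_front A B T : slide_wave A B T -> forall t,
  is_derive t 1 B (front_speed A B t) /\ 0 < front_speed A B t.
Proof.
move=> wAB; have [sAB T0 AT BT] := wAB; move=> t; split.
  apply: (@front_derive _ P Lm F0 beta K P_cont beta_lip (t - 1)).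
  - exact: wave_slides wAB.
  - by rewrite ltrBlDr ltrDl.
have [t1 _ t1P] := front_eventually_moves P_nincr P_cont beta_lip
  beta_le beta_ge gravity (wave_slides 0 wAB).
have [n nP] := nat_ge ((t1 - t) / T).
have := (t1P (t + T *+ n) _).1.
rewrite /front_speed !(periodicE AT, periodicE BT).
have -> : beta (B t + 1 *+ n) = beta (B t).
  by rewrite (@periodicE beta 1 0) ?mul0rn ?addr0// => x; rewrite addr0.
have -> : B t + 1 *+ n - (A t + 1 *+ n) = B t - A t by ring.
apply; move: nP; rewrite ler_pdivrMr// mulrC mulr_natr; lra.
Qed.

Lemma wave_mono A B T : slide_wave A B T -> forall s t, s < t -> B s < B t.
Proof.
move=> wAB s t st; rewrite -subr_gt0.
have [c _ ->] := is_derive_MVT st (fun u _ => (wave_front wAB u).1).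
by apply: mulr_gt0; [exact: (wave_front wAB c).2|rewrite subr_gt0].
Qed.

Lemma wave_cont A B T : slide_wave A B T -> forall t,
  {for t, continuous A} /\ {for t, continuous B}.
Proof.
move=> wAB t; apply: (slides_cont (wave_slides (t - 1) wAB)).
by rewrite ltrBlDr ltrDl.
Qed.

(** The speed of the front is positive, continuous and periodic in time. *)
Lemma wave_lower A B T : slide_wave A B T ->
  exists2 c, 0 < c & forall s t, s <= t -> c * (t - s) <= B t - B s.
Proof.
move=> wAB; have [sAB T0 AT BT] := wAB.
set G := front_speed A B.
have cG : {within `[0, T], continuous G}.
  apply: continuous_subspaceT => t.
  apply: (front_speed_cont P_cont beta_lip (wave_slides (t - 1) wAB)).
  by rewrite ltrBlDr ltrDl.
have [c _ cP] := EVT_min (ltW T0) cG.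
exists (G c); first exact: (wave_front wAB c).2.
have Gc t : G c <= G t.
  pose n : int := Num.floor (t / T).
  pose t' := t - n%:~R * T.
  have t'T : t' \in `[0, T].
    have /andP[n1 n2] := floor_itv (t / T).
    rewrite in_itv/= /t'; apply/andP; split; first by rewrite subr_ge0 -ler_pdivlMr.
    rewrite lerBlDr -[X in X + _]mul1r -mulrDl -ler_pdivrMr// addrC ltW//.
    by move: n2; rewrite intrD.
  suff -> : G t = G t' by exact: cP.
  have per s (k : nat) : G (s + T *+ k) = G s.
    rewrite /G /front_speed !(periodicE AT, periodicE BT).
    have -> : beta (B s + 1 *+ k) = beta (B s).
      by rewrite (@periodicE beta 1 0) ?mul0rn ?addr0// => x; rewrite addr0.
    by have -> : B s + 1 *+ k - (A s + 1 *+ k) = B s - A s by ring.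
  rewrite /t'; case: (n) => k.
    rewrite -[in LHS](subrK (k%:~R * T) t) -pmulrn.
    by rewrite -[X in G (_ + X) = _]/(k%:R * T) mulr_natl per.
  by rewrite NegzE mulrNz mulNr opprK -pmulrn mulr_natl per.
move=> s t; rewrite le_eqVlt => /predU1P[->|st]; first by rewrite !subrr mulr0.
have [u _ ->] := is_derive_MVT st (fun u _ => (wave_front wAB u).1).
by rewrite ler_wpM2r ?subr_ge0 ?(ltW st)// Gc.
Qed.

Lemma wave_inverse A B T : slide_wave A B T ->
  exists g : R -> R, cancel g B /\ cancel B g.
Proof.
move=> wAB; have [c c0 cP] := wave_lower wAB.
have cB : continuous B by move=> t; exact: (wave_cont wAB t).2.
by have [g [gB Bg _]] := expanding_inverse c0 cB cP; exists g.
Qed.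

(** The phase [y] of the wave whose front is at [b] satisfies
    [y' - 1 = (P (b - a) - P (B y - A y)) / B' y], which has the sign of
    [z := a - A y]. By uniqueness [z] keeps its sign, so that [y - t] is
    monotone, and by comparison it is bounded: it converges, and this forces
    [z] to converge to [0]. *)
Theorem wave_attracts A B T a b t0 :
  slide_wave A B T -> slides `[t0, +oo[ a b ->
  exists tau, forall e, 0 < e -> exists2 t1, t0 <= t1 & forall t, t1 <= t ->
    `|a t - A (t + tau)| <= e /\ `|b t - B (t + tau)| <= e.
Proof.
move=> wAB sab.
have [g [gK Kg]] := wave_inverse wAB.
have [c c0 cP] := wave_lower wAB.
have Bmono := wave_mono wAB.
have [[lA lB LAB _] T0 AT BT] := wAB.
have [la lb L _] := sab.
have Bmonole s t : B s <= B t -> s <= t.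
  by move=> st; rewrite leNgt; apply/negP => /Bmono; rewrite ltNge st.
pose t1 := t0 + 1.
have t01 : t0 < t1 by rewrite ltrDl.
have LL t : t0 <= t -> 0 < b t - a t <= Lm.
  by move=> ?; apply: L; rewrite /= in_itv/= andbT.
pose y t := g (b t).
have By t : B (y t) = b t by exact: gK.
pose z t := a t - A (y t).
have ablt s s' : s <= s' -> `[s', +oo[ `<=` (`[s, +oo[%classic : set R).
  by move=> ss' u /=; rewrite !in_itv/= !andbT; exact: le_trans.
have after s : t0 <= s -> slides `[s, +oo[ a b.
  by move=> t0s; apply: slidesS sab; exact: ablt.
have wave_sh s u : slides `[s, +oo[ (fun t => A (t + u)) (fun t => B (t + u)).
  by case: wAB => sAB _ _ _; apply: slides_shift sAB.
(* a zero of [z] is a time where the two drops coincide up to a shift: they do ever after *)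
have [z0|nz] := pselect (exists2 t, t1 <= t & z t = 0).
  have [t2 t12 zt2] := z0; pose tau := y t2 - t2.
  have t02 : t0 <= t2 by apply: le_trans t12; exact: ltW.
  exists tau => e e0; exists t2 => // t t2t.
  have ab0 : a t2 = A (t2 + tau) /\ b t2 = B (t2 + tau).
    by rewrite /tau subrKC By; split=> //; apply/eqP; rewrite -subr_eq0; apply/eqP.
  have [le1 le2] : a t <= A (t + tau) /\ b t <= B (t + tau).
    apply: (slide_comparison P_nincr K_ge0 beta_lip (after _ t02)
      (slides_super (wave_sh t2 tau))) => //.
    by rewrite ab0.1. by rewrite ab0.2.
  have [ge1 ge2] : A (t + tau) <= a t /\ B (t + tau) <= b t.
    apply: (slide_comparison P_nincr K_ge0 beta_lip (wave_sh t2 tau)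
      (slides_super (after _ t02))) => //.
    by rewrite ab0.1. by rewrite ab0.2.
  have -> : a t = A (t + tau) by apply/le_anti; rewrite le1.
  have -> : b t = B (t + tau) by apply/le_anti; rewrite le2.
  by rewrite !subrr normr0 ltW.
have [Kb Kb0 bP] := lip_onW lb.
have [Ka Ka0 aP] := lip_onW la.
have [KA KA0 AP] := lip_onW lA.
have [KB KB0 BP] := lip_onW lB.
have It t : t0 <= t -> `[t0, +oo[%classic t by move=> ?; rewrite /= in_itv/= andbT.
have ylip s t : t0 <= s -> t0 <= t -> `|y s - y t| <= Kb / c * `|s - t|.
  move=> t0s t0t.
  have Bc u v : c * `|u - v| <= `|B u - B v|.
    wlog uv : u v / v <= u.
      move=> wl; case: (leP v u) => uv; first exact: wl.
      by rewrite distrC [`|B u - _|]distrC; apply: wl; exact: ltW.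
    by rewrite ger0_norm ?subr_ge0// (le_trans (cP _ _ uv))// ler_norm.
  rewrite mulrAC ler_pdivlMr// mulrC (le_trans (Bc _ _))// !By.
  exact: bP (It _ t0s) (It _ t0t).
pose Kz := Ka + KA * (Kb / c).
have Kz0 : 0 <= Kz by rewrite addr_ge0// mulr_ge0// divr_ge0// ltW.
have zlip s t : t0 <= s -> t0 <= t -> `|z s - z t| <= Kz * `|s - t|.
  move=> t0s t0t; rewrite /z.
  have -> : a s - A (y s) - (a t - A (y t)) = (a s - a t) - (A (y s) - A (y t)).
    by ring.
  rewrite (le_trans (ler_normB _ _))// mulrDl lerD//.
    exact: aP (It _ t0s) (It _ t0t).
  rewrite (le_trans (AP _ _ _ _))// -mulrA ler_wpM2l//.
  exact: ylip.
pose G := front_speed A B.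
have dy t : t0 < t -> is_derive t 1 y (front_speed a b t / G (y t)).
  move=> t0t; have [dB G0] := wave_front wAB (y t).
  have dg : is_derive (b t) 1 g (G (y t))^-1.
    rewrite -(By t); apply: (is_derive_inverse _ _ dB) => //.
    - by near=> u; exact: Kg.
    - by near=> u; exact: (wave_cont wAB u).2.
    - by rewrite gt_eqF.
  have db := front_derive P_cont beta_lip sab t0t.
  apply: is_derive_eq (is_derive1_comp dg db) _.
  by rewrite mulrC.
pose e t := y t - t.
pose e' t := (P (b t - a t) - P (B (y t) - A (y t))) / G (y t).
have de t : t0 < t -> is_derive t 1 e (e' t).
  move=> t0t; have dyt := dy _ t0t; rewrite /e.
  have G0 : G (y t) != 0 by rewrite gt_eqF//; exact: (wave_front wAB (y t)).2.
  apply: is_derive_eq; rewrite /e'.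
  apply: (mulIf G0); rewrite mulrBl !divfK// mul1r /G /front_speed By.
  by ring.
have Lz t : B (y t) - A (y t) = b t - a t + z t by rewrite /z By; ring.
have ycl t : 0 < B (y t) - A (y t) <= Lm by exact: LAB.
have zc : forall t, t0 < t -> {for t, continuous z}.
  move=> t t0t; apply: (@lip_continuous _ z (`[t0, +oo[%classic) Kz).
    by move=> s u; rewrite /= !in_itv/= !andbT; exact: zlip.
  near=> u; rewrite /= in_itv/= andbT ltW//; near: u; exact: lt_nbhsr.
have e_limit : exists tau, forall eps, 0 < eps -> exists2 t2, t1 <= t2 &
    forall t, t2 <= t -> `|e t - tau| <= eps.
  have zsign t : t1 <= t -> (0 < z t) = (0 < z t1).
    move=> t1t; have zt1 : z t1 != 0 by apply/eqP => E; apply: nz; exists t1.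
    have zt : z t != 0 by apply/eqP => E; apply: nz; exists t.
    apply: contrapT => H; apply: nz.
    have [||u] := @IVT R z t1 t 0 t1t.
    - apply: continuous_in_subspaceT => u; rewrite inE/= in_itv/= => /andP[t1u _].
      by apply: zc; apply: lt_le_trans t1u.
    - move: H zt1 zt; case: (ltgtP (z t) 0) => // zt0; case: (ltgtP (z t1) 0) => // zt10 _ _ _;
        by rewrite ge_min le_max !(ltW zt0) ?(ltW zt10) ?orbT.
    - by rewrite in_itv/= => /andP[t1u _] zu; exists u.
  have emono (sg : bool) : (forall t, t1 <= t -> (0 < z t) = sg) ->
      forall s t, t1 <= s -> s <= t -> 0 <= (-1) ^+ (~~ sg) * (e t - e s).
    move=> zsg s t t1s; rewrite le_eqVlt => /predU1P[->|st].
      by rewrite subrr mulr0.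
    have dest u : s <= u <= t -> is_derive u 1 e (e' u).
      by move=> /andP[su _]; apply: de; apply: lt_le_trans (le_trans t1s su).
    have [u /andP[su ut] ->] := is_derive_MVT st dest.
    rewrite mulrA mulr_ge0 ?subr_ge0 ?(ltW st)// /e' mulrA divr_ge0//; last first.
      by apply/ltW; exact: (wave_front wAB (y u)).2.
    have t1u : t1 <= u by lra.
    have t0u : t0 <= u by apply: le_trans t1u; exact: ltW.
    have := zsg _ t1u; have /andP[? ?] := ycl u; have /andP[? ?] := LL _ t0u.
    case: sg {zsg} => zu /=.
      rewrite mul1r subr_ge0; apply: P_nincr => //.
      by rewrite Lz lerDl ltW.
    rewrite mulN1r oppr_ge0 subr_le0; apply: P_nincr => //.
    by rewrite Lz gerDl leNgt zu.
  (* shifting the wave by [n] periods in time puts it ahead of, or behind, the drop *)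
  have [n nP] := nat_ge (Num.max `|a t1 - A t1| `|b t1 - B t1|).
  move: nP; rewrite ge_max !ler_norml => /andP[/andP[na1 na2] /andP[nb1 nb2]].
  have AN u : A (u - T *+ n) = A u - n%:R.
    by rewrite -[in RHS](subrK (T *+ n) u) (periodicE AT) addrK.
  have BN u : B (u - T *+ n) = B u - n%:R.
    by rewrite -[in RHS](subrK (T *+ n) u) (periodicE BT) addrK.
  have up t : t1 <= t -> e t <= T *+ n.
    move=> t1t; suff : y t <= t + T *+ n by rewrite /e; lra.
    apply: Bmonole; rewrite By.
    apply: (proj2 (slide_comparison P_nincr K_ge0 beta_lip (after _ (ltW t01))
      (slides_super (wave_sh t1 (T *+ n))) _ _ t1t)).
      by rewrite (periodicE AT); lra.
    by rewrite (periodicE BT); lra.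
  have low t : t1 <= t -> - (T *+ n) <= e t.
    move=> t1t; suff : t - T *+ n <= y t by rewrite /e; lra.
    apply: Bmonole; rewrite By.
    apply: (proj2 (slide_comparison P_nincr K_ge0 beta_lip (wave_sh t1 (- (T *+ n)))
      (slides_super (after _ (ltW t01))) _ _ t1t)).
      by rewrite AN; lra.
    by rewrite BN; lra.
  move: zsign; case: (0 < z t1) => zsign.
    apply: (@nondecreasing_limit e t1 (T *+ n)) => // s t t1s st.
    by have := emono true zsign s t t1s st; rewrite mul1r subr_ge0.
  have [| |l lP] := @nondecreasing_limit (fun t => - e t) t1 (T *+ n).
  - move=> s t t1s st.
    by have := emono false zsign s t t1s st; rewrite mulN1r; lra.
  - by move=> t /low; lra.
  exists (- l) => eps eps0; have [t2 t12 t2P] := lP _ eps0; exists t2 => // t t2t.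
  by rewrite -normrN; have := t2P _ t2t; congr (`|_| <= _); ring.
have [tau tauP] := e_limit.
exists tau => eps eps0.
suff : exists2 t2, t1 <= t2 & forall t, t2 <= t ->
    `|z t| <= eps / 2 /\ (KA + KB) * `|e t - tau| <= eps / 2.
  move=> [t2 t12 t2P]; exists t2; first by lra.
  move=> t t2t; have [zt et] := t2P _ t2t.
  have et0 := normr_ge0 (e t - tau).
  have ety : y t - (t + tau) = e t - tau by rewrite /e; ring.
  have KAe : 0 <= KA * `|e t - tau| by rewrite mulr_ge0.
  have KBe : 0 <= KB * `|e t - tau| by rewrite mulr_ge0.
  split.
    have -> : a t - A (t + tau) = z t + (A (y t) - A (t + tau)) by rewrite /z; ring.
    rewrite (le_trans (ler_normD _ _))//.
    have := AP (y t) (t + tau) I I; rewrite ety; lra.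
  by have := BP (y t) (t + tau) I I; rewrite By ety; lra.
(* if [z] were large at a late time, it would stay so during a time [d], and [e] would
   move by more than [gam], which its convergence forbids *)
pose eh := eps / 2 / 2.
have eh0 : 0 < eh by rewrite !divr_gt0.
have [eta eta0 etaP] := P_decr_unif eh0.
pose d := eh / (Kz + 1).
have d0 : 0 < d by rewrite divr_gt0// ltr_wpDl.
pose KG := KB + 1.
have GK t : G t <= KG.
  have [dB G0] := wave_front wAB t.
  rewrite -/G in dB G0; rewrite leNgt; apply/negP => GKG.
  have /is_derive1_nearP/(_ 1 ltr01)/nbhs_ballP[r /= r0 rP] := dB.
  have /rP : ball 0 r (r / 2).
    by rewrite /ball/= sub0r normrN gtr0_norm ?divr_gt0// ltr_pdivrMr// ltr_pMr// ltr1n.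
  rewrite mul1r (gtr0_norm (_ : 0 < r / 2)) ?divr_gt0// ler_norml => /andP[r1 r2].
  have := BP (t + r / 2) t I I; rewrite addrAC subrr add0r.
  rewrite (gtr0_norm (_ : 0 < r / 2)) ?divr_gt0// => /ler_normlW.
  have : KG * (r / 2) < G t * (r / 2) by rewrite ltr_pM2r ?divr_gt0.
  by rewrite /KG; nra.
have KG0 : 0 < KG by rewrite ltr_wpDl.
pose gam := eta / KG * d.
have gam0 : 0 < gam by rewrite mulr_gt0// divr_gt0.
have gam4 : 0 < gam / 4 by rewrite divr_gt0.
have epsK : 0 < eps / 2 / (KA + KB + 1).
  by rewrite !divr_gt0// ltr_wpDl// addr_ge0.
have [t2 t12 t2P] := tauP _ gam4.
have [t3 t13 t3P] := tauP _ epsK.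
exists (Num.max t2 t3); first by rewrite le_max t12.
move=> t; rewrite ge_max => /andP[t2t t3t]; split; last first.
  apply: (@le_trans _ _ ((KA + KB + 1) * `|e t - tau|)).
    by rewrite ler_wpM2r// lerDl.
  rewrite mulrC -ler_pdivlMr ?ltr_wpDl ?addr_ge0//.
  exact: t3P.
rewrite leNgt; apply/negP => zt.
have t0t : t0 < t by lra.
have t0td : t0 < t + d by lra.
have dest u : t <= u <= t + d -> is_derive u 1 e (e' u).
  by move=> /andP[tu _]; apply: de; apply: lt_le_trans tu.
have ttd : t < t + d by rewrite ltrDl.
have [u /andP[tu utd]] := is_derive_MVT ttd dest.
have -> : t + d - t = d by ring.
have t0u : t0 <= u by lra.
have zu : eh <= `|z u|.
  have zz : `|z t - z u| <= eh.
    rewrite (le_trans (zlip _ _ (ltW t0t) t0u))//.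
    rewrite distrC gtr0_norm ?subr_gt0//.
    apply: (@le_trans _ _ ((Kz + 1) * d)); last by rewrite /d mulrC divfK// gt_eqF// ltr_wpDl.
    by apply: ler_pM => //; [rewrite subr_ge0 ltW|rewrite lerDl|lra].
  have := ler_normD (z u) (z t - z u); rewrite subrKC.
  have -> : eh = eps / 2 - eh by rewrite /eh; field.
  lra.
have [/andP[? ?] /andP[? ?]] := (LL _ t0u, ycl u).
have G0 : 0 < G (y u) := (wave_front wAB (y u)).2.
have e'u : eta / KG <= `|e' u|.
  rewrite /e' normrM normfV (gtr0_norm G0).
  apply: ler_pM; rewrite ?invr_ge0 ?(ltW eta0) ?(ltW KG0)//; last first.
    by rewrite lef_pV2 ?posrE// GK.
  have [z0|z0] := leP 0 (z u).
    move: zu; rewrite (ger0_norm z0) => zu.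
    rewrite (le_trans _ (ler_norm _))// lerBrDr addrC.
    by apply: etaP => //; rewrite Lz lerD2l.
  move: zu; rewrite (ltr0_norm z0) => zu.
  rewrite distrC (le_trans _ (ler_norm _))// lerBrDr addrC.
  by apply: etaP => //; have := Lz u; lra.
move=> eE.
have : gam <= `|e (t + d) - e t|.
  by rewrite eE normrM (gtr0_norm d0) ler_wpM2r// ltW.
have := t2P _ t2t.
have : `|e (t + d) - tau| <= gam / 4 by apply: t2P; lra.
rewrite !ler_norml => /andP[? ?] /andP[? ?].
by rewrite leNgt => /negP; apply; rewrite ltr_norml; apply/andP; split; lra.
Unshelve. all: by end_near. Qed.

Lemma wave_multiple A B T (n : nat) t : slide_wave A B T ->
  A (t + T *+ n) = A t + n%:R /\ B (t + T *+ n) = B t + n%:R.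
Proof. by case=> _ _ AT BT; rewrite (periodicE AT) (periodicE BT). Qed.

(** Two periods [T < T'] are excluded by the attraction: the front of the first
    wave would gain one unit of length in each time [T * T' / (T' - T)]. *)
Theorem wave_unique A B T A' B' T' : slide_wave A B T -> slide_wave A' B' T' ->
  exists tau, forall t, A' t = A (t + tau) /\ B' t = B (t + tau).
Proof.
move=> w w'.
have [tau tauP] := wave_attracts w (wave_slides 0 w').
have [_ T0 _ _] := w; have [_ T'0 _ _] := w'.
have far (t1 C D D' : R) : 0 < D -> 0 < D' ->
    exists2 n : nat, t1 <= n%:R * D & C <= n%:R * D'.
  move=> D0 D'0; have [n] := nat_ge (Num.max (t1 / D) (C / D')).
  by rewrite ge_max !ler_pdivrMr// => /andP[? ?]; exists n.
have TT' : T = T'.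
  have [k kP] := nat_ge (`|B' 0 - B tau| + 2).
  have [t1 _ t1P] := tauP _ ltr01.
  have Bmono s t : s <= t -> B s <= B t.
    by rewrite le_eqVlt => /predU1P[->//|/(wave_mono w)/ltW].
  have Bn (n : nat) t : B (t + n%:R * T) = B t + n%:R.
    by rewrite mulr_natl (wave_multiple n t w).2.
  have B'n (n : nat) : B' (n%:R * T') = B' 0 + n%:R.
    by rewrite -[n%:R * T']add0r mulr_natl (wave_multiple n 0 w').2.
  have nrm := ler_norm (B' 0 - B tau).
  have nrmN : - (B' 0 - B tau) <= `|B' 0 - B tau| by rewrite -normrN ler_norm.
  apply/eqP; rewrite eq_le; apply/andP; split; rewrite leNgt; apply/negP => TT.
  - have TT0 : 0 < T - T' by rewrite subr_gt0.
    have [n nt nk] := far t1 (k%:R * T) _ _ T'0 TT0.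
    have [_] := t1P _ nt; rewrite B'n ler_norml => /andP[_].
    have : B (n%:R * T' + tau + k%:R * T) <= B (tau + n%:R * T).
      by apply: Bmono; move: nk; rewrite mulrBr; lra.
    by rewrite !Bn; lra.
  - have TT0 : 0 < T' - T by rewrite subr_gt0.
    have [n nt nk] := far t1 (k%:R * T) _ _ T'0 TT0.
    have [_] := t1P _ nt; rewrite B'n ler_norml => /andP[+ _].
    have : B (tau + k%:R * T + n%:R * T) <= B (n%:R * T' + tau).
      by apply: Bmono; move: nk; rewrite mulrBr; lra.
    by rewrite !Bn; lra.
subst T'; exists tau => t.
have small (e : R) : 0 < e -> `|A' t - A (t + tau)| <= e /\ `|B' t - B (t + tau)| <= e.
  move=> e0; have [t1 _ t1P] := tauP _ e0.
  have [n nt _] := far (t1 - t) 0 _ _ T0 T0.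
  have tn : t1 <= t + T *+ n by rewrite -mulr_natl; lra.
  have [A'n B'n] := wave_multiple n t w'.
  have [An Bn] := wave_multiple n (t + tau) w.
  have := t1P _ tn; rewrite [t + T *+ n + tau]addrAC A'n B'n An Bn => -[H1 H2].
  split.
    by move: H1; congr (`|_| <= _); ring.
  by move: H2; congr (`|_| <= _); ring.
have eq0 (x y : R) : (forall e, 0 < e -> `|x - y| <= e) -> x = y.
  move=> H; apply/eqP; rewrite -subr_eq0 -normr_eq0 eq_le normr_ge0 andbT.
  by apply/ler_addgt0Pl => e e0; rewrite addr0 H.
by split; apply: eq0 => e /small[].
Qed.

End wave.

(** * A periodic obstacle problem for a scalar equation *)

Section obstacle_ode.
Variable R : realType.
Implicit Types (x y h k s : R) (z : R -> R).
Variables (F : R -> R -> R) (l0 l1 K V : R).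
Hypothesis l01 : l0 < l1.
Hypothesis K_ge0 : 0 <= K.
Hypothesis F_lip : forall s s' x x', `|F s x - F s' x'| <= K * (`|s - s'| + `|x - x'|).
Hypothesis F_bnd : forall s x, `|F s x| <= V.
Hypothesis F_l0 : forall x, 0 <= F l0 x.

Let h0 := (K + 1)^-1.
Let C := K * (V + 1).

Let V0 : 0 <= V. Proof. exact: le_trans (F_bnd 0 0). Qed.
Let K1 : 0 < K + 1. Proof. by rewrite ltr_wpDl. Qed.
Let h0_gt0 : 0 < h0. Proof. by rewrite invr_gt0. Qed.
Let Kh0 : K * h0 <= 1. Proof. by rewrite ler_pdivrMr// mul1r lerDl. Qed.
Let C0 : 0 <= C. Proof. by rewrite mulr_ge0// addr_ge0. Qed.

Let C_large : K * (V + C * h0 + 1) <= 2 * C.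
Proof.
have -> : K * (V + C * h0 + 1) = C + C * (K * h0) by rewrite /C; ring.
have : C * (K * h0) <= C by rewrite ler_piMr.
lra.
Qed.

(** The quadratic term makes the definition stable under suprema without any
    regularity: a subsolution may jump downwards, but not upwards. *)
Let subsol z := (forall x, l0 <= z x <= l1) /\
  forall x h, 0 <= h <= h0 -> z (x + h) <= z x + F (z x) x * h + C * h ^+ 2.

(** Steps are so short that [K * h <= 1]. *)
Let euler_mono s s' x h : s <= s' -> 0 <= h <= h0 ->
  s + F s x * h <= s' + F s' x * h.
Proof.
move=> ss /andP[hp hh].
have : F s x - F s' x <= K * (s' - s).
  have := F_lip s s' x x; rewrite subrr normr0 addr0 => /ler_normlW.
  by rewrite [`|s - s'|]distrC (ger0_norm (_ : 0 <= s' - s)) ?subr_ge0.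
move=> H.
have H1 : (F s x - F s' x) * h <= K * (s' - s) * h by rewrite ler_wpM2r.
have H2 : K * (s' - s) * h <= s' - s.
  rewrite mulrAC ler_piMl ?subr_ge0//.
  by rewrite (le_trans _ Kh0)// ler_wpM2l.
by rewrite mulrBl in H1; lra.
Qed.

Let C_sq u : 0 <= u -> u <= h0 -> `|C * u ^+ 2| <= C * h0 * u.
Proof.
move=> u0 uh; have Cu : 0 <= C * u ^+ 2 by rewrite mulr_ge0// exprn_ge0.
by rewrite (ger0_norm Cu) expr2 mulrA ler_wpM2r// ler_wpM2l.
Qed.

Let subsol_l0 : subsol (fun=> l0).
Proof.
split=> [x|x h /andP[hp _]]; first by rewrite lexx ltW.
by rewrite -addrA lerDl addr_ge0// mulr_ge0// exprn_ge0.
Qed.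

Let Z x := sup [set z x | z in subsol].

Let Z_has_sup x : has_sup [set z x | z in subsol].
Proof.
split; first by exists l0, (fun=> l0).
by exists l1 => _ [z [zl _] <-]; have /andP[] := zl x.
Qed.

Let subsol_le z : subsol z -> forall x, z x <= Z x.
Proof.
move=> sz x; apply: ub_le_sup; first by case: (Z_has_sup x).
by exists z.
Qed.

Let Z_sub : subsol Z.
Proof.
split=> [x|x h hh].
  apply/andP; split; first exact: (subsol_le subsol_l0).
  apply: ge_sup; first by case: (Z_has_sup x).
  by move=> _ [z [zl _] <-]; have /andP[] := zl x.
apply: ge_sup; first by case: (Z_has_sup (x + h)).
move=> _ [z sz <-]; apply: (le_trans (proj2 sz _ _ hh)).
by rewrite lerD2r euler_mono// subsol_le.
Qed.

(** The constant [C] is so large that a parabola started at [(x, Z x)] with an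
    admissible slope bends downwards faster than [F] can vary along it; then its
    supremum with [Z] is a subsolution, and by maximality it stays below [Z]. *)
Let Z_bump x s h : s <= F (Z x) x -> `|s| <= V -> 0 <= h <= h0 ->
  (forall k, 0 <= k <= h -> Z x + s * k - C * k ^+ 2 <= l1) ->
  forall k, 0 <= k <= h -> Z x + s * k - C * k ^+ 2 <= Z (x + k).
Proof.
move=> sF sV /andP[hp hh0] hl1 k0 k0h.
pose q k := Z x + s * k - C * k ^+ 2.
pose inI y := (x <= y <= x + h).
pose zt y := if inI y then Num.max (Z y) (q (y - x)) else Z y.
have Zzt y : Z y <= zt y by rewrite /zt; case: ifP => // _; rewrite le_max lexx.
suff : subsol zt.
  move=> /subsol_le/(_ (x + k0)); rewrite {1}/zt /inI.
  have -> : x <= x + k0 <= x + h by move: k0h; lra.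
  by rewrite ge_max addrAC subrr add0r => /andP[].
split=> [y|y k /andP[kp kh0]].
  have /andP[Z1 Z2] := proj1 Z_sub y; rewrite (le_trans Z1)//=.
  rewrite /zt; case: ifP => // /andP[xy yh]; rewrite ge_max Z2/= hl1//.
  by apply/andP; split; lra.
have kk : 0 <= k <= h0 by rewrite kp.
have Zok : Z (y + k) <= zt y + F (zt y) y * k + C * k ^+ 2.
  by rewrite (le_trans (proj2 Z_sub _ _ kk))// lerD2r euler_mono.
rewrite {1}/zt; case: ifP => // /andP[xyk ykh]; rewrite ge_max Zok/=.
have [xy|yx] := leP x y.
  have Iy : inI y by rewrite /inI xy/=; lra.
  apply: (@le_trans _ _ (q (y - x) + F (q (y - x)) y * k + C * k ^+ 2)); last first.
    by rewrite lerD2r euler_mono// /zt Iy le_max lexx orbT.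
  set u := y - x; have u0 : 0 <= u by rewrite subr_ge0.
  have uh : u <= h by rewrite /u; lra.
  have -> : y + k - x = u + k by rewrite /u; ring.
  have Fq : s - K * (V + C * h0 + 1) * u <= F (q u) y.
    have := F_lip (q u) (Z x) y x; rewrite ler_norml => /andP[+ _].
    rewrite [`|y - x|]ger0_norm ?subr_ge0// -/u.
    have qu : `|q u - Z x| <= (V + C * h0) * u.
      have -> : q u - Z x = s * u - C * u ^+ 2 by rewrite /q; ring.
      rewrite (le_trans (ler_normB _ _))// mulrDl lerD//.
        by rewrite normrM (ger0_norm u0) ler_wpM2r.
        apply: C_sq => //; exact: le_trans hh0.
    have : K * (`|q u - Z x| + u) <= K * (((V + C * h0) + 1) * u).
      by rewrite ler_wpM2l// [leRHS]mulrDl mul1r lerD2r.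
    by rewrite mulrA; lra.
  have Fqk : (s - K * (V + C * h0 + 1) * u) * k <= F (q u) y * k by rewrite ler_wpM2r.
  have uk : 0 <= u * k by rewrite mulr_ge0.
  have Cuk : K * (V + C * h0 + 1) * (u * k) <= 2 * C * (u * k) by rewrite ler_wpM2r.
  have kC : 0 <= C * k ^+ 2 by rewrite mulr_ge0// exprn_ge0.
  by move: Fqk Cuk; rewrite mulrBl -mulrA /q; nra.
have zty : zt y = Z y by rewrite /zt /inI leNgt yx.
rewrite zty.
set k1 := x - y; set k2 := y + k - x.
have k10 : 0 <= k1 by rewrite subr_ge0 ltW.
have k20 : 0 <= k2 by rewrite subr_ge0.
have kE : k = k1 + k2 by rewrite /k1 /k2; ring.
have k1h : 0 <= k1 <= h0 by rewrite k10; lra.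
have k2h : 0 <= k2 <= h0 by rewrite k20; lra.
set w := Z y + F (Z y) y * k1 + C * k1 ^+ 2.
have Zxw : Z x <= w.
  have -> : x = y + k1 by rewrite /k1 subrKC.
  exact: proj2 Z_sub _ _ k1h.
have E1 : Z x + F (Z x) x * k2 <= w + F w x * k2 by exact: euler_mono.
have E2 : F w x <= F (Z y) y + K * (V + C * h0 + 1) * k1.
  have := F_lip w (Z y) x y; rewrite ler_norml => /andP[_].
  rewrite [`|x - y|]ger0_norm -/k1//.
  have wZ : `|w - Z y| <= (V + C * h0) * k1.
    have -> : w - Z y = F (Z y) y * k1 + C * k1 ^+ 2 by rewrite /w; ring.
    rewrite (le_trans (ler_normD _ _))// mulrDl lerD//.
      by rewrite normrM (ger0_norm k10) ler_wpM2r.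
    by apply: C_sq => //; case/andP: k1h.
  have : K * (`|w - Z y| + k1) <= K * (((V + C * h0) + 1) * k1).
    by rewrite ler_wpM2l// [leRHS]mulrDl mul1r lerD2r.
  by rewrite mulrA; lra.
have E3 : F w x * k2 <= (F (Z y) y + K * (V + C * h0 + 1) * k1) * k2.
  by rewrite ler_wpM2r.
have kk2 : 0 <= k1 * k2 by rewrite mulr_ge0.
have E4 : K * (V + C * h0 + 1) * (k1 * k2) <= 2 * C * (k1 * k2) by rewrite ler_wpM2r.
have E5 : s * k2 <= F (Z x) x * k2 by rewrite ler_wpM2r.
have E6 : 0 <= C * k2 ^+ 2 by rewrite mulr_ge0// exprn_ge0.
rewrite kE /q -/k2; move: E3; rewrite mulrDl -mulrA /w in E1 * => E3.
have -> : C * (k1 + k2) ^+ 2 = C * k1 ^+ 2 + 2 * C * (k1 * k2) + C * k2 ^+ 2 by ring.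
lra.
Qed.

Let Lip := V + C * h0 + (l1 - l0) / h0.

Let Z_lip x y : `|Z x - Z y| <= Lip * `|x - y|.
Proof.
wlog xy : x y / x <= y.
  move=> wl; case: (leP x y) => xy; first exact: wl.
  by rewrite distrC [`|x - y|]distrC; apply: wl; exact: ltW.
have -> : y = x + (y - x) by rewrite subrKC.
set h := y - x; have hp : 0 <= h by rewrite subr_ge0.
have -> : x - (x + h) = - h by ring.
rewrite normrN (ger0_norm hp).
have /andP[Zx0 Zx1] := proj1 Z_sub x.
have /andP[Zy0 Zy1] := proj1 Z_sub (x + h).
have l10 : 0 <= (l1 - l0) / h0 by rewrite divr_ge0 ?subr_ge0 ?(ltW l01)// ltW.
have VC : 0 <= V + C * h0 by rewrite addr_ge0// mulr_ge0// ltW.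
have [hh|hh] := leP h h0; last first.
  have : l1 - l0 <= (l1 - l0) / h0 * h.
    by rewrite mulrAC ler_pdivlMr// ler_wpM2l ?subr_ge0 ?(ltW l01)// ltW.
  have : 0 <= (V + C * h0) * h by rewrite mulr_ge0.
  by rewrite /Lip mulrDl ler_norml => ? ?; apply/andP; split; lra.
have hI : 0 <= h <= h0 by rewrite hp.
have up := proj2 Z_sub x h hI.
have Ch : C * h ^+ 2 <= C * h0 * h by rewrite expr2 mulrA ler_wpM2r// ler_wpM2l.
have Fh : F (Z x) x * h <= V * h.
  by rewrite ler_wpM2r// (le_trans (ler_norm _)).
have lh : 0 <= (l1 - l0) / h0 * h by rewrite mulr_ge0.
have low : Z x + - V * h - C * h ^+ 2 <= Z (x + h).
  apply: (@Z_bump x (- V) h) => //.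
  - by have := F_bnd (Z x) x; rewrite ler_norml => /andP[].
  - by rewrite normrN ger0_norm.
  - move=> k /andP[k0 _]; have : 0 <= C * k ^+ 2 by rewrite mulr_ge0// exprn_ge0.
    have : 0 <= V * k by rewrite mulr_ge0.
    by rewrite mulNr; lra.
  - by rewrite hp lexx.
rewrite distrC /Lip !mulrDl ler_norml; apply/andP; split; lra.
Qed.

Let Lip0 : 0 <= Lip.
Proof.
have h0p := ltW h0_gt0.
have lh : 0 <= (l1 - l0) / h0 by rewrite divr_ge0// subr_ge0 ltW.
have Ch : 0 <= C * h0 by rewrite mulr_ge0.
by rewrite /Lip addr_ge0// addr_ge0.
Qed.

Let Z_step y k : 0 <= k <= h0 -> Z y + V * k <= l1 ->
  `|Z (y + k) - Z y - F (Z y) y * k| <= C * k ^+ 2.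
Proof.
move=> /andP[kp kh] kl.
have kI : 0 <= k <= h0 by rewrite kp.
have up := proj2 Z_sub y k kI.
have low : Z y + F (Z y) y * k - C * k ^+ 2 <= Z (y + k).
  apply: (@Z_bump y _ k) => //; last by rewrite kp lexx.
  move=> j /andP[j0 jk].
  have : 0 <= C * j ^+ 2 by rewrite mulr_ge0// exprn_ge0.
  have : F (Z y) y * j <= V * k.
    apply: (@le_trans _ _ (V * j)); last by rewrite ler_wpM2l.
    by rewrite ler_wpM2r// (le_trans (ler_norm _)).
  lra.
by rewrite ler_norml; apply/andP; split; lra.
Qed.

(** To the right of [x] the expansion is [Z_step] at [x]; to the left, it is
    [Z_step] at the nearby point, where [F] is almost the same. *)
Let Z_derive x : Z x < l1 -> is_derive x 1 Z (F (Z x) x).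
Proof.
move=> Zx; apply/is_derive1_nearP => e e0.
pose C2 := C + K * (Lip + 1) + 1.
have C20 : 0 < C2 by rewrite ltr_wpDl// addr_ge0// mulr_ge0// addr_ge0.
pose d := Num.min h0 (Num.min ((l1 - Z x) / (V + Lip + 1)) (e / C2)).
have VL : 0 < V + Lip + 1 by rewrite ltr_wpDl// addr_ge0.
have d0 : 0 < d by rewrite !lt_min h0_gt0 !divr_gt0 ?subr_gt0.
apply: filterS (near0_norm_lt d0) => h; rewrite !lt_min => /and3P[hh0 hl he].
have hl' : (V + Lip) * `|h| <= l1 - Z x.
  move: hl; rewrite ltr_pdivlMr// mulrDr mulr1 mulrC.
  by have := normr_ge0 h; lra.
have he' : C2 * `|h| <= e by move: he; rewrite ltr_pdivlMr// mulrC => /ltW.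
have hsq : h ^+ 2 = `|h| * `|h| by rewrite -expr2 real_normK// num_real.
have VL0 : 0 <= V * `|h| /\ 0 <= Lip * `|h| by rewrite !mulr_ge0.
suff : `|Z (x + h) - Z x - F (Z x) x * h| <= C2 * h ^+ 2.
  move=> /le_trans; apply; rewrite hsq mulrA ler_wpM2r//.
have [hp|hn] := leP 0 h.
  rewrite (ger0_norm hp) in hh0 hl' he' VL0.
  apply: (@le_trans _ _ (C * h ^+ 2)).
    by apply: Z_step; [rewrite hp ltW|move: hl' VL0; rewrite [(V + Lip) * _]mulrDl; lra].
  rewrite ler_wpM2r ?exprn_even_ge0// /C2 -addrA lerDl.
  by rewrite addr_ge0// mulr_ge0// addr_ge0.
rewrite (ltr0_norm hn) in hh0 hl' he' VL0.
set k := - h in hh0 hl' he' VL0.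
have k0 : 0 < k by rewrite oppr_gt0.
set y := x + h.
have xy : x = y + k by rewrite /y /k addrK.
have Zyx : `|Z y - Z x| <= Lip * k.
  by rewrite (le_trans (Z_lip _ _))// /y addrAC subrr add0r (ltr0_norm hn).
have := @Z_step y k; rewrite (ltW k0) (ltW hh0) -xy => /(_ isT) H.
have {}H : `|Z x - Z y - F (Z y) y * k| <= C * k ^+ 2.
  by apply: H; move: Zyx hl' VL0; rewrite [(V + Lip) * _]mulrDl ler_norml => /andP[_]; lra.
have Fyx : `|F (Z y) y - F (Z x) x| <= K * (Lip + 1) * k.
  rewrite (le_trans (F_lip _ _ _ _))// -mulrA ler_wpM2l// mulrDl mul1r lerD//.
  by rewrite /y addrAC subrr add0r (ltr0_norm hn).
have -> : Z y - Z x - F (Z x) x * h =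
    - (Z x - Z y - F (Z y) y * k) - (F (Z y) y - F (Z x) x) * k.
  by rewrite /k; ring.
rewrite (le_trans (ler_normB _ _))// normrN normrM (gtr0_norm k0).
have -> : h ^+ 2 = k ^+ 2 by rewrite /k sqrrN.
have FF : `|F (Z y) y - F (Z x) x| * k <= K * (Lip + 1) * k * k.
  by rewrite ler_wpM2r// ltW.
have : 0 <= k ^+ 2 by rewrite exprn_even_ge0.
by move: H FF; rewrite /C2 !mulrDl -!mulrA -expr2 mul1r; lra.
Qed.

(** If [F] were negative at a contact point, [Z] could not have come up to the
    obstacle from the left. *)
Let Z_contact x : Z x = l1 -> 0 <= F l1 x.
Proof.
move=> Zx; rewrite leNgt; apply/negP => Fx.
have KC : 0 < K + C + 1 by rewrite ltr_wpDl// addr_ge0.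
pose k := Num.min h0 (- F l1 x / (K + C + 1)) / 2.
have m0 : 0 < Num.min h0 (- F l1 x / (K + C + 1)).
  by rewrite lt_min h0_gt0 divr_gt0// oppr_gt0.
have k0 : 0 < k by rewrite divr_gt0.
have km : k < Num.min h0 (- F l1 x / (K + C + 1)).
  by rewrite ltr_pdivrMr// ltr_pMr// ltr1n.
move: km; rewrite lt_min => /andP[kh0 kF].
have kI : 0 <= k <= h0 by rewrite !ltW.
have := proj2 Z_sub (x - k) k kI; rewrite subrK Zx.
have /andP[_ Zl1] := proj1 Z_sub (x - k).
have := euler_mono (x - k) Zl1 kI.
have : F l1 (x - k) <= F l1 x + K * k.
  have := F_lip l1 l1 (x - k) x; rewrite subrr normr0 add0r addrAC subrr add0r normrN.
  by rewrite (gtr0_norm k0) ler_norml => /andP[_]; lra.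
move=> Fk; have : F l1 (x - k) * k <= (F l1 x + K * k) * k by rewrite ler_wpM2r// ltW.
move: kF; rewrite ltr_pdivlMr// => kF.
have : k * (k * (K + C + 1)) < k * (- F l1 x) by rewrite ltr_pM2l.
have : 0 < k * k by rewrite mulr_gt0.
by rewrite expr2; nra.
Qed.

(** The largest function below the obstacle [l1] all of whose slopes are at
    most [F] solves the equation away from the obstacle; being the largest, it
    inherits the period of [F]. *)
Theorem periodic_obstacle_ode p : (forall s x, F s (x + p) = F s x) ->
  exists Z : R -> R, [/\ forall x, Z (x + p) = Z x,
    forall x, l0 <= Z x <= l1,
    exists C, forall x y, `|Z x - Z y| <= C * `|x - y|,
    forall x, Z x < l1 -> is_derive x 1 Z (F (Z x) x) &
    forall x, Z x = l1 -> 0 <= F l1 x].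
Proof.
move=> Fp; exists Z; split => //; last first.
- by exists Lip.
- exact: proj1 Z_sub.
have FN s x : F s (x - p) = F s x by rewrite -[in RHS](subrK p x) Fp.
have shift q : (forall s x, F s (x + q) = F s x) -> forall x, Z (x + q) <= Z x.
  move=> Fq; apply: subsol_le; split => [x|x h hh]; first exact: proj1 Z_sub _.
  by have := proj2 Z_sub (x + q) h hh; rewrite addrAC Fq.
move=> x; apply/le_anti; rewrite shift//=.
by rewrite -[in leLHS](addrK p x) shift.
Qed.

End obstacle_ode.

(** * Primitives and level sets *)

Section primitive.
Variable R : realType.
Notation mu := (@lebesgue_measure R).
Implicit Types (k : R -> R) (x y : R).

(** Lebesgue's differentiation theorem, on each half line. *)
Lemma bounded_primitive k (V : R) : measurable_fun [set: R] k ->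
  (forall x, `|k x| <= V) ->
  exists J : R -> R, (forall x y, `|J x - J y| <= V * `|x - y|) /\
    {ae mu, forall x, is_derive x 1 J (k x)}.
Proof.
move=> mk kV.
have V0 : 0 <= V by exact: le_trans (kV 0).
have ik (A : set R) : measurable A -> (mu A < +oo)%E ->
    mu.-integrable A (EFin \o k).
  move=> mA Afin; apply: measurable_bounded_integrable => //.
    exact: measurable_funS mk.
  exists V; split; first exact: num_real.
  by move=> W VW x _ /=; exact: le_trans (kV x) (ltW VW).
have muI x y : (mu `]x, y]%classic < +oo)%E.
  by rewrite lebesgue_measure_itv/=; case: ifP; rewrite ?ltry// -EFinB ltry.
have iI x y : mu.-integrable `]x, y] (EFin \o k).
  by apply: ik; [exact: measurable_itv|exact: muI].
pose S x y := \int[mu]_(t in `]x, y]) k t.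
have SD x y z : x <= y -> y <= z -> S x z - S x y = S y z.
  by move=> xy yz; apply: Rintegral_itvB => //; rewrite bnd_simp.
have SE x y : y <= x -> S x y = 0.
  by move=> yx; rewrite /S set_itv_ge ?Rintegral_set0// bnd_simp -leNgt.
have SV x y : x <= y -> `|S x y| <= V * (y - x).
  move=> xy; rewrite (le_trans (le_normr_Rintegral _ _))//.
  have -> : V * (y - x) = \int[mu]_(t in `]x, y]) V.
    rewrite Rintegral_cst//= lebesgue_measure_itv/= lte_fin.
    by move: xy; rewrite le_eqVlt => /predU1P[->|->]; rewrite ?ltxx ?subrr.
  apply: le_Rintegral => //.
  - exact: integrable_norm (iI x y).
  - apply: measurable_bounded_integrable;
      [exact: measurable_itv|exact: muI|exact: measurable_cst|].
    exists V; split; first exact: num_real.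
    by move=> W /ltW VW t _ /=; rewrite ger0_norm.
pose J x := S 0 x - S x 0.
have JS x y : x <= y -> J y - J x = S x y.
  move=> xy; rewrite /J; have [x0|x0] := leP 0 x.
    have y0 : 0 <= y by lra.
    by rewrite (SE x 0 x0) (SE y 0 y0) -(SD _ _ _ x0 xy); ring.
  have [y0|y0] := leP 0 y.
    by rewrite (SE 0 x (ltW x0)) (SE y 0 y0) -(SD _ _ _ (ltW x0) y0); ring.
  by rewrite (SE 0 x (ltW x0)) (SE 0 y (ltW y0)) -(SD _ _ _ xy (ltW y0)); ring.
exists J; split.
  move=> x y; wlog xy : x y / x <= y.
    move=> wl; case: (leP x y) => xy; first exact: wl.
    by rewrite distrC [`|x - y|]distrC; apply: wl; exact: ltW.
  by rewrite distrC JS// [`|x - y|]distrC (ger0_norm (_ : 0 <= y - x)) ?subr_ge0// SV.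
have loc : locally_integrable [set: R] k.
  split => //; first exact: openT.
  move=> A _ cA; have mA : measurable A by exact: compact_measurable.
  by have /integrableP[] := ik A mA (compact_finite_measure cA).
have aen (n : nat) : {ae mu, forall x, - n%:R < x -> is_derive x 1 J (k x)}.
  have /= := @FTC1 R k (BRight (- n%:R)) (fun y => iI _ y) loc.
  move=> H; apply: aeS H _ => x H nx.
  have [dS Sk] : derivable (S (- n%:R)) x 1 /\ derive1 (S (- n%:R)) x = k x.
    by apply: H; exact: nx.
  have := derivable_is_derive1 dS; rewrite Sk => /is_derive1_nearP dS'.
  apply/is_derive1_nearP => e e0; have := dS' e e0.
  have nx0 : 0 < x + n%:R by lra.
  apply: filterS2 (near0_norm_lt nx0) => h hn.
  have nxh : - n%:R <= x + h by move: hn; rewrite ltr_norml; lra.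
  by rewrite -!JS ?(ltW nx)//; congr (`|_| <= _); ring.
apply: aeS (ae_foralln aen) _ => x H.
have [n xn] := nat_ge (- x + 1).
by apply: (H n); lra.
Qed.

Lemma primitive_ge k J (v : R) x y C : (forall x y, `|J x - J y| <= C * `|x - y|) ->
  {ae mu, forall x, is_derive x 1 J (k x)} -> (forall t, v <= k t) ->
  x <= y -> v * (y - x) <= J y - J x.
Proof.
move=> JL aeJ kv xy.
have : (- J y) - (- J x) <= (- v) * (y - x).
  apply: (@lip_ae_derive_le _ (fun t => - J t)) => //.
    by exists C => s t _ _; rewrite -opprD normrN JL.
  apply: aeS aeJ _ => t dJ _; exists (- k t); last by rewrite lerN2.
  exact: is_deriveN.
by rewrite mulNr; lra.
Qed.

(** At a point where a closed level set has density one, the function cannot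
    leave its level at a positive speed. *)
Lemma level_set_derive (f : R -> R) (c K : R) :
  (forall x y, `|f x - f y| <= K * `|x - y|) ->
  {ae mu, forall x, f x = c -> is_derive x 1 f 0}.
Proof.
move=> fL.
have K0 : 0 <= K.
  by have := fL 1 0; rewrite subr0 normr1 mulr1; apply: le_trans.
have cf : continuous f.
  move=> x; apply: (@lip_continuous _ f setT K) => //; exact: filterT.
(* the primitive [X] of the indicator of the level set measures it *)
pose chi x : R := if f x == c then 1 else 0.
have mchi : measurable_fun [set: R] chi.
  apply: measurable_fun_ifT => //.
  apply: measurable_fun_eqr => //; exact: continuous_measurable_fun.
have chi1 x : `|chi x| <= 1.
  by rewrite /chi; case: ifP; rewrite ?normr1 ?normr0.
have [X [XL aeX]] := bounded_primitive mchi chi1.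
apply: (aeS aeX) => x dX fx; apply/is_derive1_nearP => e e0.
pose r := e / (K + 1).
have K1 : 0 < K + 1 by rewrite ltr_wpDl.
have r0 : 0 < r by rewrite divr_gt0.
pose r' := Num.min r 1 / 4.
have r'0 : 0 < r' by rewrite divr_gt0// lt_min r0 ltr01.
have r'r : 4 * r' <= r /\ 4 * r' <= 1.
  have -> : 4 * r' = Num.min r 1 by rewrite /r'; field.
  by rewrite !ge_min !lexx orbT.
move/is_derive1_nearP : dX => /(_ r' r'0) /nbhs_ballP[d /= d0 dP].
have {}dP u : `|u| < d -> `|X (x + u) - X x - u| <= r' * `|u|.
  move=> ud; have := dP u; rewrite /ball/= sub0r normrN => /(_ ud).
  by rewrite /chi fx eqxx mul1r.
apply: filterS (near0_norm_lt d0) => h hd.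
rewrite mul0r subr0.
suff [u [hu fu]] : exists u, `|h - u| <= r * `|h| /\ f (x + u) = c.
  rewrite fx -fu (le_trans (fL _ _))//.
  have -> : x + h - (x + u) = h - u by ring.
  apply: (@le_trans _ _ (K * (r * `|h|))); first by rewrite ler_wpM2l.
  rewrite mulrA ler_wpM2r// /r mulrCA ler_piMr ?(ltW e0)//.
  by rewrite ler_pdivrMr// mul1r lerDl.
have [->|h0] := eqVneq h 0.
  by exists 0; rewrite subrr normr0 mulr0 addr0.
apply: contrapT => nou.
pose h' := (1 - 4 * r') * h.
have h'd : `|h'| <= `|h|.
  rewrite normrM ler_piMl// ger0_norm; lra.
have hh' : h - h' = 4 * r' * h by rewrite /h'; ring.
(* otherwise [X] would be constant near [x + h], although its slope at [x] is one *)
have Xhh' : X (x + h) - X (x + h') = 0.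
  have flat s t : s <= t -> (forall u, s < u < t -> f u <> c) -> X t - X s = 0.
    move=> st nc; have lX : lip_on `[s, t] X by exists 1 => ? ? _ _; exact: XL.
    have lNX : lip_on `[s, t] (fun t => - X t).
      by exists 1 => ? ? _ _; rewrite -opprD normrN; exact: XL.
    apply/le_anti; apply/andP; split.
      have := @lip_ae_derive_le _ X s t 0 st lX; rewrite mul0r; apply.
      apply: (aeS aeX) => u du sut; exists (chi u) => //.
      by rewrite /chi; case: eqP => // /nc; exact.
    have : - X t - - X s <= 0 * (t - s).
      apply: (@lip_ae_derive_le _ (fun t => - X t)) => //.
      apply: (aeS aeX) => u du sut; exists (- chi u); first exact: is_deriveN.
      by rewrite /chi oppr_le0; case: eqP.
    by rewrite mul0r; lra.
  have nc u : `|h - u| <= r * `|h| -> f (x + u) <> c.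
    by move=> hu fu; apply: nou; exists u.
  have rh : 4 * r' * `|h| <= r * `|h| by rewrite ler_wpM2r//; lra.
  have [hp|hn] := ltP 0 h.
    rewrite (gtr0_norm hp) in nc rh.
    have hh0 : 0 <= 4 * r' * h by rewrite mulr_ge0 ?(ltW hp)//; lra.
    apply: flat => [|v /andP[v1 v2]]; first by move: hh'; lra.
    rewrite -(subrK x v) addrC; apply: nc; rewrite ger0_norm; lra.
  have {}hn : h < 0 by rewrite lt_neqAle h0.
  rewrite (ltr0_norm hn) in nc rh.
  apply/eqP; rewrite -oppr_eq0 opprB; apply/eqP.
  have hh0 : 4 * r' * h <= 0 by rewrite mulr_ge0_le0 ?(ltW hn)//; lra.
  apply: flat => [|v /andP[v1 v2]]; first by move: hh'; lra.
  by rewrite -(subrK x v) addrC; apply: nc; rewrite ler0_norm; lra.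
have := dP h hd; have := dP h' (le_lt_trans h'd hd).
have r'h : r' * `|h'| <= r' * `|h| by rewrite ler_wpM2l// ltW.
have hp : 0 < `|h| by rewrite normr_gt0.
have r'hp : 0 < r' * `|h| by rewrite mulr_gt0.
have : 4 * r' * `|h| = `|h - h'| by rewrite hh' normrM gtr0_norm// mulr_gt0.
move=> E1 E2 E3.
have : `|h - h'| <= 2 * (r' * `|h|).
  have -> : h - h' = (X (x + h') - X x - h') - (X (x + h) - X x - h).
    by move: Xhh'; lra.
  by rewrite (le_trans (ler_normB _ _))//; lra.
by lra.
Qed.

End primitive.

(** * Existence of a wave *)

Section wave_existence.
Variable R : realType.
Notation mu := (@lebesgue_measure R).
Implicit Types (s t x y : R).
Variables (P : R -> R) (Lm F0 : R) (beta : R -> R) (K : R).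
Hypothesis Lm_gt0 : 0 < Lm.
Hypothesis P_nincr : forall l l', 0 < l -> l <= l' -> l' <= Lm -> P l' <= P l.
Hypothesis P_Lm : P Lm = 0.
Hypothesis P_lip : forall l0, 0 < l0 -> exists C, forall l l',
  l0 <= l <= Lm -> l0 <= l' <= Lm -> `|P l - P l'| <= C * `|l - l'|.
Hypothesis P_large : forall C, exists2 l0, 0 < l0 < Lm & C <= P l0.
Hypothesis K_ge0 : 0 <= K.
Hypothesis beta_lip : forall x y, `|beta x - beta y| <= K * `|x - y|.
Variables (M m : R).
Hypothesis beta_le : forall x, beta x <= M.
Hypothesis beta_ge : forall x, m <= beta x.
Hypothesis gravity : M - m < F0.
Hypothesis beta_per : forall x, beta (x + 1) = beta x.

Let c0 := F0 - (M - m).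
Let c0_gt0 : 0 < c0. Proof. by rewrite subr_gt0. Qed.
Let back s x := (x - s) / 2.
Let front s x := (x + s) / 2.
Let speed s x := F0 + beta (back s x) - beta (front s x).
Let speed_ge s x : c0 <= speed s x.
Proof. by have := beta_ge (back s x); have := beta_le (front s x); rewrite /speed /c0; lra. Qed.

(** In terms of the sum [x := a + b], which increases at a speed at least
    [F0 - (M - m)], the length [Z] of a freely sliding drop solves a scalar
    equation, whose right-hand side has period [2]. *)
Let length_profile : exists Z : R -> R, [/\ forall x, Z (x + 2) = Z x,
    forall x, 0 < Z x <= Lm,
    exists C, forall x y, `|Z x - Z y| <= C * `|x - y|,
    forall x, Z x < Lm -> is_derive x 1 Z
      ((2 * P (Z x) + F0 - beta (back (Z x) x) - beta (front (Z x) x)) / speed (Z x) x) &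
    forall x, Z x = Lm -> beta (back Lm x) + beta (front Lm x) <= F0].
Proof.
have [l0 /andP[l00 l0m] Pl0] := P_large M.
have Mm : m <= M by apply: le_trans (beta_le 0).
have [KP PP] := P_lip l00.
(* [P] is unbounded at length zero: the right-hand side is truncated below [l0], where it
   is positive *)
pose cl s := Num.max l0 (Num.min s Lm).
have clI s : l0 <= cl s <= Lm by rewrite le_max lexx ge_max (ltW l0m) ge_min lexx orbT.
have clE s : l0 <= s <= Lm -> cl s = s.
  by move=> /andP[s0 s1]; rewrite /cl (min_l s1) (max_r s0).
have cllip s s' : `|cl s - cl s'| <= `|s - s'|.
  wlog ss : s s' / s <= s'.
    move=> wl; case: (leP s s') => ss; first exact: wl.
    by rewrite distrC [`|s - s'|]distrC; apply: wl; exact: ltW.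
  rewrite distrC [`|s - s'|]distrC (ger0_norm (_ : 0 <= s' - s)) ?subr_ge0//.
  rewrite /cl; case: (leP s Lm) => ?; case: (leP s' Lm) => ?; rewrite ler_norml;
    do 2?[case: (leP l0 _) => ?]; apply/andP; split; lra.
have KP0 : 0 <= KP.
  have := PP l0 Lm; rewrite !lexx (ltW l0m) => /(_ isT isT).
  rewrite distrC [`|l0 - _|]distrC (gtr0_norm (_ : 0 < Lm - l0)) ?subr_gt0// => H.
  by have := le_trans (normr_ge0 _) H; rewrite pmulr_lge0// subr_gt0.
have Plip s s' : `|P (cl s) - P (cl s')| <= KP * `|s - s'|.
  by rewrite (le_trans (PP _ _ (clI s) (clI s')))// ler_wpM2l.
have P0 s : 0 <= P (cl s) <= P l0.
  have /andP[c1 c2] := clI s; rewrite -{1}P_Lm !P_nincr//.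
  exact: lt_le_trans c1.
pose num s x := 2 * P (cl s) + F0 - beta (back s x) - beta (front s x).
pose NB := 2 * P l0 + F0 + 2 * (`|M| + `|m|).
have F00 : 0 < F0 by apply: le_lt_trans gravity; rewrite subr_ge0.
have NB0 : 0 <= NB.
  have /andP[p1 p2] := P0 l0; have := normr_ge0 M; have := normr_ge0 m.
  by rewrite /NB; lra.
have numB s x : `|num s x| <= NB.
  have /andP[p1 p2] := P0 s.
  have := beta_ge (back s x); have := beta_ge (front s x).
  have := beta_le (back s x); have := beta_le (front s x).
  have := ler_norm M; have := ler_norm (- m); rewrite normrN.
  have := normr_ge0 M; have := normr_ge0 m.
  by rewrite ler_norml /num /NB => *; apply/andP; split; lra.
have bl s s' x x' : `|beta (back s x) - beta (back s' x')| <= K / 2 * (`|s - s'| + `|x - x'|).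
  rewrite (le_trans (beta_lip _ _))// -mulrA ler_wpM2l//.
  have -> : back s x - back s' x' = 2^-1 * ((x - x') - (s - s')).
    by rewrite /back; field.
  by rewrite normrM ger0_norm// ler_wpM2l// (le_trans (ler_normB _ _))// addrC.
have fl s s' x x' : `|beta (front s x) - beta (front s' x')| <= K / 2 * (`|s - s'| + `|x - x'|).
  rewrite (le_trans (beta_lip _ _))// -mulrA ler_wpM2l//.
  have -> : front s x - front s' x' = 2^-1 * ((x - x') + (s - s')).
    by rewrite /front; field.
  by rewrite normrM ger0_norm// ler_wpM2l// (le_trans (ler_normD _ _))// addrC.
pose G s x := num s x / speed s x.
pose KG := (2 * KP + K) / c0 + NB * K / c0 / c0.
have sp0 s x : 0 < speed s x by apply: lt_le_trans (speed_ge s x).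
have isp s x : 0 <= (speed s x)^-1 <= c0^-1.
  by rewrite invr_ge0 (ltW (sp0 _ _)) lef_pV2 ?posrE ?speed_ge.
have Glip s s' x x' : `|G s x - G s' x'| <= KG * (`|s - s'| + `|x - x'|).
  set S := `|s - s'| + `|x - x'|.
  have S0 : 0 <= S by rewrite addr_ge0.
  have nl : `|num s x - num s' x'| <= (2 * KP + K) * S.
    have := Plip s s'; have := bl s s' x x'; have := fl s s' x x'; rewrite -/S.
    have KPS : KP * `|s - s'| <= KP * S by rewrite ler_wpM2l// lerDl.
    rewrite !ler_norml /num mulrDl => /andP[? ?] /andP[? ?] /andP[? ?].
    by apply/andP; split; lra.
  have sl : `|speed s x - speed s' x'| <= K * S.
    have := bl s s' x x'; have := fl s s' x x'; rewrite -/S.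
    rewrite !ler_norml /speed => /andP[? ?] /andP[? ?].
    by apply/andP; split; lra.
  have -> : G s x - G s' x' = (num s x - num s' x') * (speed s x)^-1 +
      num s' x' * (speed s' x' - speed s x) * (speed s x)^-1 * (speed s' x')^-1.
    rewrite /G; have := sp0 s x; have := sp0 s' x'.
    by move=> /gt_eqF/negbT u1 /gt_eqF/negbT u2; field; rewrite u1 u2.
  have /andP[i1 i2] := isp s x; have /andP[i3 i4] := isp s' x'.
  rewrite (le_trans (ler_normD _ _))// /KG [leRHS]mulrDl lerD//.
    by rewrite normrM (ger0_norm i1) [leRHS]mulrAC ler_pM.
  rewrite !normrM (ger0_norm i1) (ger0_norm i3).
  have -> : NB * K / c0 / c0 * S = NB * (K * S) / c0 / c0 by ring.
  have sl' : `|speed s' x' - speed s x| <= K * S by rewrite distrC.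
  by do 3?[apply: ler_pM; rewrite ?mulr_ge0//].
have GB s x : `|G s x| <= NB / c0.
  have /andP[i1 i2] := isp s x.
  by rewrite normrM (ger0_norm i1) ler_pM.
have KG0 : 0 <= KG.
  have c0p := ltW c0_gt0.
  have KPK : 0 <= 2 * KP + K by rewrite addr_ge0// mulr_ge0.
  have NBK : 0 <= NB * K by rewrite mulr_ge0.
  by apply: addr_ge0; [exact: divr_ge0|apply: divr_ge0 => //; exact: divr_ge0].
have Gl0 x : 0 <= G l0 x.
  rewrite /G divr_ge0 ?(ltW (sp0 _ _))// /num clE ?lexx ?(ltW l0m)//.
  by have := beta_le (back l0 x); have := beta_le (front l0 x); lra.
have Gper s x : G s (x + 2) = G s x.
  have E1 : back s (x + 2) = back s x + 1 by rewrite /back; field.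
  have E2 : front s (x + 2) = front s x + 1 by rewrite /front; field.
  by rewrite /G /num /speed E1 E2 !beta_per.
have [Z [Zp Zb ZL ZD ZC]] := periodic_obstacle_ode l0m KG0 Glip GB Gl0 Gper.
exists Z; split => //.
- by move=> x; have /andP[z1 ->] := Zb x; rewrite (lt_le_trans l00 z1).
- by move=> x /ZD; rewrite /G /num clE ?Zb.
- move=> x /ZC; rewrite /G pmulr_lge0 ?invr_gt0// /num clE ?lexx ?(ltW l0m)//.
  by rewrite P_Lm; lra.
Qed.

(** Time is recovered by integrating the inverse of the speed of [x], which is
    discontinuous where the drop attains or leaves its maximal length. *)
Theorem wave_exists : exists A B T, slide_wave P Lm F0 beta A B T.
Proof.
have [Z [Zp Zb [CZ ZL] ZD ZC]] := length_profile.
have Mm : m <= M by apply: le_trans (beta_le 0).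
have F00 : 0 < F0 by apply: le_lt_trans gravity; rewrite subr_ge0.
have cZ : continuous Z.
  by move=> x; apply: (@lip_continuous _ Z setT CZ) => //; exact: filterT.
have cbeta : continuous beta := beta_cont beta_lip.
have cback : continuous (fun x => back (Z x) x).
  by move=> x; apply: cvgMl; apply: cvgB; [exact: cvg_id|exact: cZ].
have cfront : continuous (fun x => front (Z x) x).
  by move=> x; apply: cvgMl; apply: cvgD; [exact: cvg_id|exact: cZ].
have cbb : continuous (fun x => beta (back (Z x) x)).
  by move=> x; apply: continuous_comp; [exact: cback|exact: cbeta].
have cbf : continuous (fun x => beta (front (Z x) x)).
  by move=> x; apply: continuous_comp; [exact: cfront|exact: cbeta].
pose v1 x := speed (Z x) x.
pose v2 x := Num.max (2 * (F0 - beta (front (Z x) x))) c0.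
(* on contact both ends move with the velocity of the front; the maximum with [c0]
   keeps [v2] positive away from contact *)
pose v x := if Z x < Lm then v1 x else v2 x.
have v_ge x : c0 <= v x.
  by rewrite /v; case: ifP => _; [exact: speed_ge|rewrite le_max lexx orbT].
have v_gt0 x : 0 < v x by apply: lt_le_trans (v_ge x).
pose W := 2 * (F0 + (M - m) + `|m|).
have v_le x : v x <= W.
  have m0 := normr_ge0 m; have mN : - m <= `|m| by rewrite -normrN ler_norm.
  have bx := beta_le (back (Z x) x); have fx := beta_ge (front (Z x) x).
  rewrite /v; case: ifP => _; first by rewrite /v1 /speed /W; lra.
  by rewrite ge_max; apply/andP; split; rewrite /c0 /W; lra.
have W_gt0 : 0 < W by apply: lt_le_trans (v_le 0).
have cv1 : continuous v1.
  by move=> x; apply: cvgB; [apply: cvgD; [exact: cvg_cst|exact: cbb]|exact: cbf].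
have cv2 : continuous v2.
  move=> x; apply: (@continuous_max R _ (fun x => 2 * (F0 - beta (front (Z x) x))) (cst c0)).
    by apply: cvgMr; apply: cvgB; [exact: cvg_cst|exact: cbf].
  exact: cvg_cst.
pose k x := (v x)^-1.
have mk : measurable_fun [set: R] k.
  have -> : k = (fun x => if Z x < Lm then (v1 x)^-1 else (v2 x)^-1).
    by apply/funext => x; rewrite /k /v; case: ifP.
  apply: measurable_fun_ifT.
  - apply: measurable_fun_ltr; last exact: measurable_cst.
    exact: continuous_measurable_fun.
  - apply: continuous_measurable_fun => x; apply: cvgV; last exact: cv1.
    by rewrite gt_eqF// (lt_le_trans c0_gt0)// speed_ge.
  - apply: continuous_measurable_fun => x; apply: cvgV; last exact: cv2.
    by rewrite gt_eqF// (lt_le_trans c0_gt0)// le_max lexx orbT.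
have k_gt0 x : 0 < k x by rewrite invr_gt0.
have k_le x : `|k x| <= c0^-1 by rewrite gtr0_norm// lef_pV2 ?posrE.
have k_ge x : W^-1 <= k x by rewrite lef_pV2 ?posrE.
have [J [JL aeJ]] := bounded_primitive mk k_le.
have Jge s t : s <= t -> W^-1 * (t - s) <= J t - J s.
  exact: primitive_ge JL aeJ k_ge.
have cJ : continuous J.
  by move=> x; apply: (@lip_continuous _ J setT c0^-1) => //; exact: filterT.
have W'0 : 0 < W^-1 by rewrite invr_gt0.
have [rho [rhoK Jrho rhoL]] := expanding_inverse W'0 cJ Jge.
rewrite invrK in rhoL.
have kper x : k (x + 2) = k x.
  have E1 : back (Z x) (x + 2) = back (Z x) x + 1 by rewrite /back; field.
  have E2 : front (Z x) (x + 2) = front (Z x) x + 1 by rewrite /front; field.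
  by rewrite /k /v /v1 /v2 Zp /speed E1 E2 !beta_per.
pose T := J 2 - J 0.
have T_gt0 : 0 < T.
  by rewrite (lt_le_trans _ (Jge 0 2 _))// mulr_gt0// subr0.
have Jper x : J (x + 2) = J x + T.
  pose f x := J (x + 2) - J x.
  have fL (I : set R) : lip_on I f.
    apply: lip_onB; last by exists c0^-1 => *; exact: JL.
    apply: (@lip_on_shift R setT) => //; by exists c0^-1 => *; exact: JL.
  have aef : {ae mu, forall x, is_derive x 1 f 0}.
    apply: aeS (aeI aeJ (ae_shift 2 aeJ)) _ => y [d1 d2].
    have := is_deriveB (is_derive1_shift d2) d1.
    by rewrite kper subrr.
  have fle s t : s <= t -> f t <= f s.
    move=> st; have := lip_ae_derive_le st (fL `[s, t]%classic) (C := 0).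
    rewrite mul0r subr_le0; apply.
    by apply: aeS aef _ => y dy _; exists 0.
  have fge s t : s <= t -> f s <= f t.
    move=> st; have : (- f t) - (- f s) <= 0 * (t - s).
      apply: (@lip_ae_derive_le _ (fun t => - f t)) => //.
        have [C CP] := fL `[s, t]%classic.
        by exists C => y z Iy Iz; rewrite -opprD normrN; exact: CP.
      apply: aeS aef _ => y dy _; exists 0 => //.
      by rewrite -oppr0; exact: is_deriveN.
    by rewrite mul0r; lra.
  have : f x = f 0.
    by case: (leP x 0) => [|/ltW] x0; apply/le_anti; rewrite (fle _ _ x0) (fge _ _ x0).
  by rewrite /f add0r /T; lra.
have rhoT t : rho (t + T) = rho t + 2.
  by rewrite -[in LHS](rhoK t) -Jper Jrho.
pose A t := back (Z (rho t)) (rho t).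
pose B t := front (Z (rho t)) (rho t).
have BA t : B t - A t = Z (rho t) by rewrite /A /B /back /front; field.
have rhol : lip_on setT rho by exists W => s t _ _; exact: rhoL.
have CZ0 : 0 <= CZ.
  by have := ZL 1 0; rewrite subr0 normr1 mulr1; apply: le_trans.
have Zrho s t : `|Z (rho s) - Z (rho t)| <= CZ * (W * `|s - t|).
  by rewrite (le_trans (ZL _ _))// ler_wpM2l.
exists A, B, T; split => //; last first.
- by move=> t; rewrite /B rhoT Zp /front; field.
- by move=> t; rewrite /A rhoT Zp /back; field.
split.
- exists ((W + CZ * W) / 2) => s t _ _.
  have -> : A s - A t = 2^-1 * ((rho s - rho t) - (Z (rho s) - Z (rho t))).
    by rewrite /A /back; field.
  rewrite normrM ger0_norm// mulrC mulrAC ler_wpM2r// (le_trans (ler_normB _ _))//.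
  by rewrite [leRHS]mulrDl -[X in _ <= _ + X]mulrA lerD ?rhoL ?Zrho.
- exists ((W + CZ * W) / 2) => s t _ _.
  have -> : B s - B t = 2^-1 * ((rho s - rho t) + (Z (rho s) - Z (rho t))).
    by rewrite /B /front; field.
  rewrite normrM ger0_norm// mulrC mulrAC ler_wpM2r// (le_trans (ler_normD _ _))//.
  by rewrite [leRHS]mulrDl -[X in _ <= _ + X]mulrA lerD ?rhoL ?Zrho.
- by move=> t _; rewrite BA.
(* almost everywhere on the contact set the length is stationary, and null sets of
   positions are null sets of times *)
pose Q x := is_derive x 1 J (k x) /\ (Z x = Lm -> is_derive x 1 Z 0).
have aeQ : {ae mu, forall x, Q x} by exact: aeI aeJ (level_set_derive Lm ZL).
have {aeQ} : {ae mu, forall t, Q (rho t)}.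
  have := negligible_lip_image JL aeQ.
  by apply: negligibleS => t /= Qt; exists (rho t).
move=> aeQ; apply: aeS aeQ _ => t [dJ dZ] _.
set x := rho t in dJ dZ *.
have drho : is_derive t 1 rho (v x).
  rewrite -(rhoK t) -[v x]invrK; apply: (is_derive_inverse _ _ dJ).
  - by near=> y; exact: Jrho.
  - by near=> y; exact: cJ.
  - by rewrite gt_eqF.
have dAB z' : is_derive x 1 Z z' ->
    is_derive t 1 A ((v x - z' * v x) / 2) /\ is_derive t 1 B ((v x + z' * v x) / 2).
  move=> dZx; have dZr : is_derive t 1 (fun t => Z (rho t)) (z' * v x).
    exact: (@is_derive1_comp R Z rho t _ _ dZx drho).
  by split; rewrite /A /B /back /front; apply: is_derive_eq;
    rewrite /GRing.scale/=; ring.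
have /andP[Z0 Z1] := Zb x.
have [ZLm|ZLm] := ltP (Z x) Lm.
  have [dA dB] := dAB _ (ZD x ZLm).
  have vE : v x = speed (Z x) x by rewrite /v ZLm.
  have spn : speed (Z x) x != 0 by rewrite -vE gt_eqF.
  eexists; eexists; split; [exact: dA|exact: dB| | |]; rewrite BA -/x vE divfK//.
  - by rewrite /B /front -/x /speed /front; field.
  - by rewrite /A /back -/x /speed /back; lra.
  - by move=> _; rewrite /A /back -/x /speed /back; field.
have {ZLm Z1}ZE : Z x = Lm by apply/le_anti; rewrite Z1.
have [dA dB] := dAB _ (dZ ZE).
have bF : beta (A t) + beta (B t) <= F0 by rewrite /A /B -/x ZE; exact: ZC.
have vE : v x = 2 * (F0 - beta (B t)).
  rewrite /v ZE ltxx /v2; apply/max_idPl; rewrite -/(B t).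
  by move: (beta_ge (A t)) (beta_le (B t)); rewrite /c0; lra.
eexists; eexists; split; [exact: dA|exact: dB| | |]; rewrite BA -/x vE ZE ?P_Lm mul0r.
- by field.
- lra.
- by rewrite ltxx.
Unshelve. all: by end_near. Qed.

End wave_existence.

(** * Pinned drops as barriers *)

Section sticking.
Variable R : realType.
Variables (P : R -> R) (Lm F0 : R) (beta : R -> R) (K : R).
Hypothesis P_nincr : forall l l', 0 < l -> l <= l' -> l' <= Lm -> P l' <= P l.
Hypothesis K_ge0 : 0 <= K.
Hypothesis beta_lip : forall x y, `|beta x - beta y| <= K * `|x - y|.

Lemma periodic_int (f : R -> R) p : (forall x, f (x + p) = f x) ->
  forall (j : int) x, f (x + j%:~R * p) = f x.
Proof.
move=> fp j x.
have nat_ n y : f (y + n%:R * p) = f y.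
  have f0 z : f (z + p) = f z + 0 by rewrite addr0 fp.
  by rewrite mulr_natl (periodicE f0) mul0rn addr0.
case: j => n; first by rewrite -pmulrn nat_.
rewrite NegzE mulrNz mulNr -pmulrn.
by rewrite -[in RHS](subrK (n.+1%:R * p) x) nat_.
Qed.

(** A drop at rest with its back at a minimum of [beta] and its front at a
    maximum is a barrier, provided that its length lies between [l1] and [l2];
    such drops exist arbitrarily far downhill when the period is less than
    [l2 - l1]. *)
Theorem slides_stick (M m xM xm l1 l2 p : R) a b :
  beta xM = M -> beta xm = m -> (forall x, beta (x + p) = beta x) ->
  0 < p -> p < l2 - l1 -> 0 < l1 -> l2 <= Lm -> P l1 + F0 <= M -> m <= P l2 ->
  slides P Lm F0 beta `[0, +oo[ a b ->
  exists xa xb, forall t, 0 <= t -> a t <= xa /\ b t <= xb.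
Proof.
move=> bM bm bp p0 pl l10 l2m Pl1 Pl2 sab.
have [n nP] := nat_ge ((Num.max (a 0) (b 0) - xm) / p).
pose xa := xm + n%:~R * p.
pose j : int := Num.floor ((xa + l2 - xM) / p).
pose xb := xM + j%:~R * p.
have xaP : Num.max (a 0) (b 0) <= xa.
  by move: nP; rewrite ler_pdivrMr// /xa -pmulrn; lra.
have /andP[j1 j2] := floor_itv ((xa + l2 - xM) / p).
rewrite -/j ler_pdivlMr// in j1.
rewrite -/j ltr_pdivrMr// intrD mulrDl mul1r in j2.
have Ll : l1 <= xb - xa <= l2 by rewrite /xb; apply/andP; split; lra.
have /andP[L1 L2] := Ll.
have bxa : beta xa = m by rewrite /xa periodic_int.
have bxb : beta xb = M by rewrite /xb periodic_int.
exists xa, xb; apply: (slide_comparison P_nincr K_ge0 beta_lip sab).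
- split.
  + by exists 0 => s t _ _; rewrite subrr normr0 mul0r.
  + by exists 0 => s t _ _; rewrite subrr normr0 mul0r.
  + by move=> t _; apply/andP; split; lra.
  + apply: aeS (ae_neq 0) _ => t _ _; exists 0, 0; split.
    * exact: is_derive_cst.
    * exact: is_derive_cst.
    * have : P (xb - xa) <= P l1 by apply: P_nincr => //; lra.
      by rewrite bxb; lra.
    * have : P l2 <= P (xb - xa) by apply: P_nincr => //; lra.
      by rewrite bxa; lra.
- by move: xaP; rewrite ge_max => /andP[].
- by move: xaP; rewrite ge_max => /andP[_]; lra.
Qed.

End sticking.

(** * Hyperbolic functions *)

Section hyperbolic.
Variable R : realType.
Implicit Types x y t : R.

Definition sinh x : R := (expR x - expR (- x)) / 2.
Definition cosh x : R := (expR x + expR (- x)) / 2.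

Lemma sinh0 : sinh 0 = 0.
Proof. by rewrite /sinh oppr0 subrr mul0r. Qed.

Lemma sinhN x : sinh (- x) = - sinh x.
Proof. by rewrite /sinh opprK; field. Qed.

Lemma coshN x : cosh (- x) = cosh x.
Proof. by rewrite /cosh opprK addrC. Qed.

Lemma cosh_sinh x : cosh x ^+ 2 - sinh x ^+ 2 = 1.
Proof.
have : expR x * expR (- x) = 1 by rewrite -expRD subrr expR0.
by rewrite /cosh /sinh => e; field : e.
Qed.

Lemma sinhD x y : sinh (x + y) = sinh x * cosh y + cosh x * sinh y.
Proof. by rewrite /sinh /cosh opprD !expRD; field. Qed.

Lemma coshD x y : cosh (x + y) = cosh x * cosh y + sinh x * sinh y.
Proof. by rewrite /sinh /cosh opprD !expRD; field. Qed.

Lemma is_derive_sinh x : is_derive x 1 sinh (cosh x).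
Proof.
rewrite /sinh; apply: is_derive_eq.
by rewrite /cosh /GRing.scale/=; field.
Qed.

Lemma is_derive_cosh x : is_derive x 1 cosh (sinh x).
Proof.
rewrite /cosh; apply: is_derive_eq.
by rewrite /sinh /GRing.scale/=; field.
Qed.

Lemma cosh_gt0 x : 0 < cosh x.
Proof. by rewrite divr_gt0// addr_gt0// expR_gt0. Qed.

Lemma sinh_gt0 x : 0 < x -> 0 < sinh x.
Proof. by move=> x0; rewrite divr_gt0// subr_gt0 ltr_expR; lra. Qed.

Lemma cosh_incr x y : 0 <= x -> x < y -> cosh x < cosh y.
Proof.
move=> x0 xy; rewrite -subr_gt0.
have [z /andP[xz _] ->] := is_derive_MVT xy (fun t _ => is_derive_cosh t).
apply: mulr_gt0; last by rewrite subr_gt0.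
by apply: sinh_gt0; apply: le_lt_trans xz.
Qed.

Lemma sinh_ge x : 0 < x -> x <= sinh x.
Proof.
move=> x0; have [z /andP[z0 _]] := is_derive_MVT x0 (fun t _ => is_derive_sinh t).
rewrite sinh0 !subr0 => ->; rewrite ler_peMl ?(ltW x0)//.
by have := cosh_incr (lexx 0) z0; rewrite {1}/cosh oppr0 expR0; lra.
Qed.

Lemma sinh_lt x : 0 < x -> sinh x < x * cosh x.
Proof.
move=> x0; have [z /andP[z0 zx]] := is_derive_MVT x0 (fun t _ => is_derive_sinh t).
by rewrite sinh0 !subr0 => ->; rewrite mulrC ltr_pM2l// cosh_incr// ltW.
Qed.

(** The function [x coth x - 1], through which all geometric quantities of a
    drop depend on its length. *)
Definition xcoth1 x := x * cosh x / sinh x - 1.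

Lemma xcoth1_gt0 x : 0 < x -> 0 < xcoth1 x.
Proof.
by move=> x0; rewrite subr_gt0 ltr_pdivlMr ?sinh_gt0// mul1r sinh_lt.
Qed.

Lemma is_derive_xcoth1 x : 0 < x ->
  is_derive x 1 xcoth1 ((sinh x * cosh x - x) / sinh x ^+ 2).
Proof.
move=> x0; have s0 : sinh x != 0 by rewrite gt_eqF// sinh_gt0.
have ds := is_derive_sinh x; have dc := is_derive_cosh x.
have dv := is_deriveV s0 ds.
rewrite /xcoth1; apply: is_derive_eq.
rewrite /GRing.scale/=; have := cosh_sinh x => e.
have -> : sinh x * cosh x - x = sinh x * cosh x - x * (cosh x ^+ 2 - sinh x ^+ 2).
  by rewrite e mulr1.
by field.
Qed.

Lemma xcoth1_derive_bounds x : 0 < x ->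
  0 < (sinh x * cosh x - x) / sinh x ^+ 2 <= 1.
Proof.
move=> x0; have s0 := sinh_gt0 x0; have s2 : 0 < sinh x ^+ 2 by rewrite exprn_gt0.
have sx := sinh_ge x0.
apply/andP; split.
  rewrite divr_gt0// subr_gt0 (le_lt_trans sx)// ltr_pMr//.
  by have := cosh_incr (lexx 0) x0; rewrite {1}/cosh oppr0 expR0; lra.
rewrite ler_pdivrMr// mul1r.
have : sinh x * (cosh x - sinh x) <= x.
  have -> : cosh x - sinh x = expR (- x) by rewrite /cosh /sinh; field.
  have -> : sinh x * expR (- x) = (1 - expR (- (2 * x))) / 2.
    rewrite /sinh mulrAC mulrBl -!expRD subrr expR0.
    by have -> : - x + - x = - (2 * x) by ring.
  by have := expR_ge1Dx (- (2 * x)); lra.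
by rewrite mulrBr expr2; lra.
Qed.

Lemma xcoth1_incr x y : 0 < x -> x < y -> xcoth1 x < xcoth1 y.
Proof.
move=> x0 xy; rewrite -subr_gt0.
have d t : x <= t <= y ->
    is_derive t 1 xcoth1 ((sinh t * cosh t - t) / sinh t ^+ 2).
  by move=> /andP[xt _]; apply: is_derive_xcoth1; apply: lt_le_trans xt.
have [z /andP[xz _] ->] := is_derive_MVT xy d.
apply: mulr_gt0; last by rewrite subr_gt0.
by have /andP[] := xcoth1_derive_bounds (lt_trans x0 xz).
Qed.

Lemma xcoth1_ndecr x y : 0 < x -> x <= y -> xcoth1 x <= xcoth1 y.
Proof.
by move=> x0; rewrite le_eqVlt => /predU1P[->//|/(xcoth1_incr x0)/ltW].
Qed.

Lemma xcoth1_lip x y : 0 < x -> x <= y -> xcoth1 y - xcoth1 x <= y - x.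
Proof.
move=> x0; rewrite le_eqVlt => /predU1P[->|xy]; first by rewrite !subrr.
have d t : x <= t <= y ->
    is_derive t 1 xcoth1 ((sinh t * cosh t - t) / sinh t ^+ 2).
  by move=> /andP[xt _]; apply: is_derive_xcoth1; apply: lt_le_trans xt.
have [z /andP[xz _] ->] := is_derive_MVT xy d.
rewrite ler_piMl ?subr_ge0 ?(ltW xy)//.
by have /andP[] := xcoth1_derive_bounds (lt_trans x0 xz).
Qed.

Lemma xcoth1_cont x : 0 < x -> {for x, continuous xcoth1}.
Proof.
by move=> /is_derive_xcoth1[/derivable1_diffP/differentiable_continuous].
Qed.

Lemma xcoth1_le x : 0 < x -> xcoth1 x <= x.
Proof.
move=> x0; have s0 := sinh_gt0 x0.
rewrite lerBlDr ler_pdivrMr//.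
have -> : cosh x = expR (- x) + sinh x by rewrite /cosh /sinh; field.
have : x * expR (- x) <= x.
  by rewrite ler_piMr ?(ltW x0)// -expR0 ler_expR oppr_le0 ltW.
by have := sinh_ge x0; rewrite mulrDr mulrDl mul1r; lra.
Qed.

Lemma xcoth1_ge x : 0 < x -> x - 1 <= xcoth1 x.
Proof.
move=> x0; have s0 := sinh_gt0 x0.
rewrite lerD2r ler_pdivlMr// ler_wpM2l ?(ltW x0)//.
by have := expR_gt0 (- x); rewrite /sinh /cosh; lra.
Qed.

End hyperbolic.

(** * Contact slopes of a drop *)

Section contact_slopes.
Variable R : realType.
Implicit Types L l : R.
Variables (V0 c s : R).
Hypothesis V0_gt0 : 0 < V0.
Hypothesis c_gt0 : 0 < c.
Hypothesis s_gt0 : 0 < s.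

Definition omega : R := Num.sqrt c.

Lemma omega_gt0 : 0 < omega. Proof. by rewrite sqrtr_gt0. Qed.
Lemma omega2 : omega ^+ 2 = c. Proof. by rewrite sqr_sqrtr// ltW. Qed.

Definition theta L := omega * L / 2.

Lemma theta_gt0 L : 0 < L -> 0 < theta L.
Proof. by move=> L0; rewrite divr_gt0// mulr_gt0// omega_gt0. Qed.

Lemma theta_lt l L : l < L -> theta l < theta L.
Proof. by move=> lL; rewrite ltr_pM2r ?invr_gt0// ltr_pM2l// omega_gt0. Qed.

Definition back_slope L := V0 * c / 2 / xcoth1 (theta L) - s / c * xcoth1 (theta L).
Definition front_slope L := V0 * c / 2 / xcoth1 (theta L) + s / c * xcoth1 (theta L).

Let k_gt0 L : 0 < L -> 0 < xcoth1 (theta L).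
Proof. by move=> /theta_gt0/xcoth1_gt0. Qed.

Lemma front_slope_gt0 L : 0 < L -> 0 < front_slope L.
Proof.
move=> /k_gt0 k0; rewrite addr_gt0// ?divr_gt0// ?mulr_gt0// ?invr_gt0//.
Qed.

(** The total force on the drop is its weight along the incline. *)
Lemma slope_balance L : 0 < L ->
  front_slope L ^+ 2 / 2 = back_slope L ^+ 2 / 2 + V0 * s.
Proof.
move=> /k_gt0/gt_eqF/negbT k0; rewrite /front_slope /back_slope.
by field; rewrite k0 gt_eqF.
Qed.

Lemma back_slope_decr l L : 0 < l -> l < L -> back_slope L < back_slope l.
Proof.
move=> l0 lL; have kl := k_gt0 l0; have kL := k_gt0 (lt_trans l0 lL).
have kk := xcoth1_incr (theta_gt0 l0) (theta_lt lL).
have A0 : 0 < V0 * c / 2 by rewrite divr_gt0// mulr_gt0.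
have sc : 0 < s / c by rewrite divr_gt0.
rewrite /back_slope ltrD// ?ltrN2 ?ltr_pM2l// ltf_pV2 ?posrE//.
Qed.

(** A quantitative monotonicity: the first term of the slope decreases, and the
    second one already accounts for the gap. *)
Lemma back_slope_gap l L : 0 < l -> l <= L ->
  s / c * (xcoth1 (theta L) - xcoth1 (theta l)) <= back_slope l - back_slope L.
Proof.
rewrite le_eqVlt => l0 /predU1P[->|lL]; first by rewrite !subrr mulr0.
have kl := k_gt0 l0; have kL := k_gt0 (lt_trans l0 lL).
have kk := xcoth1_incr (theta_gt0 l0) (theta_lt lL).
have A0 : 0 < V0 * c / 2 by rewrite divr_gt0// mulr_gt0.
have : V0 * c / 2 / xcoth1 (theta L) <= V0 * c / 2 / xcoth1 (theta l).
  by rewrite ler_pM2l// lef_pV2 ?posrE// ltW.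
by rewrite /back_slope; lra.
Qed.

Lemma back_slope_cont L : 0 < L -> {for L, continuous back_slope}.
Proof.
move=> L0; have k0 := k_gt0 L0.
have ck : {for L, continuous (fun L => xcoth1 (theta L))}.
  apply: continuous_comp; last exact: xcoth1_cont (theta_gt0 L0).
  by apply: cvgMl; apply: cvgMr; exact: cvg_id.
apply: cvgB; apply: cvgMr; last exact: ck.
by apply: cvgV; [rewrite gt_eqF|exact: ck].
Qed.

Definition half_sqr_slope L := back_slope L ^+ 2 / 2.

Lemma half_sqr_slope_cont L : 0 < L -> {for L, continuous half_sqr_slope}.
Proof.
move=> /back_slope_cont cp; apply: cvgMl.
by rewrite expr2; apply: cvgM.
Qed.

(** The longest drop whose profile is nonnegative touches the incline
    tangentially at its back. *)
Lemma critical_length : exists2 Lm, 0 < Lm & back_slope Lm = 0.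
Proof.
pose ks := Num.sqrt (V0 * c ^+ 2 / (2 * s)).
have A0 : 0 < V0 * c ^+ 2 / (2 * s).
  by rewrite divr_gt0// mulr_gt0// exprn_gt0.
have ks0 : 0 < ks by rewrite sqrtr_gt0.
have ks2 : ks ^+ 2 = V0 * c ^+ 2 / (2 * s) by rewrite sqr_sqrtr// ltW.
have [t t0 kt] : exists2 t, 0 < t & xcoth1 t = ks.
  have k2 : 0 < ks / 2 by rewrite divr_gt0.
  have kk : ks / 2 <= ks + 1 by lra.
  have ck : {within `[ks / 2, ks + 1], continuous (@xcoth1 R)}.
    apply: continuous_in_subspaceT => t; rewrite inE/= in_itv/= => /andP[kt _].
    by apply: xcoth1_cont; apply: lt_le_trans kt.
  have [|t] := @IVT R _ _ _ ks kk ck.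
    have := xcoth1_le k2; have : 0 < ks + 1 by lra.
    move=> /xcoth1_ge k3 k4; rewrite ge_min le_max; apply/andP; split; apply/orP.
      by left; lra.
    by right; lra.
  rewrite in_itv/= => /andP[kt _] tk; exists t => //.
  exact: lt_le_trans kt.
exists (2 * t / omega); first by rewrite divr_gt0 ?omega_gt0// mulr_gt0.
have -> : back_slope (2 * t / omega) = V0 * c / 2 / ks - s / c * ks.
  rewrite /back_slope /theta; have -> : omega * (2 * t / omega) / 2 = t.
    by field; rewrite gt_eqF// omega_gt0.
  by rewrite kt.
have ksn : ks != 0 by rewrite gt_eqF.
have -> : V0 * c / 2 / ks - s / c * ks = (V0 * c / 2 - s / c * ks ^+ 2) / ks.
  by field; rewrite ksn gt_eqF.
by rewrite ks2; field; rewrite ksn !gt_eqF.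
Qed.

Variable Lm : R.
Hypothesis Lm_gt0 : 0 < Lm.
Hypothesis Lm_crit : back_slope Lm = 0.

Lemma back_slope_ge0 L : 0 < L -> (0 <= back_slope L) = (L <= Lm).
Proof.
move=> L0; case: (ltgtP L Lm) => [LL|LL|->]; last by rewrite Lm_crit lexx.
  by rewrite ltW// -Lm_crit back_slope_decr.
by apply/negbTE; rewrite -ltNge -Lm_crit back_slope_decr.
Qed.

Lemma back_slope_gt0 L : 0 < L -> L < Lm -> 0 < back_slope L.
Proof. by move=> L0 LL; rewrite -Lm_crit back_slope_decr. Qed.

Lemma half_sqr_slope_Lm : half_sqr_slope Lm = 0.
Proof. by rewrite /half_sqr_slope Lm_crit expr0n mul0r. Qed.

Let back_slope_ndecr l L : 0 < l -> l <= L -> back_slope L <= back_slope l.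
Proof.
by move=> l0; rewrite le_eqVlt => /predU1P[->//|/(back_slope_decr l0)/ltW].
Qed.

Lemma half_sqr_slope_nincr l l' : 0 < l -> l <= l' -> l' <= Lm ->
  half_sqr_slope l' <= half_sqr_slope l.
Proof.
move=> l0 ll lm; rewrite /half_sqr_slope ler_pM2r ?invr_gt0//.
have l'0 : 0 < l' by apply: lt_le_trans ll.
have p' : 0 <= back_slope l' by rewrite back_slope_ge0.
have pp := back_slope_ndecr l0 ll.
by rewrite ler_pXn2r// ?nnegrE// (le_trans p').
Qed.

(** Near [Lm], where the derivative of the square vanishes, a gap remains
    because the slope itself decreases at a positive rate. *)
Lemma half_sqr_slope_decr_unif e : 0 < e -> exists2 eta, 0 < eta &
  forall l l', 0 < l -> l + e <= l' -> l' <= Lm ->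
    half_sqr_slope l' + eta <= half_sqr_slope l.
Proof.
move=> e0; pose h := e / 2.
have h0 : 0 < h by rewrite divr_gt0.
have [hLm|Lmh] := leP h Lm; last first.
  by exists 1 => // l l' l0 ll lm; move: Lmh; rewrite /h; lra.
pose f l := xcoth1 (theta (l + h)) - xcoth1 (theta l).
have ck l : 0 < l -> {for l, continuous (fun l => xcoth1 (theta l))}.
  move=> l0; apply: continuous_comp; last exact: xcoth1_cont (theta_gt0 l0).
  by apply: cvgMl; apply: cvgMr; exact: cvg_id.
have cf : {within `[h, Lm], continuous f}.
  apply: continuous_in_subspaceT => l; rewrite inE/= in_itv/= => /andP[hl _].
  have l0 : 0 < l by apply: lt_le_trans hl.
  apply: cvgB; last exact: ck.
  apply: (@continuous_comp _ _ _ (fun l => l + h) (fun l => xcoth1 (theta l))).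
    by apply: cvgD; [exact: cvg_id|exact: cvg_cst].
  by apply: ck; rewrite addr_gt0.
have [l0 l0I fmin] := EVT_min hLm cf.
have l00 : 0 < l0 by move: l0I; rewrite in_itv/= => /andP[hl _]; apply: lt_le_trans hl.
have f0 : 0 < f l0.
  by rewrite subr_gt0 xcoth1_incr ?theta_gt0// theta_lt// ltrDl.
pose d := s / c * f l0.
have d0 : 0 < d by rewrite mulr_gt0// divr_gt0.
exists (d ^+ 2 / 2); first by rewrite divr_gt0// exprn_gt0.
move=> l l' lp ll lm.
have l1I : l + h \in `[h, Lm] by rewrite in_itv/= /h; apply/andP; split; lra.
have := fmin _ l1I; rewrite /f => f1.
have lh0 : 0 < l + h by rewrite addr_gt0.
have g1 := back_slope_gap lp (_ : l <= l + h).
have g2 := back_slope_gap lh0 (_ : l + h <= l + h + h).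
have e2 : l + h + h = l + e by rewrite /h; field.
have g3 : back_slope l' <= back_slope (l + h + h).
  by apply: back_slope_ndecr; rewrite e2//; lra.
have p'0 : 0 <= back_slope l' by rewrite back_slope_ge0//; lra.
have dp : d <= back_slope l - back_slope l'.
  have g4 : back_slope (l + h) <= back_slope l by apply: back_slope_ndecr => //; lra.
  have : s / c * f l0 <= s / c * (xcoth1 (theta (l + h + h)) - xcoth1 (theta (l + h))).
    by rewrite ler_pM2l// divr_gt0.
  by have := g2; rewrite lerDl (ltW h0) => /(_ isT); rewrite /d; lra.
have : d ^+ 2 <= (back_slope l - back_slope l') ^+ 2.
  by rewrite ler_pXn2r// ?nnegrE ?(ltW d0)// (le_trans (ltW d0)).
have : 0 <= back_slope l' * (back_slope l - back_slope l').
  by rewrite mulr_ge0// (le_trans (ltW d0)).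
by rewrite /half_sqr_slope; nra.
Qed.

Lemma half_sqr_slope_lip l0 : 0 < l0 -> exists C, forall l l',
  l0 <= l <= Lm -> l0 <= l' <= Lm ->
  `|half_sqr_slope l - half_sqr_slope l'| <= C * `|l - l'|.
Proof.
move=> l00; have k0 := k_gt0 l00.
set k := xcoth1 (theta l0) in k0.
pose C1 := (V0 * c / 2 / k / k + s / c) * (omega / 2).
exists (back_slope l0 * C1) => l l'.
wlog ll : l l' / l <= l'.
  move=> wl; case: (leP l l') => ll ? ?; first exact: wl.
  by rewrite distrC [`|l - l'|]distrC; apply: wl => //; exact: ltW.
move=> /andP[l0l lm] /andP[l0l' lm'].
have lp : 0 < l by apply: lt_le_trans l0l.
have lp' : 0 < l' by apply: lt_le_trans l0l'.
have tl : theta l <= theta l'.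
  by rewrite ler_pM2r ?invr_gt0// ler_pM2l// omega_gt0.
have kl : k <= xcoth1 (theta l).
  by rewrite xcoth1_ndecr ?theta_gt0// ler_pM2r ?invr_gt0// ler_pM2l// omega_gt0.
have kk := xcoth1_ndecr (theta_gt0 lp) tl.
have kd := xcoth1_lip (theta_gt0 lp) tl.
have td : theta l' - theta l = omega / 2 * (l' - l) by rewrite /theta; field.
set kl1 := xcoth1 (theta l) in kl kk kd *; set kl2 := xcoth1 (theta l') in kk kd *.
have kl10 : 0 < kl1 by apply: lt_le_trans kl.
have kl20 : 0 < kl2 by apply: lt_le_trans kk.
have p0 : 0 <= back_slope l' by rewrite back_slope_ge0.
have pp : back_slope l' <= back_slope l by exact: back_slope_ndecr.
have p1 : back_slope l <= back_slope l0 by exact: back_slope_ndecr.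
have dp : back_slope l - back_slope l' <= C1 * (l' - l).
  have -> : back_slope l - back_slope l' =
      (V0 * c / 2 / kl1 / kl2 + s / c) * (kl2 - kl1).
    by rewrite /back_slope -/kl1 -/kl2; field; rewrite !gt_eqF.
  rewrite /C1 -[leRHS]mulrA -td; apply: ler_pM => //.
  - by rewrite addr_ge0// ltW// ?divr_gt0// ?mulr_gt0.
  - by rewrite subr_ge0.
  rewrite lerD2r -!mulrA !ler_pM2l ?invr_gt0//.
  by apply: ler_pM; rewrite ?invr_ge0 ?(ltW kl10) ?(ltW kl20)// lef_pV2 ?posrE// (le_trans kl).
have Pd : half_sqr_slope l - half_sqr_slope l' =
    (back_slope l - back_slope l') * ((back_slope l + back_slope l') / 2).
  by rewrite /half_sqr_slope; field.
have av0 : 0 <= (back_slope l + back_slope l') / 2 by lra.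
have dp0 : 0 <= back_slope l - back_slope l' by rewrite subr_ge0.
have ll0' : 0 <= l' - l by rewrite subr_ge0.
rewrite Pd (ger0_norm (mulr_ge0 dp0 av0)) distrC (ger0_norm ll0').
have -> : back_slope l0 * C1 * (l' - l) = C1 * (l' - l) * back_slope l0 by ring.
by apply: ler_pM => //; lra.
Qed.

Lemma half_sqr_slope_large C : exists2 l0, 0 < l0 < Lm & C <= half_sqr_slope l0.
Proof.
pose D := 2 * `|C| + 1.
have D1 : 1 <= D by rewrite lerDr mulr_ge0.
have sc : 0 < s / c by rewrite divr_gt0.
have A0 : 0 < V0 * c / 2 by rewrite divr_gt0// mulr_gt0.
pose t := Num.min (Num.min 1 (V0 * c / 2 / (D + s / c))) (theta Lm / 2).
have Ds : 0 < D + s / c by lra.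
have tLm := theta_gt0 Lm_gt0.
have t0 : 0 < t by rewrite /t !lt_min ltr01 (divr_gt0 A0 Ds) divr_gt0.
have t1 : t <= 1 by rewrite /t !ge_min lexx.
have tA : t <= V0 * c / 2 / (D + s / c) by rewrite /t !ge_min lexx !orbT.
have tL : t <= theta Lm / 2 by rewrite /t !ge_min lexx !orbT.
have om := omega_gt0.
pose l0 := 2 * t / omega.
have thl : theta l0 = t by rewrite /theta /l0; field; rewrite gt_eqF.
have l00 : 0 < l0 by rewrite divr_gt0// mulr_gt0.
have kt := xcoth1_le t0; have k0 := xcoth1_gt0 t0.
exists l0.
  rewrite l00/= ltNge; apply/negP => lL.
  have : theta Lm <= theta l0 by rewrite ler_pM2r ?invr_gt0// ler_pM2l.
  by rewrite thl; lra.
have DP : D <= back_slope l0.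
  rewrite /back_slope thl.
  have : D + s / c <= V0 * c / 2 / xcoth1 t.
    rewrite ler_pdivlMr// mulrC -ler_pdivlMr// (le_trans kt)//.
  have : s / c * xcoth1 t <= s / c by rewrite ler_piMr ?(ltW sc)// (le_trans kt).
  lra.
have : D ^+ 2 <= back_slope l0 ^+ 2.
  by rewrite ler_pXn2r// ?nnegrE; lra.
have : D * 1 <= D * D by rewrite ler_pM2l; lra.
by rewrite /half_sqr_slope /D expr2; have := ler_norm C; lra.
Qed.

(** The gap between the two critical lengths for depinning: the front is
    blocked at a maximum of [beta] as soon as the drop is longer than
    [l1], the back at a minimum as long as it is shorter than [l2]. *)
Lemma pinning_lengths M m : 0 <= m -> V0 * s < M - m -> exists l1 l2,
  [/\ 0 < l1, l1 < l2, l2 <= Lm, half_sqr_slope l1 + V0 * s <= M &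
      m <= half_sqr_slope l2].
Proof.
move=> m0 Mm.
have [l0 /andP[l00 l0m] Pl0] := half_sqr_slope_large (M - V0 * s).
have cP x y : 0 < x -> {within `[x, y], continuous half_sqr_slope}.
  move=> x0; apply: continuous_in_subspaceT => l; rewrite inE/= in_itv/= => /andP[xl _].
  by apply: half_sqr_slope_cont; apply: lt_le_trans xl.
have [|l1 l1I P1] := @IVT R _ _ _ (M - V0 * s) (ltW l0m) (cP _ Lm l00).
  by rewrite half_sqr_slope_Lm ge_min le_max; apply/andP; split; apply/orP;
    [right; lra|left].
move: l1I; rewrite in_itv/= => /andP[l01 l1m].
have l10 : 0 < l1 by apply: lt_le_trans l01.
have [|l2 l2I P2] := @IVT R _ _ _ m l1m (cP _ Lm l10).
  by rewrite half_sqr_slope_Lm P1 ge_min le_max m0 !orbT/=; apply/orP; left; lra.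
move: l2I; rewrite in_itv/= => /andP[l12 l2m].
exists l1, l2; split => //.
- rewrite lt_neqAle l12 andbT; apply/eqP => E; move: P2; rewrite -E P1; lra.
- by rewrite P1; lra.
- by rewrite P2.
Qed.

End contact_slopes.

(** * The profile of a drop on [[0, L]] *)

Section profile.
Variable R : realType.
Implicit Types L x : R.
Variables (V0 c s : R).
Hypothesis V0_gt0 : 0 < V0.
Hypothesis c_gt0 : 0 < c.
Hypothesis s_gt0 : 0 < s.
Local Notation om := (omega c).
Local Notation th := (theta c).

(** The profile on [[0, L]] is the sum of two functions that vanish at both ends:
    one is even about [L / 2], solves [- w'' + c * w = c * amplitude L], and
    carries the volume; the other one is odd, solves
    [- w'' + c * w = s * (x - L / 2)], and is the effect of the incline. *)
Definition amplitude L := V0 * om * cosh (th L) / (2 * sinh (th L) * xcoth1 (th L)).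
Definition arch L x :=
  amplitude L * (1 - cosh (om * (x - L / 2)) / cosh (th L)) +
  s / c * (x - L / 2 - L / 2 * sinh (om * (x - L / 2)) / sinh (th L)).
Definition arch1 L x :=
  - amplitude L * om * sinh (om * (x - L / 2)) / cosh (th L) +
  s / c * (1 - L / 2 * om * cosh (om * (x - L / 2)) / sinh (th L)).
Definition arch2 L x :=
  - amplitude L * c * cosh (om * (x - L / 2)) / cosh (th L) -
  s * (L / 2) * sinh (om * (x - L / 2)) / sinh (th L).
Definition arch_primitive L x :=
  amplitude L * (x - sinh (om * (x - L / 2)) / (om * cosh (th L))) +
  s / c * ((x - L / 2) ^+ 2 / 2 - L / 2 * cosh (om * (x - L / 2)) / (om * sinh (th L))).

Let om0 : om != 0. Proof. by rewrite gt_eqF// omega_gt0. Qed.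
Let om2 : om ^+ 2 = c. Proof. exact: omega2. Qed.
Let c0 : c != 0. Proof. by rewrite gt_eqF. Qed.
Let ch0 y : cosh y != 0 :> R. Proof. by rewrite gt_eqF// cosh_gt0. Qed.
Let sh0 L : 0 < L -> sinh (th L) != 0.
Proof. by move=> L0; rewrite gt_eqF// sinh_gt0// theta_gt0. Qed.
Let k0 L : 0 < L -> xcoth1 (th L) != 0.
Proof. by move=> L0; rewrite gt_eqF// xcoth1_gt0// theta_gt0. Qed.
Let thE L : th L = om * (L / 2). Proof. by rewrite /theta mulrA. Qed.
Let thN L : om * (0 - L / 2) = - th L. Proof. by rewrite sub0r mulrN thE. Qed.
Let thP L : om * (L - L / 2) = th L. Proof. by rewrite thE; field. Qed.

Let is_derive_shifted (f f' : R -> R) L x : (forall y : R, is_derive y 1 f (f' y)) ->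
  is_derive x 1 (fun x => f (om * (x - L / 2))) (om * f' (om * (x - L / 2))).
Proof.
move=> df; have -> : om * f' (om * (x - L / 2)) = f' (om * (x - L / 2)) * om by rewrite mulrC.
apply: (@is_derive1_comp _ f (fun x => om * (x - L / 2))) => //.
by apply: is_derive_eq; rewrite /GRing.scale/=; ring.
Qed.

Let dsinh L x := is_derive_shifted L x (@is_derive_sinh R).
Let dcosh L x := is_derive_shifted L x (@is_derive_cosh R).

Lemma arch0 L : 0 < L -> arch L 0 = 0.
Proof.
move=> L0; rewrite /arch thN coshN sinhN; field.
by rewrite ?c0 ?ch0 ?sh0.
Qed.

Lemma archL L : 0 < L -> arch L L = 0.
Proof.
move=> L0; rewrite /arch thP; field.
by rewrite ?c0 ?ch0 ?sh0.
Qed.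

Lemma is_derive_arch L x : is_derive x 1 (arch L) (arch1 L x).
Proof.
have := dsinh L x; have := dcosh L x => d1 d2.
rewrite /arch /arch1; apply: is_derive_eq.
by rewrite /GRing.scale/=; ring.
Qed.

Lemma is_derive_arch1 L x : 0 < L -> is_derive x 1 (arch1 L) (arch2 L x).
Proof.
move=> L0; have := dsinh L x; have := dcosh L x => d1 d2.
rewrite /arch1 /arch2; apply: is_derive_eq.
rewrite /GRing.scale/=; have e := om2; field : e.
by rewrite sh0// ch0 c0.
Qed.

Lemma arch_ode L x : 0 < L ->
  - arch2 L x + c * arch L x - s * (x - L / 2) = c * amplitude L.
Proof. by move=> L0; rewrite /arch2 /arch; field; rewrite ?c0 ?sh0 ?ch0. Qed.

Lemma is_derive_arch_primitive L x : 0 < L -> is_derive x 1 (arch_primitive L) (arch L x).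
Proof.
move=> L0; have := dsinh L x; have := dcosh L x => d1 d2.
rewrite /arch_primitive /arch; apply: is_derive_eq.
by rewrite /GRing.scale/=; field; rewrite ?om0 ?ch0 ?c0 ?sh0.
Qed.

Lemma arch_volume L : 0 < L -> arch_primitive L L - arch_primitive L 0 = V0.
Proof.
move=> L0; rewrite /arch_primitive thN thP coshN sinhN.
have t0 := theta_gt0 c_gt0 L0.
have LE : L = 2 * th L / om by rewrite thE; field.
have kE : th L * cosh (th L) = sinh (th L) * (xcoth1 (th L) + 1).
  by rewrite /xcoth1; field; rewrite sh0.
have vE : amplitude L * (L - 2 * sinh (th L) / (om * cosh (th L))) = V0.
  rewrite /amplitude [X in _ * (X - _)]LE.
  by field : kE; rewrite ?om0 ?ch0 ?sh0 ?k0.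
rewrite -[RHS]vE; field.
by rewrite ?c0 ?om0 ?ch0 ?sh0.
Qed.

Let kE L : 0 < L -> th L * cosh (th L) = sinh (th L) * (xcoth1 (th L) + 1).
Proof. by move=> L0; rewrite /xcoth1; field; rewrite sh0. Qed.

Let amplitudeE L : 0 < L ->
  amplitude L * om * sinh (th L) / cosh (th L) = V0 * c / 2 / xcoth1 (th L).
Proof.
move=> L0; have e := om2; rewrite /amplitude; field : e.
by rewrite ?c0 ?om0 ?ch0 ?sh0 ?k0.
Qed.

Let tilt1 L : 1 - L / 2 * om * cosh (th L) / sinh (th L) = - xcoth1 (th L).
Proof.
have e1 : L / 2 * om = th L by rewrite thE mulrC.
by rewrite e1 /xcoth1; ring.
Qed.

Lemma arch1_0 L : 0 < L -> arch1 L 0 = back_slope V0 c s L.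
Proof.
move=> L0; rewrite /arch1 thN coshN sinhN tilt1 /back_slope -amplitudeE//.
by ring.
Qed.

Lemma arch1_L L : 0 < L -> arch1 L L = - front_slope V0 c s L.
Proof.
move=> L0; rewrite /arch1 thP tilt1 /front_slope -amplitudeE//.
by ring.
Qed.

(** In the half-distances to the two contact points, the profile factorizes
    thanks to the addition formulas. *)
Lemma arch_factor L x : 0 < x -> x < L ->
  arch L x = 2 * sinh (th x) * sinh (th (L - x)) / (om * sinh (th L)) *
    (back_slope V0 c s L +
     s / c * (xcoth1 (th L) + (xcoth1 (th x) - xcoth1 (th (L - x))))).
Proof.
move=> x0 xL; have L0 : 0 < L by apply: lt_trans xL.
have Lx0 : 0 < L - x by rewrite subr_gt0.
have LE : L = x + (L - x) by rewrite subrKC.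
set y := L - x in Lx0 LE *.
have th_D : th L = th x + th y by rewrite [in LHS]LE /theta; field.
have t1 : om * (x - L / 2) = th x - th y by rewrite LE /theta; field.
have x2 : x - L / 2 = (th x - th y) / om by rewrite -t1; field.
have L2 : L / 2 = th L / om by rewrite thE; field.
have kx := kE x0; have ky := kE Lx0.
have shL := sh0 L0; have kL := k0 L0.
have shE : sinh (th L) = sinh (th x) * cosh (th y) + cosh (th x) * sinh (th y).
  by rewrite th_D sinhD.
have chE : cosh (th L) = cosh (th x) * cosh (th y) + sinh (th x) * sinh (th y).
  by rewrite th_D coshD.
have ch2 : cosh (th x - th y) = cosh (th x) * cosh (th y) - sinh (th x) * sinh (th y).
  by rewrite coshD coshN sinhN mulrN.
have sh2 : sinh (th x - th y) = sinh (th x) * cosh (th y) - cosh (th x) * sinh (th y).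
  by rewrite sinhD coshN sinhN mulrN.
have evenE : amplitude L * (1 - cosh (th x - th y) / cosh (th L)) =
    V0 * om / (2 * xcoth1 (th L)) * (2 * sinh (th x) * sinh (th y) / sinh (th L)).
  have -> : 1 - cosh (th x - th y) / cosh (th L) =
      (cosh (th L) - cosh (th x - th y)) / cosh (th L) by field; rewrite ch0.
  rewrite ch2 [X in X - _]chE /amplitude; field.
  by rewrite ?ch0 ?shL ?kL.
have oddE : x - L / 2 - L / 2 * sinh (th x - th y) / sinh (th L) =
    2 * sinh (th x) * sinh (th y) / (om * sinh (th L)) *
    (xcoth1 (th x) - xcoth1 (th y)).
  have -> : x - L / 2 - L / 2 * sinh (th x - th y) / sinh (th L) =
      ((th x - th y) * sinh (th L) - th L * sinh (th x - th y)) / (om * sinh (th L)).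
    by rewrite x2 L2; field; rewrite shL om0.
  have -> : (th x - th y) * sinh (th L) - th L * sinh (th x - th y) =
      2 * (th x * cosh (th x) * sinh (th y) - th y * cosh (th y) * sinh (th x)).
    by rewrite sh2 [X in _ * X - _]shE [X in _ - X * _]th_D; ring.
  by rewrite kx ky; field; rewrite shL om0.
rewrite /arch t1 evenE oddE /back_slope.
have e := om2; field : e.
by rewrite ?c0 ?om0 ?shL ?kL.
Qed.

Lemma arch_gt0 L x : 0 <= back_slope V0 c s L -> 0 < x < L -> 0 < arch L x.
Proof.
move=> p0 /andP[x0 xL]; have L0 : 0 < L by apply: lt_trans xL.
have Lx0 : 0 < L - x by rewrite subr_gt0.
have LxL : L - x <= L by rewrite gerBl ltW.
have sc : 0 < s / c by rewrite divr_gt0.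
rewrite arch_factor//; apply: mulr_gt0.
  have sx := sinh_gt0 (theta_gt0 c_gt0 x0).
  have sy := sinh_gt0 (theta_gt0 c_gt0 Lx0).
  have sL := sinh_gt0 (theta_gt0 c_gt0 L0).
  have o0 := omega_gt0 c_gt0.
  by apply: divr_gt0; apply: mulr_gt0 => //; apply: mulr_gt0.
apply: ltr_wpDl => //; rewrite mulr_gt0//.
have : xcoth1 (th (L - x)) < xcoth1 (th L).
  by apply: xcoth1_incr; [exact: theta_gt0|apply: theta_lt => //; rewrite gtrBl].
have := xcoth1_gt0 (theta_gt0 c_gt0 x0); lra.
Qed.

Lemma arch_cont L x : 0 < L -> {for (L, x), continuous (fun z : R * R => arch z.1 z.2)}.
Proof.
move=> L0.
have c1 : {for (L, x), continuous (fun z : R * R => z.1)} by exact: cvg_fst.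
have c2 : {for (L, x), continuous (fun z : R * R => z.2)} by exact: cvg_snd.
have cs (y : R) : {for y, continuous (@sinh R)}.
  by have [/derivable1_diffP/differentiable_continuous] := is_derive_sinh y.
have cc (y : R) : {for y, continuous (@cosh R)}.
  by have [/derivable1_diffP/differentiable_continuous] := is_derive_cosh y.
have cth : {for (L, x), continuous (fun z : R * R => th z.1)}.
  by apply: cvgMl; apply: cvgMr; exact: c1.
have cmid : {for (L, x), continuous (fun z : R * R => z.2 - z.1 / 2)}.
  by apply: cvgB; [exact: c2|apply: cvgMl; exact: c1].
have carg : {for (L, x), continuous (fun z : R * R => om * (z.2 - z.1 / 2))}.
  by apply: cvgMr; exact: cmid.
have csL : {for (L, x), continuous (fun z : R * R => sinh (th z.1))}.
  by apply: (@continuous_comp _ _ _ (fun z : R * R => th z.1) (@sinh R)).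
have ccL : {for (L, x), continuous (fun z : R * R => cosh (th z.1))}.
  by apply: (@continuous_comp _ _ _ (fun z : R * R => th z.1) (@cosh R)).
have csa : {for (L, x), continuous (fun z : R * R => sinh (om * (z.2 - z.1 / 2)))}.
  by apply: (@continuous_comp _ _ _ (fun z : R * R => om * (z.2 - z.1 / 2)) (@sinh R)).
have cca : {for (L, x), continuous (fun z : R * R => cosh (om * (z.2 - z.1 / 2)))}.
  by apply: (@continuous_comp _ _ _ (fun z : R * R => om * (z.2 - z.1 / 2)) (@cosh R)).
have ck : {for (L, x), continuous (fun z : R * R => xcoth1 (th z.1))}.
  apply: (@continuous_comp _ _ _ (fun z : R * R => th z.1) (@xcoth1 R)) => //.
  exact: xcoth1_cont (theta_gt0 c_gt0 L0).
apply: cvgD.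
  apply: cvgM.
    apply: cvgM; first by apply: cvgMr; exact: ccL.
    apply: cvgV; first by
      apply: mulf_neq0; [apply: mulf_neq0; [rewrite pnatr_eq0|exact: sh0]|exact: k0].
    by apply: cvgM; [apply: cvgMr; exact: csL|exact: ck].
  apply: cvgB; first exact: cvg_cst.
  by apply: cvgM; [exact: cca|apply: cvgV; [exact: ch0|exact: ccL]].
apply: cvgMr; apply: cvgB; first exact: cmid.
apply: cvgM; last by apply: cvgV; [exact: sh0|exact: csL].
by apply: cvgM; [apply: cvgMl; exact: c1|exact: csa].
Qed.

End profile.

(** * Square-integrable functions *)

Section square_integrable.
Variable R : realType.
Local Notation mu := (@Lebesgue R).
Local Notation L2 := (Lfun (@Lebesgue R) 2%:E).
Implicit Types (f g v : R -> R).

Lemma L2_measurable f : f \in L2 -> measurable_fun [set: measurableTypeR R] f.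
Proof. by rewrite inE => /andP[]; rewrite inE. Qed.

Lemma L2_mul f g : f \in L2 -> g \in L2 ->
  mu.-integrable [set: measurableTypeR R] (EFin \o (fun x => f x * g x)).
Proof. by move=> f2 g2; apply/Lfun1_integrable; exact: Lfun2_mul_Lfun1. Qed.

Lemma L2_norm_fin f : f \in L2 -> ('N[mu]_2%:E[EFin \o f] < +oo)%E.
Proof. by rewrite inE => /andP[_]; rewrite inE. Qed.

Lemma L2D f g : f \in L2 -> g \in L2 -> (fun x => f x + g x) \in L2.
Proof.
move=> f2 g2; rewrite inE; apply/andP; split; rewrite inE/=.
  by apply: measurable_funD; exact: L2_measurable.
rewrite /finite_norm.
have l12 : (1 <= 2%:E :> \bar R)%E by rewrite lee_fin ler1n.
have H := eminkowski mu (L2_measurable f2) (L2_measurable g2) l12.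
by apply: (le_lt_trans H); rewrite lte_add_pinfty// L2_norm_fin.
Qed.

Lemma L2Z (k : R) f : f \in L2 -> (fun x => k * f x) \in L2.
Proof.
move=> f2; have -> : (fun x => k * f x) = (fun x => f x * k).
  by apply/funext => x; rewrite mulrC.
by apply: (@Lfun_scale _ _ _ mu f k 2) => //; rewrite ler1n.
Qed.

Lemma L2B f g : f \in L2 -> g \in L2 -> (fun x => f x - g x) \in L2.
Proof.
move=> f2 g2; have -> : (fun x => f x - g x) = (fun x => f x + -1 * g x).
  by apply/funext => x; rewrite mulN1r.
exact: L2D f2 (L2Z (-1) g2).
Qed.

Lemma integrable_bounded f (a b C : R) : measurable_fun [set: measurableTypeR R] f ->
  (forall x, `|f x| <= C) -> (forall x, ~ (a <= x <= b) -> f x = 0) ->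
  mu.-integrable [set: measurableTypeR R] (EFin \o f).
Proof.
move=> mf fC f0.
have mI : measurable (`[a, b]%classic : set (measurableTypeR R)) by exact: measurable_itv.
have muI : (@lebesgue_measure R `[a, b]%classic < +oo)%E.
  by rewrite lebesgue_measure_itv/=; case: ifP; rewrite ?ltry// -EFinB ltry.
have iI : mu.-integrable `[a, b] (EFin \o f).
  apply: measurable_bounded_integrable => //.
  - exact: measurable_funS mf.
  - exists C; split; first exact: num_real.
    by move=> D /ltW CD x _ /=; exact: le_trans (fC x) CD.
have -> : EFin \o f = (EFin \o f) \_ `[a, b]; last exact/(integrable_mkcond _ mI).
apply/funext => x; rewrite patchE.
case: ifPn => // /negP; rewrite inE/= in_itv/= => xab.
by rewrite /= f0.
Qed.

Lemma L2_sqr f : measurable_fun [set: measurableTypeR R] f ->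
  mu.-integrable [set: measurableTypeR R] (EFin \o (fun x => f x ^+ 2)) -> f \in L2.
Proof.
move=> mf /integrableP[_ f2]; rewrite inE; apply/andP; split; rewrite inE//=.
rewrite /finite_norm unlock poweR_lty//.
apply: le_lt_trans f2; rewrite le_eqVlt; apply/orP; left; apply/eqP.
apply: eq_integral => x _ /=.
by rewrite powR_mulrn// normrX.
Qed.

Lemma L2_bounded f (a b C : R) : measurable_fun [set: measurableTypeR R] f ->
  (forall x, `|f x| <= C) -> (forall x, ~ (a <= x <= b) -> f x = 0) ->
  f \in L2.
Proof.
move=> mf fC f0; apply: L2_sqr => //.
apply: (@integrable_bounded _ a b (C ^+ 2)).
- exact: measurable_funX.
- move=> x; rewrite normrX ler_pXn2r// nnegrE// (le_trans _ (fC x))//.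
- by move=> x /f0 ->; rewrite expr0n.
Qed.

Lemma cauchy_schwarz f g : f \in L2 -> g \in L2 ->
  (`|\int[mu]_x (f x * g x)|%:E <= 'N[mu]_2%:E[EFin \o f] * 'N[mu]_2%:E[EFin \o g])%E.
Proof.
move=> f2 g2.
have mf := L2_measurable f2; have mg := L2_measurable g2.
have H : (2^-1 + 2^-1 = 1 :> R)%R by rewrite [RHS]splitr !div1r.
have two_gt0 : 0 < 2 :> R by rewrite ltr0n.
have := @hoelder _ _ _ mu f g 2 2 mf mg two_gt0 two_gt0 H.
apply: le_trans; rewrite Lnorm1.
have ifg := L2_mul f2 g2.
have fin : (\int[mu]_x (`|f x * g x|%:E))%E \is a fin_num.
  exact: integrable_fin_num (integrable_norm ifg).
have := le_normr_Rintegral measurableT ifg.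
by rewrite -lee_fin => /le_trans; apply; rewrite /Rintegral fineK.
Qed.

(** Convergence in norm implies convergence of the pairings, which is all that
    is needed to pass to the limit in linear identities. *)
Lemma L2_weak_cvg f v (phi : nat -> R -> R) : f \in L2 -> v \in L2 ->
  (forall n, phi n \in L2) ->
  Lnorm mu 2%:E (fun x => (phi n x - v x)%:E) @[n --> \oo] --> 0%E ->
  (fun n => \int[mu]_x (f x * phi n x)) @ \oo --> \int[mu]_x (f x * v x).
Proof.
move=> f2 v2 phi2 cphi; apply/cvgrPdist_le => e e0.
have Nf : ('N[mu]_2%:E[EFin \o f])%E \is a fin_num.
  by rewrite ge0_fin_numE ?Lnorm_ge0// L2_norm_fin.
set C := fine ('N[mu]_2%:E[EFin \o f])%E.
have C0 : 0 <= C by rewrite fine_ge0// Lnorm_ge0.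
have e1 : (0 < (e / (C + 1))%:E)%E by rewrite lte_fin divr_gt0// ltr_wpDl.
have : \forall n \near \oo, (Lnorm mu 2%:E (fun x => (phi n x - v x)%:E) < (e / (C + 1))%:E)%E.
  have oI : open [set y | (y < (e / (C + 1))%:E)%E] by exact: open_ereal_lt_ereal.
  exact: (cphi _ (open_nbhs_nbhs (conj oI e1))).
apply: filterS => n nlt.
have d2 : (fun x => phi n x - v x) \in L2 by exact: L2B.
have -> : \int[mu]_x (f x * v x) - \int[mu]_x (f x * phi n x) =
    - \int[mu]_x (f x * (phi n x - v x)).
  rewrite -opprB -RintegralB//; [|exact: L2_mul|exact: L2_mul].
  by congr (- _); apply: eq_Rintegral => x _; rewrite mulrBr.
rewrite normrN -lee_fin (le_trans (cauchy_schwarz f2 d2))//.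
rewrite -(fineK Nf) -/C.
apply: (@le_trans _ _ (C%:E * (e / (C + 1))%:E)%E).
  by rewrite lee_wpmul2l ?lee_fin// ltW.
rewrite -EFinM lee_fin mulrCA ler_piMr ?(ltW e0)//.
by rewrite ler_pdivrMr ?ltr_wpDl// mul1r lerDl.
Qed.
End square_integrable.

(** * Test functions *)

Section test_functions.
Variable R : realType.
Local Notation mu := (@Lebesgue R).
Local Notation L2 := (Lfun (@Lebesgue R) 2%:E).
Implicit Types (f g v phi : R -> R) (a b x : R).

Lemma derivable1_continuous f : (forall x, derivable f x 1) -> continuous f.
Proof. by move=> df x; apply/differentiable_continuous/derivable1_diffP. Qed.

Lemma compact_support_bounded f a b : continuous f ->
  (forall x, ~ (a <= x <= b) -> f x = 0) -> exists C, forall x, `|f x| <= C.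
Proof.
move=> cf f0; have [ab|ba] := leP a b; last first.
  by exists 0 => x; rewrite f0 ?normr0// => /andP[ax xb]; have := le_trans ax xb; rewrite leNgt ba.
have cn : {within `[a, b], continuous (fun x => `|f x|)}.
  by apply: continuous_subspaceT => x; apply: cvg_norm; exact: cf.
have [y yI yP] := EVT_max ab cn.
exists `|f y| => x; have [xab|xab] := pselect (a <= x <= b).
  by apply: yP; rewrite in_itv.
by rewrite f0// normr0.
Qed.

Lemma continuous_L2 f a b : continuous f ->
  (forall x, ~ (a <= x <= b) -> f x = 0) -> f \in L2.
Proof.
move=> cf f0; have [C fC] := compact_support_bounded cf f0.
exact: (L2_bounded (continuous_measurable_fun cf) fC f0).
Qed.

Lemma test_function_support a b phi : test_function a b phi ->
  forall x, ~ (a < x < b) -> phi x = 0 /\ derive1 phi x = 0.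
Proof.
move=> [dphi _ [A [cA Aab phi0]]] x xab.
have Ax : ~ A x by move=> /Aab; rewrite /= in_itv.
split; first exact: phi0.
have oA : open (~` A).
  by rewrite openC; apply: compact_closed => //; exact: Rhausdorff.
have nA : \forall y \near x, phi y = 0.
  by apply: filterS (open_nbhs_nbhs (conj oA Ax)) => y; exact: phi0.
have [_ <-] : is_derive x 1 phi 0.
  apply/is_derive1_nearP => e e0.
  have /nbhs_ballP[d /= d0 dP] := nA.
  apply: filterS (near0_norm_lt d0) => h hd.
  rewrite mul0r subr0 (phi0 x)// dP ?subrr ?normr0 ?mulr_ge0 ?(ltW e0)//.
  by rewrite /ball/= opprD addrA subrr sub0r normrN.
by rewrite derive1E.
Qed.

Lemma test_function_closed_support a b phi : test_function a b phi ->
  forall x, ~ (a <= x <= b) -> phi x = 0 /\ derive1 phi x = 0.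
Proof.
move=> tphi x xab; apply: (test_function_support tphi) => /andP[ax xb].
by apply: xab; rewrite !ltW.
Qed.

Lemma test_function_L2 a b phi : test_function a b phi ->
  phi \in L2 /\ derive1 phi \in L2.
Proof.
move=> tphi; have supp := test_function_closed_support tphi.
have [dphi cdphi _] := tphi.
have [s0 s1] : (forall x, ~ (a <= x <= b) -> phi x = 0) /\
    (forall x, ~ (a <= x <= b) -> derive1 phi x = 0).
  by split=> x xab; have [] := supp x xab.
by split; [exact: continuous_L2 (derivable1_continuous dphi) s0|exact: continuous_L2 s1].
Qed.

Lemma test_functionD a b phi psi (k : R) : test_function a b phi ->
  test_function a b psi ->
  test_function a b (fun x => phi x + k * psi x) /\
  derive1 (fun x => phi x + k * psi x) = fun x => derive1 phi x + k * derive1 psi x.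
Proof.
move=> [d1 c1 [A [cA Aab A0]]] [d2 c2 [B [cB Bab B0]]].
have dd x : is_derive x 1 (fun x => phi x + k * psi x) (derive1 phi x + k * derive1 psi x).
  have i1 := derivable_is_derive1 (d1 x); have i2 := derivable_is_derive1 (d2 x).
  by apply: is_derive_eq; rewrite /GRing.scale/=; ring.
have dE : derive1 (fun x => phi x + k * psi x) = fun x => derive1 phi x + k * derive1 psi x.
  by apply/funext => x; rewrite derive1E; have [_ ->] := dd x.
split; last exact: dE.
split.
- by move=> x; have [] := dd x.
- rewrite dE => x; apply: cvgD; first exact: c1.
  by apply: cvgMr; exact: c2.
- exists (A `|` B); split; first exact: compactU.
    by move=> x [/Aab|/Bab].
  by move=> x AB; rewrite A0 ?B0 ?mulr0 ?addr0// => ?; apply: AB; [right|left].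
Qed.

(** Dominated convergence on a bounded interval. *)
Lemma Lnorm_cvg0 (f : nat -> R -> R) a b C :
  (forall n, measurable_fun [set: measurableTypeR R] (f n)) ->
  (forall n x, `|f n x| <= C) ->
  (forall n x, ~ (a <= x <= b) -> f n x = 0) ->
  (forall x, f n x @[n --> \oo] --> 0) ->
  Lnorm mu 2%:E (fun x => (f n x)%:E) @[n --> \oo] --> 0%E.
Proof.
move=> mf fC f0 fcvg.
pose g x : R := if (a <= x) && (x <= b) then C ^+ 2 else 0.
have C0 : 0 <= C by exact: le_trans (fC 0%N 0).
have mg : measurable_fun [set: measurableTypeR R] g.
  apply: measurable_fun_ifT => //.
  apply: measurable_and.
    by apply: measurable_fun_ler; [exact: measurable_cst|exact: measurable_id].
  by apply: measurable_fun_ler; [exact: measurable_id|exact: measurable_cst].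
have ig : mu.-integrable [set: measurableTypeR R] (EFin \o g).
  apply: (@integrable_bounded _ _ a b (C ^+ 2)) => //.
    by move=> x; rewrite /g; case: ifP => _; rewrite ?normr0 ?exprn_ge0// ger0_norm ?exprn_ge0.
  by move=> x /negP/negbTE xab; rewrite /g xab.
have fg n x : (f n x) ^+ 2 <= g x.
  rewrite /g; case: ifPn => [_|/negP xab]; last by rewrite f0// expr0n.
  by rewrite -real_normK ?num_real// ler_pXn2r ?nnegrE.
have H : (fun n => \int[mu]_x (f n x ^+ 2)%:E)%E @ \oo --> 0%E.
  have [] := @dominated_convergence _ _ R mu setT measurableT
    (fun n x => (f n x ^+ 2)%:E) (cst 0%E) (EFin \o g).
  - by move=> n; apply/measurable_EFinP; exact: measurable_funX.
  - exact: measurable_cst.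
  - apply: aeW => x _; apply: cvg_EFin; first exact: nearW.
    rewrite /comp/= [X in _ --> X](_ : _ = 0 * 0 :> R); last by rewrite mulr0.
    exact: cvgM (fcvg x) (fcvg x).
  - exact: ig.
  - by apply: aeW => x n _ /=; rewrite lee_fin ger0_norm ?exprn_even_ge0.
  by move=> _ _; rewrite integral_cst// mul0e.
have NE n : Lnorm mu 2%:E (fun x => (f n x)%:E) = ((\int[mu]_x (f n x ^+ 2)%:E) `^ 2^-1)%E.
  rewrite unlock; congr (_ `^ _)%E; apply: eq_integral => x _ /=.
  by rewrite powR_mulrn// real_normK ?num_real.
have small e : 0 < e -> \forall n \near \oo, (Lnorm mu 2%:E (fun x => (f n x)%:E) <= e%:E)%E.
  move=> e0; have e2 : (0 < (e ^+ 2)%:E)%E by rewrite lte_fin exprn_gt0.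
  have oI : open [set y | (y < (e ^+ 2)%:E)%E] by exact: open_ereal_lt_ereal.
  have Hn : \forall n \near \oo, (\int[mu]_x (f n x ^+ 2)%:E < (e ^+ 2)%:E)%E.
    exact: (H _ (open_nbhs_nbhs (conj oI e2))).
  apply: filterS Hn => n nlt; rewrite NE.
  have i0 : (0 <= \int[mu]_x (f n x ^+ 2)%:E)%E.
    by apply: integral_ge0 => x _; rewrite lee_fin exprn_even_ge0.
  have -> : e%:E = ((e ^+ 2)%:E `^ 2^-1)%E.
    by rewrite poweR_EFin powR12_sqrt ?exprn_ge0 ?(ltW e0)// sqrtr_sqr gtr0_norm.
  by apply: gt0_ler_poweR; rewrite ?in_itv/= ?leey ?andbT ?(ltW e2)// ltW.
apply/fine_cvgP; split.
  apply: filterS (small 1 ltr01) => n n1.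
  by rewrite ge0_fin_numE ?Lnorm_ge0// (le_lt_trans n1)// ltry.
apply/cvgrPdist_le => e e0; apply: filterS (small e e0) => n ne.
rewrite sub0r normrN ger0_norm ?fine_ge0 ?Lnorm_ge0//= -lee_fin fineK//.
by rewrite ge0_fin_numE ?Lnorm_ge0// (le_lt_trans ne)// ltry.
Qed.
End test_functions.

(** * The Euler--Lagrange equation of the profile *)

Section drop_profile.
Variable R : realType.
Local Notation mu := (@Lebesgue R).
Local Notation L2 := (Lfun (@Lebesgue R) 2%:E).
Implicit Types (f g v phi : R -> R) (a b x : R).
Variables (V0 c s : R).
Hypothesis V0_gt0 : 0 < V0.
Hypothesis c_gt0 : 0 < c.
Hypothesis s_gt0 : 0 < s.
Local Notation arch := (arch V0 c s).
Local Notation arch1 := (arch1 V0 c s).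
Local Notation arch2 := (arch2 V0 c s).

(** Truncating the abscissa extends the arch by zero, since it vanishes at both
    ends. *)
Definition profile a b x := arch (b - a) (Num.max 0 (Num.min (x - a) (b - a))).
Definition profile1 a b x := if (a < x) && (x < b) then arch1 (b - a) (x - a) else 0.

Lemma profileE a b x : a <= x <= b -> profile a b x = arch (b - a) (x - a).
Proof.
move=> /andP[ax xb]; rewrite /profile min_l ?max_r//; lra.
Qed.

Lemma profile_out a b x : a < b -> ~ (a < x < b) -> profile a b x = 0.
Proof.
move=> ab xab; have L0 : 0 < b - a by rewrite subr_gt0.
have [xa|ax] := leP x a.
  rewrite /profile min_l ?max_l ?arch0//; lra.
have [bx|xb] := leP b x; last by case: xab; rewrite ax.
rewrite /profile min_r ?max_r ?archL//; lra.
Qed.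

Lemma profile_gt0 a b x : 0 <= back_slope V0 c s (b - a) -> a < x < b -> 0 < profile a b x.
Proof.
move=> p0 /andP[ax xb]; rewrite profileE ?(ltW ax) ?(ltW xb)//.
by apply: arch_gt0 => //; apply/andP; split; lra.
Qed.

Lemma profile_ge0 a b x : a < b -> 0 <= back_slope V0 c s (b - a) -> 0 <= profile a b x.
Proof.
move=> ab p0; have [xab|xab] := pselect (a < x < b); last by rewrite profile_out.
exact/ltW/profile_gt0.
Qed.

Lemma arch_continuous L : continuous (arch L).
Proof.
apply: derivable1_continuous => x.
by have [] := is_derive_arch V0 c s L x.
Qed.

Lemma arch1_continuous L : 0 < L -> continuous (arch1 L).
Proof.
move=> L0; apply: derivable1_continuous => x.
by have [] := is_derive_arch1 V0 s c_gt0 x L0.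
Qed.

Lemma arch2_continuous L : continuous (arch2 L).
Proof.
apply: derivable1_continuous => x.
have d1 := @is_derive_sinh R; have d2 := @is_derive_cosh R.
have da (f f' : R -> R) : (forall y : R, is_derive y 1 f (f' y)) ->
    derivable (fun y => f (omega c * (y - L / 2))) x 1.
  move=> df; have lin : is_derive x 1 (fun y => omega c * (y - L / 2)) (omega c).
    by apply: is_derive_eq; rewrite /GRing.scale/=; ring.
  by have [] := @is_derive1_comp R f (fun y => omega c * (y - L / 2)) x _ _ (df _) lin.
rewrite /arch2; apply: derivableB.
  by apply: derivableM => //; apply: derivableM => //; exact: da d2.
by apply: derivableM => //; apply: derivableM => //; exact: da d1.
Qed.

Lemma profile_continuous a b : continuous (profile a b).
Proof.
move=> x; apply: (@continuous_comp _ _ _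
  (fun x => Num.max 0 (Num.min (x - a) (b - a))) (arch (b - a))); last exact: arch_continuous.
apply: (@continuous_max R _ (cst 0) (fun x => Num.min (x - a) (b - a))).
  exact: cvg_cst.
apply: (@continuous_min R _ (fun x => x - a) (cst (b - a))); last exact: cvg_cst.
by apply: cvgB; [exact: cvg_id|exact: cvg_cst].
Qed.

Lemma profile_L2 a b : a < b -> profile a b \in L2.
Proof.
move=> ab; apply: (@continuous_L2 _ _ a b) (@profile_continuous a b) _ => x xab.
by rewrite profile_out// => /andP[ax xb]; apply: xab; rewrite !ltW.
Qed.

Lemma measurable_in_itv a b :
  measurable_fun [set: measurableTypeR R] (fun x => (a < x) && (x < b)).
Proof.
apply: measurable_and.
  by apply: measurable_fun_ltr; [exact: measurable_cst|exact: measurable_id].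
by apply: measurable_fun_ltr; [exact: measurable_id|exact: measurable_cst].
Qed.

Lemma shift_continuous f a : continuous f -> continuous (fun x => f (x - a)).
Proof.
move=> cf x; apply: continuous_comp; last exact: cf.
by apply: cvgB; [exact: cvg_id|exact: cvg_cst].
Qed.

Lemma measurable_profile1 a b : a < b ->
  measurable_fun [set: measurableTypeR R] (profile1 a b).
Proof.
move=> ab; apply: measurable_fun_ifT; last exact: measurable_cst.
- exact: measurable_in_itv.
- apply: continuous_measurable_fun; apply: shift_continuous.
  by apply: arch1_continuous; rewrite subr_gt0.
Qed.

Lemma continuous_bounded_itv f a b : continuous f ->
  exists C, forall x, a <= x <= b -> `|f x| <= C.
Proof.
move=> cf; have [ab|ba] := leP a b; last first.
  by exists 0 => x /andP[ax xb]; have := le_trans ax xb; rewrite leNgt ba.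
have cn : {within `[a, b], continuous (fun x => `|f x|)}.
  by apply: continuous_subspaceT => x; apply: cvg_norm; exact: cf.
have [y yI yP] := EVT_max ab cn.
by exists `|f y| => x xab; apply: yP; rewrite in_itv.
Qed.

Lemma profile1_L2 a b : a < b -> profile1 a b \in L2.
Proof.
move=> ab; have L0 : 0 < b - a by rewrite subr_gt0.
have [C CP] := @continuous_bounded_itv (fun x => arch1 (b - a) (x - a)) a b
  (@shift_continuous (arch1 (b - a)) a (arch1_continuous L0)).
have C0 : 0 <= C by rewrite (le_trans _ (CP a _))// lexx ltW.
apply: (@L2_bounded _ _ a b C).
- exact: measurable_profile1.
- move=> x; rewrite /profile1; case: ifPn => [/andP[ax xb]|_]; last by rewrite normr0.
  by apply: CP; rewrite !ltW.
- move=> x xab; rewrite /profile1; case: ifPn => // /andP[ax xb].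
  by case: xab; rewrite !ltW.
Qed.

Definition cutoff a b x : R := if (a <= x) && (x <= b) then 1 else 0.

Lemma cutoff_mul_L2 a b f : continuous f -> (fun x => f x * cutoff a b x) \in L2.
Proof.
move=> cf; have [C CP] := @continuous_bounded_itv f a b cf.
apply: (@L2_bounded _ _ a b (Num.max C 0)).
- apply: measurable_funM; first exact: continuous_measurable_fun.
  apply: measurable_fun_ifT => //; apply: measurable_and.
    by apply: measurable_fun_ler; [exact: measurable_cst|exact: measurable_id].
  by apply: measurable_fun_ler; [exact: measurable_id|exact: measurable_cst].
- move=> x; rewrite /cutoff; case: ifPn => [xab|_].
    by rewrite mulr1 le_max CP.
  by rewrite mulr0 normr0 le_max lexx orbT.
- by move=> x /negP/negbTE xab; rewrite /cutoff xab mulr0.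
Qed.

Lemma cutoff_L2 a b : cutoff a b \in L2.
Proof.
have -> : cutoff a b = (fun x => cst 1 x * cutoff a b x).
  by apply/funext => x; rewrite mul1r.
by apply: cutoff_mul_L2; exact: cst_continuous.
Qed.

(** The Lagrange multiplier of the volume constraint. *)
Definition multiplier a b := c * amplitude V0 c (b - a) - s * (a + (b - a) / 2).

(** Integration by parts from [arch_ode], as the test function vanishes at both
    ends. *)
Lemma profile_weak_test a b phi : a < b -> test_function a b phi ->
  \int[mu]_x (profile1 a b x * derive1 phi x) +
  \int[mu]_x ((c * profile a b x - s * (x * cutoff a b x)) * phi x) =
  multiplier a b * \int[mu]_x (cutoff a b x * phi x).
Proof.
move=> ab tphi; have L0 : 0 < b - a by rewrite subr_gt0.
have [phi2 dphi2] := test_function_L2 tphi.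
have supp := test_function_support tphi.
have [dphi cdphi _] := tphi.
pose G x := arch1 (b - a) (x - a) * phi x.
pose g x := arch2 (b - a) (x - a) * phi x + arch1 (b - a) (x - a) * derive1 phi x.
have dG x : is_derive x 1 G (g x).
  have i1 := derivable_is_derive1 (dphi x).
  have i2 : is_derive x 1 (fun x => arch1 (b - a) (x - a)) (arch2 (b - a) (x - a)).
    by apply: is_derive1_shift; exact: is_derive_arch1.
  by rewrite /G /g; apply: is_derive_eq; rewrite /GRing.scale/=; ring.
have cg : continuous g.
  move=> x; apply: cvgD; apply: cvgM.
  - exact: (@shift_continuous (arch2 (b - a)) a (@arch2_continuous (b - a))).
  - exact: (derivable1_continuous dphi).
  - exact: (@shift_continuous (arch1 (b - a)) a (arch1_continuous L0)).
  - exact: cdphi.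
have Gab : G a = 0 /\ G b = 0.
  by rewrite /G; split; rewrite (supp _ _).1 ?mulr0// => /andP[]; rewrite ltxx.
have cG : continuous G by apply: derivable1_continuous => x; have [] := dG x.
have int0 : \int[mu]_(x in `[a, b]) g x = 0.
  rewrite /Rintegral (@continuous_FTC2 R g G a b ab)//.
  - by rewrite Gab.1 Gab.2 -EFinB subrr.
  - exact: continuous_subspaceT.
  - split; first by move=> x _; have [] := dG x.
      by apply: cvg_at_right_filter; exact: cG.
    by apply: cvg_at_left_filter; exact: cG.
  - by move=> x _; rewrite derive1E; have [_ ->] := dG x.
have gs2 : (fun x => x * cutoff a b x) \in L2 by apply: cutoff_mul_L2 => x; exact: cvg_id.
have f2 : (fun x => c * profile a b x - s * (x * cutoff a b x)) \in L2.
  by apply: L2B; [exact: L2Z (profile_L2 ab)|exact: L2Z gs2].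
have cut2 := L2Z (multiplier a b) (cutoff_L2 a b).
have -> : multiplier a b * \int[mu]_x (cutoff a b x * phi x) =
    \int[mu]_x ((multiplier a b * cutoff a b x) * phi x).
  rewrite -RintegralZl//; last exact: L2_mul (cutoff_L2 a b) phi2.
  by apply: eq_Rintegral => x _; rewrite mulrA.
apply/eqP; rewrite -subr_eq0 -addrA -RintegralB//; last 2 first.
- exact: L2_mul f2 phi2.
- exact: L2_mul cut2 phi2.
have -> : \int[mu]_x ((c * profile a b x - s * (x * cutoff a b x)) * phi x -
      multiplier a b * cutoff a b x * phi x) =
    \int[mu]_x (((c * profile a b x - s * (x * cutoff a b x)) -
      multiplier a b * cutoff a b x) * phi x).
  by apply: eq_Rintegral => x _; rewrite [RHS]mulrBl.
rewrite -RintegralD//; [|exact: L2_mul (profile1_L2 ab) dphi2|exact: L2_mul (L2B f2 cut2) phi2].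
apply/eqP; rewrite -[RHS]int0 [RHS]Rintegral_mkcond; apply: eq_Rintegral => x _.
have [xab|xab] := pselect (a < x < b); last first.
  have [p0 p1] := supp _ xab.
  by rewrite p0 p1 !mulr0 addr0 patchE; case: ifP => // _; rewrite /g p0 p1 !mulr0 addr0.
have /andP[ax xb] := xab.
have xab' : a <= x <= b by rewrite !ltW.
rewrite patchE mem_set/=; last by rewrite in_itv.
rewrite /profile1 xab profileE// /cutoff xab' /g /multiplier.
have := @arch_ode R V0 c s c_gt0 (b - a) (x - a) L0.
set A2 := arch2 _ _; set A := arch _ _; set m := amplitude _ _ _.
by move=> ode; have -> : A2 = c * A - s * (x - a - (b - a) / 2) - c * m; [lra|ring].
Qed.
End drop_profile.

(** * Membership of the profile in [H10] *)

Section H10_profile.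
Variable R : realType.
Local Notation mu := (@Lebesgue R).
Local Notation L2 := (Lfun (@Lebesgue R) 2%:E).
Implicit Types (f g h v phi : R -> R) (a b x : R).

Definition ip f g : R := \int[mu]_x (f x * g x).

Lemma ipC f g : ip f g = ip g f.
Proof. by apply: eq_Rintegral => x _; rewrite mulrC. Qed.

Lemma ipDr f g h : f \in L2 -> g \in L2 -> h \in L2 ->
  ip f (fun x => g x + h x) = ip f g + ip f h.
Proof.
move=> f2 g2 h2; rewrite /ip -RintegralD//; [|exact: L2_mul|exact: L2_mul].
by apply: eq_Rintegral => x _; rewrite mulrDr.
Qed.

Lemma ipZr f g (k : R) : f \in L2 -> g \in L2 -> ip f (fun x => k * g x) = k * ip f g.
Proof.
move=> f2 g2; rewrite /ip -RintegralZl//; last exact: L2_mul.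
by apply: eq_Rintegral => x _; rewrite mulrCA.
Qed.

Lemma ipBr f g h : f \in L2 -> g \in L2 -> h \in L2 ->
  ip f (fun x => g x - h x) = ip f g - ip f h.
Proof.
move=> f2 g2 h2; rewrite /ip -RintegralB//; [|exact: L2_mul|exact: L2_mul].
by apply: eq_Rintegral => x _; rewrite mulrBr.
Qed.

Lemma ipBl f g h : f \in L2 -> g \in L2 -> h \in L2 ->
  ip (fun x => g x - h x) f = ip g f - ip h f.
Proof. by move=> f2 g2 h2; rewrite ipC ipBr// ![ip f _]ipC. Qed.

Lemma ip_ge0 f : 0 <= ip f f.
Proof. by apply: Rintegral_ge0 => x _; rewrite -expr2 sqr_ge0. Qed.

Lemma Rintegral_cutoff a b : a <= b -> \int[mu]_x cutoff a b x = b - a.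
Proof.
move=> ab; have -> : \int[mu]_x cutoff a b x = \int[mu]_(x in `[a, b]) (1 : R).
  rewrite [RHS]Rintegral_mkcond; apply: eq_Rintegral => x _.
  rewrite patchE /cutoff; case: ifPn => xab; case: ifPn => //.
    by move=> /negP[]; rewrite inE/= in_itv.
  by rewrite inE/= in_itv/= => /andP[ax xb]; move/negP: xab; case; rewrite ax.
have mI : measurable (`[a, b]%classic : set (measurableTypeR R)) by exact: measurable_itv.
rewrite (Rintegral_cst mu mI) mul1r (_ : mu `[a, b]%classic = (b - a)%:E)//.
apply: (etrans (lebesgue_measure_itv `[a, b])); rewrite /= lte_fin.
by move: ab; rewrite le_eqVlt => /predU1P[->|->]; rewrite ?ltxx ?subrr.
Qed.

(** A nonzero value would persist on an interval. *)
Lemma ip_eq0 f x : f \in L2 -> ip f f = 0 -> {for x, continuous f} -> f x = 0.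
Proof.
move=> f2 f0 cf; apply/eqP; apply: contrapT => /negP fx.
have fx0 : 0 < `|f x| by rewrite normr_gt0.
pose d := `|f x| / 2.
have d0 : 0 < d by rewrite divr_gt0.
have /nbhs_ballP[r /= r0 rP] : \forall y \near x, `|f x - f y| <= d.
  by move/cvgrPdist_le : cf; apply.
pose g y := d ^+ 2 * cutoff (x - r / 2) (x + r / 2) y.
have gf y : g y <= f y * f y.
  rewrite /g /cutoff; case: ifPn => [/andP[y1 y2]|_].
    rewrite mulr1 -expr2 -[leRHS]real_normK ?num_real// ler_pXn2r ?nnegrE ?(ltW d0)//.
    have /rP : ball x r y by rewrite /ball/= ltr_norml; apply/andP; split; lra.
    have := ler_normD (f x - f y) (f y); rewrite subrK.
    have -> : `|f x| = d + d by rewrite /d; field.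
    lra.
  by rewrite mulr0 -expr2 sqr_ge0.
have i1 : mu.-integrable [set: measurableTypeR R] (EFin \o g).
  have := L2_mul (L2Z (d ^+ 2) (cutoff_L2 (x - r / 2) (x + r / 2)))
    (cutoff_L2 (x - r / 2) (x + r / 2)).
  suff -> : (fun y => d ^+ 2 * cutoff (x - r / 2) (x + r / 2) y *
      cutoff (x - r / 2) (x + r / 2) y) = g by [].
  by apply/funext => y; rewrite /g /cutoff; case: ifP; rewrite ?mulr1 ?mulr0.
have : \int[mu]_y g y <= ip f f.
  by apply: le_Rintegral => //; exact: L2_mul.
rewrite f0 leNgt => /negP; apply.
have -> : \int[mu]_y g y = d ^+ 2 * \int[mu]_y cutoff (x - r / 2) (x + r / 2) y.
  rewrite -RintegralZl//.
  have := L2_mul (cutoff_L2 (x - r / 2) (x + r / 2)) (cutoff_L2 (x - r / 2) (x + r / 2)).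
  suff -> : (fun y => cutoff (x - r / 2) (x + r / 2) y *
      cutoff (x - r / 2) (x + r / 2) y) = cutoff (x - r / 2) (x + r / 2) by [].
  by apply/funext => y; rewrite /cutoff; case: ifP; rewrite ?mulr1 ?mulr0.
by rewrite Rintegral_cutoff ?mulr_gt0 ?exprn_gt0//; lra.
Qed.

(** A rational step of class C^1 that vanishes on [t <= 1] and tends to [1] at
    infinity, with a derivative so small that [step1 t * t] tends to [0]: composed
    with [n * (x - a) * (b - x)], it cuts the profile off near both ends. *)
Let pos (t : R) : R := Num.max (t - 1) 0.
Let step (t : R) : R := pos t ^+ 2 / (1 + pos t ^+ 2).
Let step1 (t : R) : R := 2 * pos t / (1 + pos t ^+ 2) ^+ 2.

Let pos_ge0 (t : R) : 0 <= pos t. Proof. by rewrite le_max lexx orbT. Qed.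

Let den_gt0 (t : R) : 0 < 1 + pos t ^+ 2.
Proof. by rewrite ltr_pwDl// exprn_ge0. Qed.

Let is_derive_pos2 (t : R) : is_derive t 1 (fun t => pos t ^+ 2) (2 * pos t).
Proof.
apply/is_derive1_nearP => e e0; apply: filterS (near0_norm_lt e0) => h he.
apply: (@le_trans _ _ (h ^+ 2)); last first.
  by rewrite -real_normK ?num_real// expr2 ler_wpM2r// ltW.
rewrite /pos ler_norml; case: (leP (t - 1) 0) => t1; case: (leP (t + h - 1) 0) => t2;
  rewrite ?expr0n/= ?mulr0 ?mul0r ?subr0 ?sub0r; apply/andP; split; nra.
Qed.

Let is_derive_step (t : R) : is_derive t 1 step (step1 t).
Proof.
have d1 := is_derive_pos2 t; have n0 : 1 + pos t ^+ 2 != 0 by rewrite gt_eqF.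
have d2 : is_derive t 1 (fun t => 1 + pos t ^+ 2) (2 * pos t).
  rewrite -[X in is_derive _ _ _ X]add0r.
  exact: (is_deriveD (is_derive_cst (1 : R) t 1) d1).
have d3 := @is_deriveV R (fun t => 1 + pos t ^+ 2) t _ 1 n0 d2.
have -> : step = (fun t => 1 - (1 + pos t ^+ 2)^-1).
  by apply/funext => y; rewrite /step; field; rewrite gt_eqF.
have d4 := is_deriveB (is_derive_cst (1 : R) t 1) d3.
apply: is_derive_eq d4 _; rewrite /step1 /GRing.scale/=.
by field.
Qed.

Let pos_cont : continuous pos.
Proof.
move=> t; have c1 : {for t, continuous (fun t : R => t - 1)}.
  by apply: cvgB; [exact: cvg_id|exact: cvg_cst].
have c2 : {for t, continuous (cst (0 : R) : R -> R)} by exact: cvg_cst.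
exact: (continuous_max c1 c2).
Qed.

Let step1_cont : continuous step1.
Proof.
move=> t; have c2 : {for t, continuous (fun t => 1 + pos t ^+ 2)}.
  apply: cvgD; first exact: cvg_cst.
  have -> : (fun t => pos t ^+ 2) = (fun t => pos t * pos t) by apply/funext => y; rewrite expr2.
  by rewrite expr2; apply: cvgM; exact: pos_cont.
apply: cvgM; first by apply: cvgMr; exact: pos_cont.
apply: cvgV; first by rewrite gt_eqF// exprn_gt0.
have -> : (fun t => (1 + pos t ^+ 2) ^+ 2) = (fun t => (1 + pos t ^+ 2) * (1 + pos t ^+ 2)).
  by apply/funext => y; rewrite [in LHS]expr2.
by rewrite [X in _ --> X]expr2; apply: cvgM; exact: c2.
Qed.

Let step_le1 (t : R) : t <= 1 -> step t = 0 /\ step1 t = 0.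
Proof.
move=> t1; have p0 : pos t = 0 by rewrite /pos max_r// subr_le0.
by rewrite /step /step1 p0 expr0n/= mulr0 !mul0r.
Qed.

Let step_bnd (t : R) : `|step t - 1| <= (1 + pos t ^+ 2)^-1.
Proof.
have -> : step t - 1 = - (1 + pos t ^+ 2)^-1 by rewrite /step; field; rewrite gt_eqF.
by rewrite normrN ger0_norm// invr_ge0 ltW.
Qed.

Let step1_bnd (t : R) : `|step1 t * t| <= 4 / (1 + pos t ^+ 2).
Proof.
have [t1|t1] := leP t 1.
  by rewrite (step_le1 t1).2 mul0r normr0 divr_ge0// ltW.
have pE : pos t = t - 1 by rewrite /pos max_l// subr_ge0 ltW.
have p0 := pos_ge0 t; have dn := den_gt0 t.
rewrite ger0_norm; last first.
  rewrite mulr_ge0//; last by lra.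
  by rewrite divr_ge0 ?mulr_ge0 ?exprn_ge0// ltW.
have -> : step1 t * t = (2 * pos t * t / (1 + pos t ^+ 2)) / (1 + pos t ^+ 2).
  by rewrite /step1; field; rewrite gt_eqF.
rewrite ler_pM2r ?invr_gt0// ler_pdivrMr//.
have tE : t = pos t + 1 by rewrite pE; ring.
move: tE; set p := pos t => tE.
have p1 : 0 <= (p - 1) ^+ 2 by rewrite sqr_ge0.
have p2 : 0 <= p ^+ 2 by rewrite sqr_ge0.
by rewrite [X in 2 * p * X]tE; lra.
Qed.

Let decay_cvg (f : nat -> R) (d C : R) : 0 < d -> 0 <= C ->
  (forall n, `|f n| <= C / (1 + pos (n%:R * d) ^+ 2)) -> f n @[n --> \oo] --> 0.
Proof.
move=> d0 C0 fP; apply/cvgrPdist_le => e e0.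
have [N NP] := nat_ge ((C / e + 2) / d).
near=> n.
have nN : (N%:R : R) <= n%:R.
  by rewrite ler_nat; near: n; exact: nbhs_infty_ge.
have nd : C / e + 2 <= n%:R * d.
  by move: NP; rewrite ler_pdivrMr// => /le_trans; apply; rewrite ler_wpM2r// ltW.
have Ce : 0 <= C / e by rewrite divr_ge0// ltW.
have pn : C / e + 1 <= pos (n%:R * d) by rewrite le_max; apply/orP; left; lra.
have dn := den_gt0 (n%:R * d).
rewrite sub0r normrN (le_trans (fP n))//.
rewrite ler_pdivrMr// mulrC -ler_pdivrMr//.
have p1 : 1 <= pos (n%:R * d) by lra.
have : pos (n%:R * d) * 1 <= pos (n%:R * d) * pos (n%:R * d).
  by rewrite ler_wpM2l.
by rewrite expr2; lra.
Unshelve. all: by end_near. Qed.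

Variables (V0 c s : R).
Hypothesis V0_gt0 : 0 < V0.
Hypothesis c_gt0 : 0 < c.
Hypothesis s_gt0 : 0 < s.
Local Notation arch := (arch V0 c s).
Local Notation arch1 := (arch1 V0 c s).
Local Notation profile := (profile V0 c s).
Local Notation profile1 := (profile1 V0 c s).

Lemma arch_linear_bound L : 0 < L -> exists2 C, 0 <= C &
  forall x, 0 <= x <= L -> [/\ `|arch L x| <= C * x, `|arch L x| <= C * (L - x) &
    `|arch1 L x| <= C].
Proof.
move=> L0.
have [C CP] := @continuous_bounded_itv _ (arch1 L) 0 L (@arch1_continuous R V0 c s c_gt0 L L0).
have C0 : 0 <= C by rewrite (le_trans _ (CP 0 _))// lexx ltW.
have lip x y : 0 <= x -> x <= y -> y <= L -> `|arch L y - arch L x| <= C * (y - x).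
  move=> x0 xy yL; move: xy; rewrite le_eqVlt => /predU1P[->|xy].
    by rewrite !subrr normr0 mulr0.
  have [z zI ->] := is_derive_MVT xy (fun t _ => is_derive_arch V0 c s L t).
  rewrite normrM (gtr0_norm (_ : 0 < y - x)) ?subr_gt0// ler_wpM2r ?subr_ge0 ?(ltW xy)//.
  by apply: CP; apply/andP; split; lra.
exists C => // x /andP[x0 xL]; split.
- by have := lip 0 x (lexx _) x0 xL; rewrite arch0// !subr0.
- by have := lip x L x0 xL (lexx _); rewrite archL// sub0r normrN.
- by apply: CP; rewrite x0.
Qed.

(** The profile vanishes linearly at both ends, which compensates the derivative
    of the cut-off step. *)
Lemma profile_H10 a b : a < b -> H10 a b (profile a b) (profile1 a b).
Proof.
move=> ab; have L0 : 0 < b - a by rewrite subr_gt0.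
split; [exact: profile_continuous|exact: profile_L2|exact: profile1_L2|].
pose d x := (x - a) * (b - x).
pose w x := arch (b - a) (x - a).
pose w1 x := arch1 (b - a) (x - a).
pose phi n x := step (n%:R * d x) * w x.
pose phi1 n x := step (n%:R * d x) * w1 x + step1 (n%:R * d x) * (n%:R * (a + b - 2 * x)) * w x.
have dphi n x : is_derive x 1 (phi n) (phi1 n x).
  have i1 : is_derive x 1 w (w1 x) by apply: is_derive1_shift; exact: is_derive_arch.
  have i2 : is_derive x 1 (fun x => n%:R * d x) (n%:R * (a + b - 2 * x)).
    by rewrite /d; apply: is_derive_eq; rewrite /GRing.scale/=; ring.
  have i3 : is_derive x 1 (fun x => step (n%:R * d x)) (step1 (n%:R * d x) * (n%:R * (a + b - 2 * x))).
    exact: (@is_derive1_comp R step (fun x => n%:R * d x) x _ _ (is_derive_step _) i2).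
  by rewrite /phi /phi1; apply: is_derive_eq; rewrite /GRing.scale/=; ring.
have dE n : derive1 (phi n) = phi1 n.
  by apply/funext => x; rewrite derive1E; have [_ ->] := dphi n x.
have cw : continuous w by apply: shift_continuous; exact: arch_continuous.
have cw1 : continuous w1 by apply: shift_continuous; exact: arch1_continuous.
have cd : continuous d.
  move=> x; apply: cvgM; apply: cvgB; by [exact: cvg_id|exact: cvg_cst].
have cnd n : continuous (fun x => n%:R * d x) by move=> x; apply: cvgMr; exact: cd.
have cstep : continuous step.
  by apply: derivable1_continuous => t; have [] := is_derive_step t.
have cphi1 n : continuous (phi1 n).
  move=> x; apply: cvgD; apply: cvgM; [|exact: cw1| |exact: cw].
    by apply: (@continuous_comp _ _ _ (fun x => n%:R * d x) step);
      [exact: cnd|exact: cstep].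
  apply: cvgM.
    by apply: (@continuous_comp _ _ _ (fun x => n%:R * d x) step1);
      [exact: cnd|exact: step1_cont].
  apply: cvgMr; apply: cvgB; first exact: cvg_cst.
  by apply: cvgMr; exact: cvg_id.
have tphi n : test_function a b (phi n).
  split; first by move=> x; have [] := dphi n x.
    by rewrite dE; exact: cphi1.
  pose r := ((n%:R + 1) * (b - a))^-1.
  have nL : 0 < (n%:R + 1) * (b - a) by rewrite mulr_gt0// ltr_wpDl.
  have r0 : 0 < r by rewrite invr_gt0.
  exists `[a + r, b - r]%classic; split; first exact: segment_compact.
    by move=> x; rewrite /= !in_itv/= => /andP[x1 x2]; apply/andP; split; lra.
  move=> x; rewrite /= in_itv/= => xr; rewrite /phi (step_le1 _).1 ?mul0r//.
  have nr : n%:R * (r * (b - a)) <= 1.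
    rewrite /r invfM -mulrA mulVf ?gt_eqF// mulr1 ler_pdivrMr ?ltr_wpDl//.
    by rewrite mul1r lerDl.
  have n0 : 0 <= (n%:R : R) by [].
  suff : d x <= r * (b - a).
    by move=> dx; apply: le_trans nr; rewrite ler_wpM2l.
  rewrite /d; have rL : 0 <= r * (b - a) by rewrite mulr_ge0 ?ltW.
  have [xa|ax] := leP x a.
    have [|bx] := leP 0 (b - x); last by lra.
    by move=> bx; apply: le_trans rL; rewrite mulr_le0_ge0// subr_le0.
  have [bx|xb] := leP b x.
    by apply: le_trans rL; rewrite mulr_ge0_le0// ?subr_le0// subr_ge0 ltW.
  have [x1|x1] := leP (a + r) x.
    have x2 : b - r < x by rewrite ltNge; apply/negP => x2; apply: xr; rewrite x1.
    by rewrite mulrC; apply: ler_pM; lra.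
  by apply: ler_pM; lra.
have [C C0 CP] := arch_linear_bound L0.
have fbnd n x : `|phi n x - profile a b x| <= C * (b - a) / (1 + pos (n%:R * d x) ^+ 2).
  have [xab|xab] := pselect (a < x < b); last first.
    rewrite (test_function_support (tphi n) xab).1 profile_out// subrr normr0.
    by rewrite divr_ge0 ?mulr_ge0 ?(ltW L0)// ltW.
  have /andP[ax xb] := xab.
  have [|w1' _ _] := CP (x - a); first by apply/andP; split; lra.
  rewrite profileE ?(ltW ax) ?(ltW xb)// /phi -/(w x).
  have -> : step (n%:R * d x) * w x - w x = w x * (step (n%:R * d x) - 1) by ring.
  rewrite normrM; apply: ler_pM => //.
  by rewrite (le_trans w1')// ler_wpM2l//; lra.
have fbnd1 n x : `|phi1 n x - profile1 a b x| <= 9 * C / (1 + pos (n%:R * d x) ^+ 2).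
  have [xab|xab] := pselect (a < x < b); last first.
    have := (test_function_support (tphi n) xab).2; rewrite dE => ->.
    have -> : profile1 a b x = 0 by rewrite /profile1; case: ifPn => // /xab.
    by rewrite subrr normr0 divr_ge0 ?mulr_ge0// ltW.
  have /andP[ax xb] := xab.
  have [|wl wr wb] := CP (x - a); first by apply/andP; split; lra.
  rewrite -/(w x) in wl wr; rewrite -/(w1 x) in wb.
  rewrite /profile1 xab /phi1 -/(w1 x).
  have -> : step (n%:R * d x) * w1 x + step1 (n%:R * d x) * (n%:R * (a + b - 2 * x)) * w x - w1 x =
    w1 x * (step (n%:R * d x) - 1) + step1 (n%:R * d x) * n%:R * ((a + b - 2 * x) * w x) by ring.
  have dx0 : 0 < d x by rewrite mulr_gt0// subr_gt0.
  have wd : `|(a + b - 2 * x) * w x| <= 2 * C * d x.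
    have dl : `|a + b - 2 * x| <= b - a by rewrite ler_norml; apply/andP; split; lra.
    have half : (b - a) * `|w x| <= 2 * C * d x.
      have wl' : (b - x) * `|w x| <= (b - x) * (C * (x - a)).
        by rewrite ler_wpM2l// subr_ge0 ltW.
      have wr' : (x - a) * `|w x| <= (x - a) * (C * (b - a - (x - a))).
        by rewrite ler_wpM2l// subr_ge0 ltW.
      have -> : (b - a) * `|w x| = (b - x) * `|w x| + (x - a) * `|w x| by ring.
      by rewrite /d; move: wl' wr'; lra.
    rewrite normrM; apply: le_trans half.
    by rewrite ler_wpM2r.
  rewrite (le_trans (ler_normD _ _))//.
  have -> : 9 * C / (1 + pos (n%:R * d x) ^+ 2) =
     C * (1 + pos (n%:R * d x) ^+ 2)^-1 + 2 * C * (4 / (1 + pos (n%:R * d x) ^+ 2)) by ring.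
  apply: lerD; first by rewrite normrM; apply: ler_pM.
  rewrite normrM.
  apply: (@le_trans _ _ (`|step1 (n%:R * d x) * n%:R| * (2 * C * d x))).
    by rewrite ler_wpM2l.
  have -> : `|step1 (n%:R * d x) * n%:R| * (2 * C * d x) =
      2 * C * `|step1 (n%:R * d x) * (n%:R * d x)|.
    by rewrite [in RHS]mulrA [in RHS]normrM (gtr0_norm dx0); ring.
  by rewrite ler_wpM2l ?mulr_ge0// step1_bnd.
have inv1 n x : (1 + pos (n%:R * d x) ^+ 2)^-1 <= 1.
  by rewrite invf_le1// lerDl exprn_ge0.
exists phi; split => //.
- apply: (@Lnorm_cvg0 _ _ a b (C * (b - a))).
  + move=> n; apply: measurable_funB; apply: continuous_measurable_fun.
      by apply: derivable1_continuous => x; have [] := dphi n x.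
    exact: profile_continuous.
  + by move=> n x; rewrite (le_trans (fbnd n x))// ler_piMr ?mulr_ge0 ?(ltW L0).
  + move=> n x xab; rewrite (test_function_closed_support (tphi n) xab).1 profile_out ?subrr//.
    by move=> /andP[ax xb]; apply: xab; rewrite !ltW.
  + move=> x; have [xab|xab] := pselect (a < x < b); last first.
      have E n : phi n x - profile a b x = 0.
        by rewrite (test_function_support (tphi n) xab).1 profile_out ?subrr.
      by under eq_fun do rewrite E; exact: cvg_cst.
    have dx0 : 0 < d x by case/andP: xab => ? ?; rewrite mulr_gt0 ?subr_gt0.
    by apply: (decay_cvg dx0 _ (fun n => fbnd n x)); rewrite mulr_ge0// ltW.
- under eq_fun => n do under eq_fun => x do rewrite dE.
  apply: (@Lnorm_cvg0 _ _ a b (9 * C)).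
  + move=> n; apply: measurable_funB; last exact: measurable_profile1.
    exact: continuous_measurable_fun.
  + by move=> n x; rewrite (le_trans (fbnd1 n x))// ler_piMr ?mulr_ge0.
  + move=> n x xab; have := (test_function_closed_support (tphi n) xab).2; rewrite dE => ->.
    rewrite /profile1; case: ifPn; rewrite ?subrr// => /andP[ax xb].
    by case: xab; rewrite !ltW.
  + move=> x; have [xab|xab] := pselect (a < x < b); last first.
      have E n : phi1 n x - profile1 a b x = 0.
        have := (test_function_support (tphi n) xab).2; rewrite dE => ->.
        by rewrite /profile1; case: ifPn; rewrite ?subrr// => /xab.
      by under eq_fun do rewrite E; exact: cvg_cst.
    have dx0 : 0 < d x by case/andP: xab => ? ?; rewrite mulr_gt0 ?subr_gt0.
    by apply: (decay_cvg dx0 _ (fun n => fbnd1 n x)); rewrite mulr_ge0.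
Qed.

Lemma profile_volume a b : a < b -> \int[mu]_x profile a b x = V0.
Proof.
move=> ab; have L0 : 0 < b - a by rewrite subr_gt0.
have -> : \int[mu]_x profile a b x = \int[mu]_(x in `[a, b]) arch (b - a) (x - a).
  rewrite [RHS]Rintegral_mkcond; apply: eq_Rintegral => x _.
  rewrite patchE; case: ifPn => [|/negP]; rewrite inE/= in_itv/= => xab.
    exact: profileE.
  by apply: profile_out => // /andP[ax xb]; apply: xab; rewrite !ltW.
pose W x := arch_primitive V0 c s (b - a) (x - a).
have dW x : is_derive x 1 W (arch (b - a) (x - a)).
  by apply: is_derive1_shift; exact: is_derive_arch_primitive.
have cW : continuous W by apply: derivable1_continuous => x; have [] := dW x.
rewrite /Rintegral (@continuous_FTC2 R _ W a b ab).
- by rewrite -EFinB/= /W subrr; exact: arch_volume.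
- apply: continuous_subspaceT; apply: shift_continuous; exact: arch_continuous.
- split; first by move=> x _; have [] := dW x.
    by apply: cvg_at_right_filter; exact: cW.
  by apply: cvg_at_left_filter; exact: cW.
- by move=> x _; rewrite derive1E; have [_ ->] := dW x.
Qed.

End H10_profile.

(** * Minimality of the profile *)

Section variational.
Variable R : realType.
Local Notation mu := (@Lebesgue R).
Local Notation L2 := (Lfun (@Lebesgue R) 2%:E).
Implicit Types (f g h u v phi : R -> R) (a b x : R).

Lemma H10_L2 a b v vx : H10 a b v vx -> v \in L2 /\ vx \in L2.
Proof. by case. Qed.

Lemma H10_continuous a b v vx : H10 a b v vx -> continuous v.
Proof. by case. Qed.

(** A linear identity that holds against test functions passes to their closure,
    although an element of [H10] need not have the derivative [vx] at any given
    point. *)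
Lemma H10_orth a b f g v vx : f \in L2 -> g \in L2 ->
  (forall phi, test_function a b phi -> ip f (derive1 phi) + ip g phi = 0) ->
  H10 a b v vx -> ip f vx + ip g v = 0.
Proof.
move=> f2 g2 orth [_ v2 vx2 [phi [tphi cphi cdphi]]].
have c1 := L2_weak_cvg f2 vx2 (fun n => (test_function_L2 (tphi n)).2) cdphi.
have c2 := L2_weak_cvg g2 v2 (fun n => (test_function_L2 (tphi n)).1) cphi.
have c0 : (fun=> 0) @ \oo --> ip f vx + ip g v.
  apply: cvg_trans (cvgD c1 c2); apply: near_eq_cvg; apply: nearW => n.
  exact: (orth _ (tphi n)).
apply/esym; apply: (cvg_unique _ _ c0) => //; exact: cvg_cst.
Qed.

(** The part of [v] outside [[a, b]] is orthogonal to all test functions, hence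
    to [v], hence to itself. *)
Lemma H10_out a b v vx x : H10 a b v vx -> ~ (a <= x <= b) -> v x = 0.
Proof.
move=> Hv xab; have [v2 vx2] := H10_L2 Hv; have cv := H10_continuous Hv.
pose w x := v x - v x * cutoff a b x.
have w2 : w \in L2 := L2B v2 (cutoff_mul_L2 a b cv).
have z2 : (fun x => 0 * v x) \in L2 by exact: L2Z.
have z0 f : f \in L2 -> ip (fun x => 0 * v x) f = 0.
  by move=> f2; rewrite ipC ipZr// mul0r.
have orth phi : test_function a b phi -> ip (fun x => 0 * v x) (derive1 phi) + ip w phi = 0.
  move=> tphi; rewrite z0 ?add0r; last exact: (test_function_L2 tphi).2.
  rewrite -(z0 v v2); apply: eq_Rintegral => y _.
  rewrite /w /cutoff; case: ifPn => [_|/negP yab]; first by rewrite mulr1 subrr !mul0r.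
  by rewrite (test_function_closed_support tphi yab).1 mulr0 !mul0r.
have := H10_orth z2 w2 orth Hv; rewrite z0// add0r => wv.
have ww : ip w w = 0.
  rewrite -[RHS]wv; apply: eq_Rintegral => y _.
  by rewrite /w /cutoff; case: ifPn => _; rewrite ?mulr1 ?subrr ?mul0r// mulr0 subr0.
have out : \forall y \near x, ~ (a <= y <= b).
  have oI : open (~` `[a, b]%classic : set R).
    by rewrite openC; exact: interval_closed.
  have : (~` `[a, b]%classic : set R) x by rewrite /= in_itv/=.
  move=> /(conj oI)/open_nbhs_nbhs; apply: filterS => y /=.
  by rewrite in_itv.
have wE y : ~ (a <= y <= b) -> w y = v y.
  by move=> /negP/negbTE yab; rewrite /w /cutoff yab mulr0 subr0.
rewrite -wE//; apply: (ip_eq0 w2 ww).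
apply/cvgrPdist_le => e e0; have /cvgrPdist_le/(_ e e0) H := cv x.
near=> y; rewrite wE// wE; last by near: y.
by near: y.
Unshelve. all: by end_near. Qed.

Lemma H10_ip_cutoff a b v vx : H10 a b v vx -> ip (cutoff a b) v = \int[mu]_x v x.
Proof.
move=> Hv; apply: eq_Rintegral => x _; rewrite /cutoff; case: ifPn => [_|/negP xab].
  by rewrite mul1r.
by rewrite (H10_out Hv xab) mulr0.
Qed.

Lemma ip_sqrB f g : f \in L2 -> g \in L2 ->
  ip (fun x => f x - g x) (fun x => f x - g x) = ip f f - 2 * ip g f + ip g g.
Proof.
move=> f2 g2; have fg2 := L2B f2 g2.
by rewrite ipBr// !ipBl// (ipC f g); ring.
Qed.

Lemma ip_sqrD f g (k : R) : f \in L2 -> g \in L2 ->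
  ip (fun x => f x + k * g x) (fun x => f x + k * g x) =
  ip f f + 2 * k * ip f g + k ^+ 2 * ip g g.
Proof.
move=> f2 g2; have kg2 := L2Z k g2; have fg2 := L2D f2 kg2.
rewrite ipDr// ipZr// ![ip (fun x => f x + _) _]ipC !ipDr// !ipZr// (ipC g f).
by ring.
Qed.

(** The potential of gravity along the incline, truncated to be square
    integrable. *)
Definition xcut a b x : R := x * cutoff a b x.

Lemma xcut_L2 a b : xcut a b \in L2.
Proof. by apply: (@cutoff_mul_L2 R a b (fun x => x)) => x; exact: cvg_id. Qed.

Variables (V0 kappa alpha : R).
Local Notation c := (kappa * cos alpha).
Local Notation s := (kappa * sin alpha).
Local Notation energy := (energy kappa alpha).

Lemma energyE a b v vx : H10 a b v vx ->
  energy v vx = 2^-1 * ip vx vx + c / 2 * ip v v - s * ip (xcut a b) v.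
Proof.
move=> Hv; have [v2 vx2] := H10_L2 Hv; have X2 := xcut_L2 a b.
have i1 := L2_mul vx2 (L2Z 2^-1 vx2).
have i2 := L2_mul v2 (L2Z (c / 2) v2).
have i3 := L2_mul X2 (L2Z s v2).
rewrite -!ipZr// /ip -RintegralD// -RintegralB//; last first.
  exact: integrableD i1 i2.
apply: eq_Rintegral => x _.
have -> : v x * x * s = xcut a b x * (s * v x).
  rewrite /xcut /cutoff; case: ifPn => [_|/negP xab]; first by ring.
  by rewrite (H10_out Hv xab); ring.
by rewrite real_normK ?num_real//; field.
Qed.

Lemma quadratic_nonneg_linear0 (D Q e0 : R) : 0 < e0 ->
  (forall e, `|e| <= e0 -> 0 <= e * D + e ^+ 2 * Q) -> D = 0.
Proof.
move=> e00 H; have Q0 : 0 <= `|Q| by [].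
pose e := Num.min e0 (`|D| / (2 * (`|Q| + 1))).
apply/eqP; apply: contrapT => /negP D0.
have D1 : 0 < `|D| by rewrite normr_gt0.
have ep : 0 < e by rewrite lt_min e00 divr_gt0// mulr_gt0// ltr_pwDr.
have e1 : e <= e0 by rewrite ge_min lexx.
have e2 : e * (2 * (`|Q| + 1)) <= `|D|.
  by rewrite -ler_pdivlMr ?mulr_gt0 ?ltr_pwDr// ge_min lexx orbT.
have {}H k : `|k| = e -> 0 <= k * D + e ^+ 2 * `|Q|.
  move=> ke; have Hk : 0 <= k * D + k ^+ 2 * Q by apply: H; rewrite ke.
  have k2 : e ^+ 2 = k ^+ 2 by rewrite -ke real_normK ?num_real.
  apply: (le_trans Hk); rewrite lerD2l k2.
  by apply: ler_wpM2l; [exact: sqr_ge0|exact: ler_norm].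
have kD : 0 <= - e * `|D| + e ^+ 2 * `|Q|.
  have [d0|d0] := leP 0 D.
    by rewrite (ger0_norm d0); apply: (H (- e)); rewrite normrN gtr0_norm.
  by rewrite (ltr0_norm d0) mulrNN; apply: (H e); rewrite gtr0_norm.
have : 0 <= e * (e * `|Q| - `|D|).
  by move: kD; rewrite expr2; lra.
rewrite pmulr_rge0// subr_ge0 => DQ.
have : e * 2 <= e * 2 * (`|Q| + 1) by rewrite ler_peMr ?lerDr// mulr_ge0// ltW.
by move: DQ e2; lra.
Qed.

Hypothesis V0_gt0 : 0 < V0.
Hypothesis c_gt0 : 0 < c.
Hypothesis s_gt0 : 0 < s.
Local Notation profile := (profile V0 c s).
Local Notation profile1 := (profile1 V0 c s).
Local Notation back_slope := (back_slope V0 c s).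

Lemma profile_competitor a b : a < b -> 0 <= back_slope (b - a) ->
  competitor V0 a b (profile a b) (profile1 a b).
Proof.
move=> ab p0; split; first exact: profile_H10.
  by move=> x; exact: profile_ge0.
exact: profile_volume.
Qed.

(** The Euler--Lagrange equation of the profile, in divergence form. *)
Lemma profile_orth a b phi : a < b -> test_function a b phi ->
  ip (profile1 a b) (derive1 phi) +
  ip (fun x => c * profile a b x - s * xcut a b x - multiplier V0 c s a b * cutoff a b x) phi = 0.
Proof.
move=> ab tphi; have [phi2 dphi2] := test_function_L2 tphi.
have w2 : (fun x => c * profile a b x - s * xcut a b x) \in L2.
  by apply: L2B; apply: L2Z; [exact: profile_L2|exact: xcut_L2].
have k2 := L2Z (multiplier V0 c s a b) (cutoff_L2 a b).
rewrite [X in _ + X]ipC ipBr// [ip phi (fun x => multiplier _ _ _ _ _ * _)]ipZr ?cutoff_L2//.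
rewrite ![ip phi _]ipC addrA; apply/eqP; rewrite subr_eq0; apply/eqP.
exact: profile_weak_test.
Qed.

Lemma H10_weak a b v vx : a < b -> H10 a b v vx ->
  ip (profile1 a b) vx + c * ip (profile a b) v - s * ip (xcut a b) v =
  multiplier V0 c s a b * \int[mu]_x v x.
Proof.
move=> ab Hv; have [v2 vx2] := H10_L2 Hv.
have p2 := profile_L2 V0 s c_gt0 ab; have X2 := xcut_L2 a b.
have k2 := cutoff_L2 a b.
have w2 : (fun x => c * profile a b x - s * xcut a b x) \in L2.
  by apply: L2B; apply: L2Z.
have g2 := L2B w2 (L2Z (multiplier V0 c s a b) k2).
have := H10_orth (profile1_L2 V0 s c_gt0 ab) g2 (fun phi => @profile_orth a b phi ab) Hv.
rewrite [X in _ + X]ipC !ipBr// ?ipZr//; try exact: L2Z.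
rewrite ![ip v _]ipC (H10_ip_cutoff Hv); lra.
Qed.

(** The energy is quadratic, and its first variation at the profile only sees
    the volume, which is prescribed: only the square of the difference remains. *)
Lemma energy_profile a b v vx : a < b -> competitor V0 a b v vx ->
  energy v vx = energy (profile a b) (profile1 a b) +
    (2^-1 * ip (fun x => vx x - profile1 a b x) (fun x => vx x - profile1 a b x) +
     c / 2 * ip (fun x => v x - profile a b x) (fun x => v x - profile a b x)).
Proof.
move=> ab [Hv _ vV]; have Hw := profile_H10 V0 s c_gt0 ab.
have [v2 vx2] := H10_L2 Hv; have [w2 wx2] := H10_L2 Hw.
have E1 := H10_weak ab Hv; have E2 := H10_weak ab Hw.
rewrite vV in E1; rewrite (profile_volume V0 s c_gt0 ab) in E2.
rewrite (energyE Hv) (energyE Hw) !ip_sqrB//.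
by move: E1 E2; lra.
Qed.

Lemma profile_argmin a b : a < b -> 0 <= back_slope (b - a) ->
  drop_on V0 kappa alpha a b (profile a b).
Proof.
move=> ab p0; split.
  apply/seteqP; split => x /=; rewrite in_itv/= => xab; last exact: profile_gt0.
  by apply: contrapT => xab'; move: xab; rewrite profile_out// ltxx.
exists (profile1 a b); first exact: profile_competitor.
move=> v vx cv; rewrite (energy_profile ab cv) lerDl.
apply: addr_ge0; apply: mulr_ge0; rewrite ?ip_ge0 ?invr_ge0//.
by rewrite divr_ge0// ltW.
Qed.
End variational.

(** * Uniqueness of the minimizer *)

Section drop_is_profile.
Variable R : realType.
Local Notation mu := (@Lebesgue R).
Local Notation L2 := (Lfun (@Lebesgue R) 2%:E).
Implicit Types (f g h u v phi psi : R -> R) (a b x : R).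
Variables (V0 kappa alpha : R).
Local Notation c := (kappa * cos alpha).
Local Notation s := (kappa * sin alpha).
Local Notation energy := (energy kappa alpha).

Lemma H10_perturb a b u ux phi e : H10 a b u ux -> test_function a b phi ->
  H10 a b (fun x => u x + e * phi x) (fun x => ux x + e * derive1 phi x).
Proof.
move=> Hu tphi; have [u2 ux2] := H10_L2 Hu; have [phi2 dphi2] := test_function_L2 tphi.
have [cu _ _ [psi [tpsi cpsi cdpsi]]] := Hu.
split.
- have [dphi _ _] := tphi; have cphi := derivable1_continuous dphi.
  by move=> x; apply: cvgD; [exact: cu|apply: cvgMr; exact: cphi].
- exact: L2D u2 (L2Z e phi2).
- exact: L2D ux2 (L2Z e dphi2).
- have D n := test_functionD e (tpsi n) tphi.
  exists (fun n x => psi n x + e * phi x); split; first by move=> n; exact: (D n).1.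
    suff -> : (fun n => Lnorm mu 2%:E (fun x => (psi n x + e * phi x - (u x + e * phi x))%:E)) =
      (fun n => Lnorm mu 2%:E (fun x => (psi n x - u x)%:E)) by exact: cpsi.
    apply/funext => n; congr (Lnorm _ _ _); apply/funext => x; congr (_%:E); ring.
  suff -> : (fun n => Lnorm mu 2%:E (fun x =>
      (derive1 (fun x => psi n x + e * phi x) x - (ux x + e * derive1 phi x))%:E)) =
    (fun n => Lnorm mu 2%:E (fun x => (derive1 (psi n) x - ux x)%:E)) by exact: cdpsi.
  apply/funext => n; congr (Lnorm _ _ _); apply/funext => x; congr (_%:E).
  rewrite (D n).2; ring.
Qed.

Lemma perturb_ge0 a b u phi : continuous u -> (forall x, 0 <= u x) ->
  (forall x, a < x < b -> 0 < u x) -> test_function a b phi ->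
  exists2 e0, 0 < e0 & forall e, `|e| <= e0 -> forall x, 0 <= u x + e * phi x.
Proof.
move=> cu u0 upos tphi; have [dphi _ [A [cA Aab phi0]]] := tphi.
have [C CP] := compact_support_bounded (derivable1_continuous dphi)
  (fun x xab => (test_function_closed_support tphi xab).1).
have C0 : 0 <= C by rewrite (le_trans _ (CP 0)).
have [A0|/set0P An] := eqVneq A set0.
  exists 1 => // e _ x; rewrite phi0 ?mulr0 ?addr0//.
  by rewrite A0.
have cuA : {within A, continuous u} by exact: continuous_subspaceT.
have [z zA zmin] := compact_EVT_min An cA cuA.
have z0 : 0 < u z by apply: upos; have := Aab z (set_mem zA); rewrite /= in_itv.
have C1 : 0 < C + 1 by rewrite ltr_wpDl.
exists (u z / (C + 1)); first by rewrite divr_gt0.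
move=> e; rewrite ler_pdivlMr// => eC x.
have [xA|xA] := pselect (A x); last by rewrite (phi0 x xA) mulr0 addr0.
have : `|e * phi x| <= u z.
  apply: le_trans eC; rewrite normrM; apply: ler_pM => //.
  by rewrite (le_trans (CP x))// lerDl.
by rewrite ler_norml => /andP[ez _]; have := zmin x (mem_set xA); lra.
Qed.

(** A positive function can be perturbed in both directions by a test function
    of zero mass. *)
Lemma argmin_stationary a b u ux phi : (forall x, a < x < b -> 0 < u x) ->
  competitor V0 a b u ux ->
  (forall v vx, competitor V0 a b v vx -> energy u ux <= energy v vx) ->
  test_function a b phi -> ip (cutoff a b) phi = 0 ->
  ip ux (derive1 phi) + c * ip u phi - s * ip (xcut a b) phi = 0.
Proof.
move=> upos [Hu u0 uV] umin tphi phi0.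
have [u2 ux2] := H10_L2 Hu; have [phi2 dphi2] := test_function_L2 tphi.
have X2 := xcut_L2 a b; have k2 := cutoff_L2 a b.
have [e0 e00 eP] := perturb_ge0 (H10_continuous Hu) u0 upos tphi.
pose Q := 2^-1 * ip (derive1 phi) (derive1 phi) + c / 2 * ip phi phi.
apply: (@quadratic_nonneg_linear0 R _ Q _ e00) => e ee.
have Hv := H10_perturb e Hu tphi.
have := umin _ _ (And3 Hv (eP e ee) _).
rewrite (energyE kappa alpha Hu) (energyE kappa alpha Hv) !ip_sqrD//.
rewrite (ipDr X2 u2 (L2Z e phi2)) (ipZr _ X2 phi2) => H.
have : \int[mu]_x (u x + e * phi x) = V0.
  by rewrite -(H10_ip_cutoff Hv) (ipDr k2 u2 (L2Z e phi2)) (ipZr _ k2 phi2) phi0 mulr0 addr0 (H10_ip_cutoff Hu).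
by move=> /H; rewrite /Q; lra.
Qed.

Hypothesis V0_gt0 : 0 < V0.
Hypothesis c_gt0 : 0 < c.
Hypothesis s_gt0 : 0 < s.
Local Notation profile := (profile V0 c s).
Local Notation profile1 := (profile1 V0 c s).
Local Notation back_slope := (back_slope V0 c s).
Local Notation front_slope := (front_slope V0 c s).

(** A minimizer and the profile both satisfy the Euler--Lagrange equation, with
    some multiplier; tested with their difference, which has zero mass, the two
    equations give that the difference vanishes. In particular the
    profile is then nonnegative. *)
Lemma argmin_profile a b u ux : a < b -> (forall x, a < x < b -> 0 < u x) ->
  competitor V0 a b u ux ->
  (forall v vx, competitor V0 a b v vx -> energy u ux <= energy v vx) ->
  u = profile a b.
Proof.
move=> ab upos cu umin; have [Hu u0 uV] := cu.
have Hw := profile_H10 V0 s c_gt0 ab.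
have [u2 ux2] := H10_L2 Hu; have [w2 wx2] := H10_L2 Hw.
have X2 := xcut_L2 a b; have k2 := cutoff_L2 a b.
(* some test function has nonzero mass, as the volume is positive *)
have [psi tpsi psi0] : exists2 psi, test_function a b psi & ip (cutoff a b) psi != 0.
  apply: contrapT => none; have : ip (fun x => 0 * u x) ux + ip (cutoff a b) u = 0.
    apply: (H10_orth _ k2 _ Hu); first exact: L2Z.
    move=> phi tphi; have [phi2 dphi2] := test_function_L2 tphi.
    rewrite ipC ipZr// mul0r add0r; apply/eqP; apply: contrapT => /negP phi0.
    by apply: none; exists phi.
  rewrite ipC ipZr// mul0r add0r (H10_ip_cutoff Hu) uV => V00.
  by move: V0_gt0; rewrite V00 ltxx.
pose D phi := ip ux (derive1 phi) + c * ip u phi - s * ip (xcut a b) phi.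
pose Lam := D psi / ip (cutoff a b) psi.
have lagrange phi : test_function a b phi -> D phi = Lam * ip (cutoff a b) phi.
  move=> tphi; pose k := - (ip (cutoff a b) phi / ip (cutoff a b) psi).
  have [phi2 dphi2] := test_function_L2 tphi; have [psi2 dpsi2] := test_function_L2 tpsi.
  have [tk dk] := test_functionD k tphi tpsi.
  have kpsi2 := L2Z k psi2; have kdpsi2 := L2Z k dpsi2.
  have := argmin_stationary upos cu umin tk.
  rewrite dk !ipDr// !ipZr// => /(_ _) H.
  have {}H : ip ux (derive1 phi) + k * ip ux (derive1 psi) +
      c * (ip u phi + k * ip u psi) -
      s * (ip (xcut a b) phi + k * ip (xcut a b) psi) = 0.
    by apply: H; rewrite /k; field.
  have : D phi + k * D psi = 0.
    rewrite /D -[RHS]H; move: (ip ux (derive1 phi)) (ip ux (derive1 psi)).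
    move: (ip u phi) (ip u psi) (ip (xcut a b) phi) (ip (xcut a b) psi) => *; ring.
  by move/eqP; rewrite addr_eq0 => /eqP ->; rewrite /k /Lam; field.
pose zx x := ux x - profile1 a b x.
pose z x := u x - profile a b x.
pose g x := c * z x - (Lam - multiplier V0 c s a b) * cutoff a b x.
have z2 : z \in L2 by exact: L2B.
have zx2 : zx \in L2 by exact: L2B.
have g2 : g \in L2 by apply: L2B; exact: L2Z.
have orth phi : test_function a b phi -> ip zx (derive1 phi) + ip g phi = 0.
  move=> tphi; have [phi2 dphi2] := test_function_L2 tphi.
  have E1 := lagrange phi tphi.
  have w2' := L2B (L2Z c w2) (L2Z s X2).
  have E2 : ip (profile1 a b) (derive1 phi) +
      ip (fun x => c * profile a b x - s * xcut a b x) phi =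
    multiplier V0 c s a b * ip (cutoff a b) phi := profile_weak_test V0 s c_gt0 ab tphi.
  rewrite (ipBl phi2 (L2Z c w2) (L2Z s X2)) ![ip (fun x => _ * _) phi]ipC !ipZr// in E2.
  rewrite /zx (ipBl dphi2 ux2 wx2) /g (ipBl phi2 (L2Z c z2) (L2Z _ k2)).
  rewrite ![ip (fun x => _ * _) phi]ipC !ipZr// /z ipBr//.
  move: E1 E2; rewrite /D ![ip phi _]ipC; lra.
have := H10_orth zx2 g2 orth Hw.
have := H10_orth zx2 g2 orth Hu.
have cE : ip (cutoff a b) u = ip (cutoff a b) (profile a b).
  by rewrite (H10_ip_cutoff Hu) (H10_ip_cutoff Hw) uV profile_volume.
have gE f : f \in L2 -> ip g f = c * ip z f - (Lam - multiplier V0 c s a b) * ip (cutoff a b) f.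
  move=> f2; rewrite /g (ipBl f2 (L2Z c z2) (L2Z _ k2)).
  by rewrite ![ip (fun x => _ * _) f]ipC !ipZr// ![ip f _]ipC.
rewrite !gE// cE => Eu Ew.
have zz : ip zx zx + c * ip z z = 0.
  rewrite [X in ip zx X](_ : _ = fun x => ux x - profile1 a b x)// ipBr//.
  by rewrite [X in ip z X](_ : _ = fun x => u x - profile a b x)// ipBr//; lra.
have z0 : ip z z = 0.
  have := ip_ge0 zx; have := ip_ge0 z => i0 i1; apply/eqP; rewrite eq_le i0 andbT.
  by rewrite -(pmulr_rle0 _ c_gt0); lra.
apply/funext => x; apply/eqP; rewrite -subr_eq0; apply/eqP; apply: (ip_eq0 z2 z0).
by apply: cvgB; [exact: (H10_continuous Hu)|exact: profile_continuous].
Qed.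

End drop_is_profile.

(** * Contact slopes and uniform continuity of the profile *)

Section one_sided.
Variable R : realType.
Implicit Types (f g : R -> R) (a b x : R).

Lemma is_derive_right f g x y p d : 0 < d ->
  (forall h, 0 < h < d -> f (x + h) - f x = g (y + h) - g y) ->
  is_derive y 1 g p -> has_right_derivative f x p.
Proof.
move=> d0 fg dg; apply/cvgrPdist_le => e e0; rewrite near_withinE.
have H := (is_derive1_nearP g y p).1 dg e e0.
near=> h; move=> h0; have hd : `|h| < d by near: h; exact: near0_norm_lt.
have He : `|g (y + h) - g y - p * h| <= e * `|h| by near: h.
rewrite gtr0_norm// in hd; rewrite (gtr0_norm h0) in He.
rewrite fg ?h0// distrC.
have -> : h^-1 * (g (y + h) - g y) - p = (g (y + h) - g y - p * h) / h.
  by field; rewrite gt_eqF.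
by rewrite normrM normfV (gtr0_norm h0) ler_pdivrMr.
Unshelve. all: by end_near. Qed.

Lemma is_derive_left f g x y p d : 0 < d ->
  (forall h, - d < h < 0 -> f (x + h) - f x = g (y + h) - g y) ->
  is_derive y 1 g p -> has_left_derivative f x p.
Proof.
move=> d0 fg dg; apply/cvgrPdist_le => e e0; rewrite near_withinE.
have H := (is_derive1_nearP g y p).1 dg e e0.
near=> h; move=> h0; have hd : `|h| < d by near: h; exact: near0_norm_lt.
have He : `|g (y + h) - g y - p * h| <= e * `|h| by near: h.
rewrite ltr0_norm// in hd; rewrite (ltr0_norm h0) in He.
rewrite fg ?h0 ?andbT 1?ltrNl// distrC.
have -> : h^-1 * (g (y + h) - g y) - p = (g (y + h) - g y - p * h) / h.
  by field; rewrite lt_eqF.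
by rewrite normrM normfV (ltr0_norm h0) ler_pdivrMr// oppr_gt0.
Unshelve. all: by end_near. Qed.

Lemma right_derivative_unique f x p q :
  has_right_derivative f x p -> has_right_derivative f x q -> p = q.
Proof. by move=> hp hq; apply: (cvg_unique _ hp hq). Qed.

Lemma left_derivative_unique f x p q :
  has_left_derivative f x p -> has_left_derivative f x q -> p = q.
Proof. by move=> hp hq; apply: (cvg_unique _ hp hq). Qed.

Variables (V0 kappa alpha : R).
Local Notation c := (kappa * cos alpha).
Local Notation s := (kappa * sin alpha).
Hypothesis V0_gt0 : 0 < V0.
Hypothesis c_gt0 : 0 < c.
Hypothesis s_gt0 : 0 < s.
Local Notation profile := (profile V0 c s).
Local Notation back_slope := (back_slope V0 c s).
Local Notation front_slope := (front_slope V0 c s).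

Lemma profile_right_derivative a b : a < b ->
  has_right_derivative (profile a b) a (back_slope (b - a)).
Proof.
move=> ab; have L0 : 0 < b - a by rewrite subr_gt0.
have := is_derive_arch V0 c s (b - a) 0; rewrite (arch1_0 V0 s c_gt0 L0).
apply: (is_derive_right L0) => h /andP[h0 hL].
rewrite (profile_out V0 s c_gt0 ab (x := a)) ?ltxx// arch0// profileE.
  by congr (arch _ _ _ _ _ - _); ring.
by apply/andP; split; lra.
Qed.

Lemma profile_left_derivative a b : a < b ->
  has_left_derivative (profile a b) b (- front_slope (b - a)).
Proof.
move=> ab; have L0 : 0 < b - a by rewrite subr_gt0.
have := is_derive_arch V0 c s (b - a) (b - a); rewrite (arch1_L V0 s c_gt0 L0).
apply: (is_derive_left L0) => h /andP[h0 hL].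
rewrite (profile_out V0 s c_gt0 ab (x := b)) ?ltxx ?andbF// archL// profileE.
  by congr (arch _ _ _ _ _ - _); ring.
by apply/andP; split; lra.
Qed.

(** The slope at the back is a limit of nonnegative quotients; hence no drop is
    longer than the critical length. *)
Lemma back_slope_profile_ge0 a b : a < b -> (forall x, 0 <= profile a b x) ->
  0 <= back_slope (b - a).
Proof.
move=> ab w0; have d := profile_right_derivative ab.
have N : \forall h \near 0^'+, 0 <= h^-1 * (profile a b (a + h) - profile a b a).
  rewrite near_withinE; apply: nearW => h h0.
  rewrite mulr_ge0 ?invr_ge0 ?(ltW h0)// (profile_out V0 s c_gt0 ab (x := a)) ?ltxx//.
  by rewrite subr0.
exact: (cvgr_to_ge d N).
Qed.

(** The positive volume excludes an empty support; the rest is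
    [argmin_profile]. *)
Lemma drop_profile a b u : drop_on V0 kappa alpha a b u ->
  [/\ a < b, 0 <= back_slope (b - a) & u = profile a b].
Proof.
move=> [supp [ux cu umin]]; have [Hu u0 uV] := cu.
have upos x : a < x < b -> 0 < u x.
  by move=> xab; have : [set` `]a, b[] x; [rewrite /= in_itv|rewrite -supp].
have ab : a < b.
  rewrite ltNge; apply/negP => ba.
  have uz x : u x = 0.
    apply/eqP; rewrite eq_le u0 andbT leNgt; apply/negP => ux0.
    have : [set` `]a, b[] x by rewrite -supp.
    by rewrite /= in_itv/= => /andP[ax xb]; have := lt_trans ax xb; rewrite ltNge ba.
  have : ip (cutoff a b) u = 0.
    have -> : u = (fun x => 0 * u x) by apply/funext => x; rewrite uz mulr0.
    by rewrite ipZr ?mul0r// ?cutoff_L2//; have [] := H10_L2 Hu.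
  by rewrite (H10_ip_cutoff Hu) uV => V00; move: V0_gt0; rewrite V00 ltxx.
have uE := argmin_profile V0_gt0 c_gt0 ab upos cu umin.
by split => //; apply: back_slope_profile_ge0 => // x; rewrite -uE.
Qed.

Let dist_min_le (p q p' q' d : R) : `|p - p'| <= d -> `|q - q'| <= d ->
  `|Num.min p q - Num.min p' q'| <= d.
Proof.
by rewrite !ler_norml => /andP[? ?] /andP[? ?]; case: (leP p q) => ?;
  case: (leP p' q') => ?; apply/andP; split; lra.
Qed.

Let dist_max_le (p p' d : R) : `|p - p'| <= d -> `|Num.max 0 p - Num.max 0 p'| <= d.
Proof.
by rewrite !ler_norml => /andP[? ?]; case: (leP 0 p) => ?;
  case: (leP 0 p') => ?; apply/andP; split; lra.
Qed.

(** Lengths between [l] and [Lm] and abscissas form a compact set, on which the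
    arch is jointly continuous. *)
Lemma profile_unif l Lm e : 0 < l -> 0 < e -> exists2 d, 0 < d &
  forall a b A B, l <= B - A <= Lm -> `|a - A| <= d -> `|b - B| <= d ->
    forall x, `|profile a b x - profile A B x| <= e.
Proof.
move=> l0 e0; pose arch2 (z : R * R) := arch V0 c s z.1 z.2.
pose K : set (R * R) := `[l, Lm] `*` `[0, Lm].
have cK : compact K by apply: compact_setX; exact: segment_compact.
pose P (d : R) (z : R * R) := forall z', `|z'.1 - z.1| <= 2 * d -> `|z'.2 - z.2| <= 2 * d ->
  `|arch2 z' - arch2 z| <= e.
have : \forall d \near 0^'+, K `<=` P d.
  apply: (iffLR (compact_near_coveringP K) cK) => -[L x] [/=].
  rewrite !in_itv/= => /andP[lL LLm] /andP[x0 xL].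
  have L0 : 0 < L by exact: lt_le_trans lL.
  have e2 : 0 < e / 2 by rewrite divr_gt0.
  have /cvgrPdist_le/(_ _ e2)/nbhs_ballP[r /= r0 rP] := @arch_cont R V0 c s c_gt0 L x L0.
  have r40 : 0 < r / 4 by rewrite divr_gt0.
  exists ([set z | ball (L, x) (r / 2) z], [set d | d < r / 4]) => /=.
    split; first by apply: nbhsx_ballx; rewrite divr_gt0.
    exact: nbhs_right_lt.
  move=> [z d] [/= [z1 z2] dr] z' d1 d2.
  have r2 : r / 2 = 2 * (r / 4) by field.
  have b1 : ball (L, x) r z.
    split; rewrite /ball/=; apply: (lt_le_trans z1 _) || apply: (lt_le_trans z2 _);
      lra.
  have b2 : ball (L, x) r z'.
    split; rewrite /ball/=.
      have -> : L - z'.1 = (L - z.1) - (z'.1 - z.1) by ring.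
      apply: (le_lt_trans (ler_normB _ _)); move: z1; rewrite /ball/=; lra.
    have -> : x - z'.2 = (x - z.2) - (z'.2 - z.2) by ring.
    apply: (le_lt_trans (ler_normB _ _)); move: z2; rewrite /ball/=; lra.
  have := rP _ b1; have := rP _ b2; rewrite /=/arch2 => n1 n2.
  have -> : arch V0 c s z'.1 z'.2 - arch V0 c s z.1 z.2 =
    (arch V0 c s L x - arch V0 c s z.1 z.2) - (arch V0 c s L x - arch V0 c s z'.1 z'.2) by ring.
  by apply: (le_trans (ler_normB _ _)); lra.
rewrite near_withinE => /nbhs_ballP[r /= r0 rP].
have r20 : 0 < r / 2 by rewrite divr_gt0.
have KP : K `<=` P (r / 2).
  apply: rP => //; rewrite /ball/= sub0r normrN gtr0_norm//.
  by rewrite ltr_pdivrMr// mulr_natr mulr2n ltrDl.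
exists (r / 2) => // a b A B /andP[lL LLm] aA bB x.
have L0 : 0 < B - A by exact: lt_le_trans lL.
have dA : `|(b - a) - (B - A)| <= 2 * (r / 2).
  have -> : (b - a) - (B - A) = (b - B) - (a - A) by ring.
  by apply: (le_trans (ler_normB _ _)); lra.
apply: (KP (B - A, Num.max 0 (Num.min (x - A) (B - A))) _
  (b - a, Num.max 0 (Num.min (x - a) (b - a)))) => //=.
  split; rewrite /= in_itv/=; first by rewrite lL.
  by rewrite le_max lexx/= ge_max ge_min LLm orbT andbT ltW// (lt_le_trans L0).
apply: dist_max_le; apply: dist_min_le => //.
have -> : x - a - (x - A) = - (a - A) by ring.
by rewrite normrN; lra.
Qed.
End one_sided.

(** * From drops to the sliding system *)

Section translation.
Variable R : realType.
Implicit Types (beta a b f : R -> R) (t x : R).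

Lemma lip_onP (I : set R) f : [lipschitz f t | t in I] <-> lip_on I f.
Proof.
split.
  move=> [M [_ MP]]; exists (M + 1) => s t Is It.
  by apply: (MP (M + 1) _ (s, t)); rewrite ?ltrDl.
move=> [K KP]; exists K; split; first exact: num_real.
move=> M KM -[s t] [/= Is It]; apply: (le_trans (KP _ _ Is It)).
by rewrite ler_wpM2r// ltW.
Qed.

Lemma oo_itv_inj (a0 b0 a1 b1 : R) : a0 < b0 -> a1 < b1 ->
  (forall x, (a0 < x < b0) = (a1 < x < b1)) -> a0 = a1 /\ b0 = b1.
Proof.
have half (c0 d0 c1 d1 : R) : c0 < d0 -> c1 < d1 ->
    (forall x, (c0 < x < d0) = (c1 < x < d1)) -> c1 <= c0 /\ d0 <= d1.
  move=> cd0 cd1 E; split; rewrite leNgt; apply/negP => lt.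
    have [m1 m2] : c0 < Num.min c1 d0 /\ Num.min c1 d0 <= c1.
      by rewrite lt_min lt cd0 ge_min lexx.
    have m3 : Num.min c1 d0 <= d0 by rewrite ge_min lexx orbT.
    have := E ((c0 + Num.min c1 d0) / 2).
    have -> : c0 < (c0 + Num.min c1 d0) / 2 < d0 by apply/andP; split; lra.
    by move=> /esym/andP[? _]; lra.
  have [m1 m2] : Num.max d1 c0 < d0 /\ d1 <= Num.max d1 c0.
    by rewrite gt_max lt cd0 le_max lexx.
  have m3 : c0 <= Num.max d1 c0 by rewrite le_max lexx orbT.
  have := E ((d0 + Num.max d1 c0) / 2).
  have -> : c0 < (d0 + Num.max d1 c0) / 2 < d0 by apply/andP; split; lra.
  by move=> /esym/andP[_ ?]; lra.
move=> ab0 ab1 E; have [h1 h2] := half _ _ _ _ ab0 ab1 E.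
have [h3 h4] := half _ _ _ _ ab1 ab0 (fun x => esym (E x)).
by split; apply/eqP; rewrite eq_le ?h1 ?h2 ?h3 ?h4.
Qed.

Lemma ereal_sup_cvg0 (f : R -> R -> R) :
  (forall x t, 0 <= f x t) ->
  (forall e, 0 < e -> \forall t \near +oo, forall x, f x t <= e) ->
  ereal_sup [set (f x t)%:E | x in setT] @[t --> +oo] --> 0%E.
Proof.
move=> f0 fe.
have sup0 t : (0 <= ereal_sup [set (f x t)%:E | x in setT])%E.
  apply: (@le_trans _ _ (f 0 t)%:E); first by rewrite lee_fin.
  by apply: ereal_sup_ubound; exists 0.
have supe e : 0 < e ->
    \forall t \near +oo, (ereal_sup [set (f x t)%:E | x in setT] <= e%:E)%E.
  move=> /fe; apply: filterS => t ft; apply: ge_ereal_sup => _ [x _ <-].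
  by rewrite lee_fin.
have fin t e : (ereal_sup [set (f x t)%:E | x in setT] <= e%:E)%E ->
    ereal_sup [set (f x t)%:E | x in setT] \is a fin_num.
  by move=> te; rewrite ge0_fin_numE// (le_lt_trans te)// ltry.
apply/fine_cvgP; split.
  by apply: filterS (supe 1 ltr01) => t; exact: fin.
apply/cvgrPdist_le => e e0; apply: filterS (supe e e0) => t te /=.
by rewrite sub0r normrN ger0_norm ?fine_ge0// -lee_fin fineK// (fin _ e).
Qed.

Variables (V0 kappa alpha : R).
Local Notation c := (kappa * cos alpha).
Local Notation s := (kappa * sin alpha).
Hypothesis V0_gt0 : 0 < V0.
Hypothesis c_gt0 : 0 < c.
Hypothesis s_gt0 : 0 < s.
Local Notation profile := (profile V0 c s).
Local Notation back_slope := (back_slope V0 c s).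
Local Notation front_slope := (front_slope V0 c s).
Local Notation P := (half_sqr_slope V0 c s).
Local Notation F0 := (V0 * s).
Variable Lm : R.
Hypothesis Lm_gt0 : 0 < Lm.
Hypothesis Lm_crit : back_slope Lm = 0.
Variable beta : R -> R.
Local Notation slides := (slides P Lm F0 beta).

(** At the front the slope is nonzero, so that the minimum in the contact law is
    attained by the first term; at the back either term can vanish, and the
    slope does exactly at maximal length. *)
Lemma contact_lawsP (u : R -> R -> R) a b t : 0 < b t - a t <= Lm ->
  u ^~ t = profile (a t) (b t) ->
  contact_laws beta u a b t <-> slide_law P Lm F0 beta a b t.
Proof.
move=> /andP[L0 LLm] uE.
have ab : a t < b t by rewrite -subr_gt0.
have hp := profile_right_derivative (V0 := V0) c_gt0 ab.
have hq := profile_left_derivative (V0 := V0) c_gt0 ab.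
have q0 := front_slope_gt0 V0_gt0 c_gt0 s_gt0 L0.
have bal := slope_balance V0 s c_gt0 L0.
have p0 : 0 <= back_slope (b t - a t) by rewrite (back_slope_ge0 V0_gt0 c_gt0 s_gt0 Lm_gt0 Lm_crit).
have pgt : b t - a t < Lm -> 0 < back_slope (b t - a t).
  exact: (back_slope_gt0 V0_gt0 c_gt0 s_gt0 Lm_crit).
rewrite /contact_laws uE /slide_law /half_sqr_slope.
move: pgt p0 bal q0 hp hq.
set p := back_slope _; set q := front_slope _; move=> pgt p0 bal q0 hp hq.
split.
  move=> [da db [p' [q' [hp' hq']]]].
  rewrite (right_derivative_unique hp' hp) (left_derivative_unique hq' hq).
  rewrite normrN !real_normK ?num_real// (ger0_norm p0) (gtr0_norm q0) => ma mb.
  have {}mb : - derive1 b t + 2^-1 * q ^+ 2 - beta (b t) = 0.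
    move: mb; have [h|/ltW h] := leP (- derive1 b t + 2^-1 * q ^+ 2 - beta (b t)) q.
      by [].
    by move=> q00; move: q0; rewrite q00 ltxx.
  have ma1 : 0 <= derive1 a t + 2^-1 * p ^+ 2 - beta (a t).
    move: ma; have [h|/ltW h] := leP (derive1 a t + 2^-1 * p ^+ 2 - beta (a t)) p.
      by move=> ->.
    by move=> p00; move: h; rewrite {1}p00.
  have ma2 : 0 < p -> derive1 a t + 2^-1 * p ^+ 2 - beta (a t) = 0.
    move: ma; have [h|/ltW h] := leP (derive1 a t + 2^-1 * p ^+ 2 - beta (a t)) p.
      by [].
    by move=> ->; rewrite ltxx.
  exists (derive1 a t), (derive1 b t); split.
  - exact: derivable_is_derive1.
  - exact: derivable_is_derive1.
  - by lra.
  - by lra.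
  - by move=> /pgt/ma2; lra.
move=> [a' [b' [da db E1 E2 E3]]].
have aE : derive1 a t = a' by rewrite derive1E; case: da.
have bE : derive1 b t = b' by rewrite derive1E; case: db.
split; [by case: da|by case: db|].
exists p, (- q); split => //.
  rewrite aE !real_normK ?num_real// (ger0_norm p0).
  move: p0; rewrite le_eqVlt => /predU1P[p0|p0].
    by rewrite min_r -?p0// expr0n/= mulr0 addr0 subr_ge0; move: E2; rewrite -p0 expr0n/= mul0r subr0.
  have LL : b t - a t < Lm.
    rewrite lt_neqAle LLm andbT; apply/eqP => LE.
    by move: p0; rewrite /p LE Lm_crit ltxx.
  have E : a' + 2^-1 * p ^+ 2 - beta (a t) = 0 by move: (E3 LL); lra.
  by rewrite E min_l// ltW.
rewrite bE normrN !real_normK ?num_real// (gtr0_norm q0).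
have E : - b' + 2^-1 * q ^+ 2 - beta (b t) = 0 by lra.
by rewrite E min_l// ltW.
Qed.

Lemma sliding_drop_slides (I : set R) (u : R -> R -> R) a b :
  sliding_drop_on V0 kappa alpha beta I u a b <->
  slides I a b /\ forall t, I t -> u ^~ t = profile (a t) (b t).
Proof.
split.
  move=> [la lb drop law].
  have D t : I t -> 0 < b t - a t <= Lm /\ u ^~ t = profile (a t) (b t).
    move=> /drop/(drop_profile V0_gt0 c_gt0)[ab p0 uE].
    have L0 : 0 < b t - a t by rewrite subr_gt0.
    by split => //; rewrite L0 -(back_slope_ge0 V0_gt0 c_gt0 s_gt0 Lm_gt0 Lm_crit).
  split; last by move=> t /D[].
  split; [exact/lip_onP|exact/lip_onP|by move=> t /D[]|].
  apply: aeS (law : {ae @lebesgue_measure R, _}) _ => t lt It.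
  by have [ab uE] := D t It; apply/(contact_lawsP ab uE); exact: lt.
move=> [[la lb ab law] uE]; split; [exact/lip_onP|exact/lip_onP| |].
  move=> t It; have /andP[L0 LL] := ab t It.
  rewrite uE//; apply: profile_argmin => //; first by rewrite -subr_gt0.
  by rewrite (back_slope_ge0 V0_gt0 c_gt0 s_gt0 Lm_gt0 Lm_crit).
apply: (@aeS R _ _ law) => t lt It.
by apply/(contact_lawsP (ab t It) (uE t It)); exact: lt.
Qed.

Lemma profile_translate (a b x y : R) :
  profile (a + y) (b + y) (x + y) = profile a b x.
Proof.
rewrite /profile (_ : b + y - (a + y) = b - a); last by ring.
by rewrite (_ : x + y - (a + y) = x - a)//; ring.
Qed.

(** The contact points are read off from the support. *)
Lemma profile_support (a b a' b' y : R) : a < b -> a' < b' ->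
  b - a <= Lm -> b' - a' <= Lm ->
  (forall x, profile a' b' (x + y) = profile a b x) -> a' = a + y /\ b' = b + y.
Proof.
move=> ab ab' L L' E.
have supp (a0 b0 x : R) : a0 < b0 -> b0 - a0 <= Lm -> (0 < profile a0 b0 x) = (a0 < x < b0).
  move=> ab0 L0; apply/idP/idP => [px|xab].
    by apply: contrapT => xab; move: px; rewrite profile_out// ltxx.
  apply: profile_gt0 => //.
  by rewrite (back_slope_ge0 V0_gt0 c_gt0 s_gt0 Lm_gt0 Lm_crit)// subr_gt0.
apply: oo_itv_inj => //; first by rewrite ltrD2r.
move=> x; rewrite -(supp a' b' x)// (_ : x = x - y + y) ?E; last by ring.
by rewrite supp// subrK ltrBrDr ltrBlDr.
Qed.

End translation.

(** * The sliding drop theorem *)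

(** By periodicity, the length of a wave stays away from zero. *)
Lemma wave_length (R : realType) (P : R -> R) (Lm F0 : R) (beta A B : R -> R) (T : R) :
  slide_wave P Lm F0 beta A B T ->
  exists2 l, 0 < l & forall t, 0 <= t -> l <= B t - A t <= Lm.
Proof.
move=> w; have [sAB T0 AT BT] := w; have [lA lB AB _] := sAB.
have cL : {within `[0, T], continuous (fun t => B t - A t)}.
  by apply: continuous_subspaceT => t; have [cA cB] := wave_cont w t; exact: cvgB.
have [t0 _ t0P] := EVT_min (ltW T0) cL.
have /andP[L0 _] := AB t0 Logic.I.
exists (B t0 - A t0) => // t t_ge0; apply/andP; split; last by have /andP[] := AB t Logic.I.
have [n nP] := nat_ge (t / T); rewrite ler_pdivrMr// in nP.
elim: n t t_ge0 nP => [|n IH] t t_ge0 tn.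
  by apply: t0P; rewrite in_itv/= t_ge0; move: tn; rewrite mul0r; lra.
have [tT|Tt] := leP t T; first by apply: t0P; rewrite in_itv/= t_ge0.
have -> : B t - A t = B (t - T) - A (t - T).
  by rewrite -{1 2}(subrK T t) AT BT; ring.
by apply: IH; move: tn; rewrite -natr1; lra.
Qed.

Theorem theorem2p5 (R : realType) (V0 kappa alpha : R)
    (V0_gt0 : 0 < V0) (kappa_gt0 : 0 < kappa)
    (alpha_gt0 : 0 < alpha) (alpha_lt : alpha < pi / 2) :
  (forall (beta : R -> R) (M m : R),
     (forall x, 0 <= beta x) ->
     [lipschitz beta x | x in setT] ->
     periodic beta 1 ->
     is_maximum beta M -> is_minimum beta m ->
     M - m < V0 * kappa * sin alpha ->
     exists U : R -> R -> R,
       [/\ pulsating_traveling_solution V0 kappa alpha beta U,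
           forall U' : R -> R -> R,
             pulsating_traveling_solution V0 kappa alpha beta U' ->
             exists tau : R, forall x t, U' x t = U x (t + tau) &
           forall (u0 : R -> R) (u : R -> R -> R) (a b : R -> R),
             sliding_drop_solution V0 kappa alpha beta u0 u a b ->
             (exists2 t0 : R, 0 <= t0 &
                forall t, t0 <= t -> derivable b t 1 /\ 0 < derive1 b t) /\
             (exists tau : R,
                ereal_sup [set (`|u x t - U x (t + tau)|)%:E | x in setT]
                  @[t --> +oo] --> 0%E)]) /\
  (forall M m : R, M - m > V0 * kappa * sin alpha ->
     exists2 delta : R, 0 < delta &
       forall (beta : R -> R) (L : R),
         (forall x, 0 <= beta x) ->
         [lipschitz beta x | x in setT] ->
         is_maximum beta M -> is_minimum beta m ->
         0 < L -> periodic beta L ->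
         L < delta ->
         forall (u0 : R -> R) (u : R -> R -> R) (a b : R -> R),
           sliding_drop_solution V0 kappa alpha beta u0 u a b ->
           exists C : R,
             (forall t, 0 <= t -> a t <= a 0 + C) \/
             (forall t, 0 <= t -> b t <= b 0 + C)).

Proof.
have alpha_lt_pi : alpha < pi.
  by apply: (lt_trans alpha_lt); rewrite ltr_pdivrMr// ltr_pMr ?pi_gt0// ltr1n.
have c_gt0 : 0 < kappa * cos alpha.
  rewrite mulr_gt0// cos_gt0_pihalf// alpha_lt andbT (lt_trans _ alpha_gt0)//.
  by rewrite oppr_lt0 divr_gt0// pi_gt0.
have s_gt0 : 0 < kappa * sin alpha by rewrite mulr_gt0// sin_gt0_pi// alpha_gt0.
have [Lm Lm_gt0 Lm_crit] := critical_length V0_gt0 c_gt0 s_gt0.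
set P := half_sqr_slope V0 (kappa * cos alpha) (kappa * sin alpha).
have P_nincr : forall l l', 0 < l -> l <= l' -> l' <= Lm -> P l' <= P l.
  by move=> l l'; exact: half_sqr_slope_nincr.
have sl beta := @sliding_drop_slides R V0 kappa alpha V0_gt0 c_gt0 s_gt0 Lm Lm_gt0 Lm_crit beta.
split=> [beta M m _ /lip_onP/lip_onW[K K0 KP] bper [_ b_le] [_ b_ge]|M m]; rewrite -mulrA => gravity.
  have beta_lip x y : `|beta x - beta y| <= K * `|x - y| by exact: KP.
  have P_cont l : 0 < l -> {for l, continuous P} by exact: half_sqr_slope_cont.
  have P_unif e : 0 < e -> exists2 eta, 0 < eta &
      forall l l', 0 < l -> l + e <= l' -> l' <= Lm -> P l' + eta <= P l.
    by move=> e0; exact: (half_sqr_slope_decr_unif V0_gt0 c_gt0 s_gt0 Lm_gt0 Lm_crit e0).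
  have P_lip l0 : 0 < l0 -> exists C, forall l l', l0 <= l <= Lm -> l0 <= l' <= Lm ->
      `|P l - P l'| <= C * `|l - l'|.
    by move=> l00; exact: (half_sqr_slope_lip V0_gt0 c_gt0 s_gt0 Lm_gt0 Lm_crit l00).
  have P_large C : exists2 l0, 0 < l0 < Lm & C <= P l0.
    exact: half_sqr_slope_large.
  have P_Lm : P Lm = 0 by exact: half_sqr_slope_Lm.
  have [A [B [T w]]] := wave_exists P_nincr P_Lm P_lip P_large K0 beta_lip b_le b_ge gravity bper.
  have [sAB T0 AT BT] := w.
  pose U x t := profile V0 (kappa * cos alpha) (kappa * sin alpha) (A t) (B t) x.
  exists U; split.
  - split; first by exists A, B; apply/sl.
    by exists T => // x t; rewrite /U AT BT profile_translate.
  - move=> U' [[a [b /sl[sab U'E]]] [T' T'0 U'per]].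
    have abT' t : a (t + T') = a t + 1 /\ b (t + T') = b t + 1.
      have [_ _ ab _] := sab.
      have /andP[t1 t2] := ab t Logic.I; have /andP[t3 t4] := ab (t + T') Logic.I.
      apply: (@profile_support R V0 kappa alpha V0_gt0 c_gt0 s_gt0 Lm Lm_gt0 Lm_crit
        (a t) (b t) (a (t + T')) (b (t + T')) 1).
      - by rewrite -subr_gt0.
      - by rewrite -subr_gt0.
      - exact: t2.
      - exact: t4.
      - move=> x; move: (U'per x t).
        have /(congr1 (@^~ (x + 1)))/= -> := U'E (t + T') Logic.I.
        by have /(congr1 (@^~ x))/= -> := U'E t Logic.I.
    have w' : slide_wave P Lm (V0 * (kappa * sin alpha)) beta a b T'.
      by split => // t; have [] := abT' t.
    have [tau tauP] := wave_unique P_nincr P_unif P_cont K0 beta_lip b_le b_ge gravity bper w w'.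
    exists tau => x t; have [aE bE] := tauP t.
    by have := U'E t Logic.I; move/(congr1 (@^~ x)) => /= ->; rewrite /U aE bE.
  - move=> u0 u a b [_ /sl[sab uE]]; split.
      have [t1 t10 t1P] := front_eventually_moves P_nincr P_cont beta_lip b_le b_ge gravity sab.
      exists t1; first exact: ltW.
      by move=> t /t1P[sp db]; split; [case: db|rewrite derive1E; case: db => _ ->].
    have [tau tauP] := wave_attracts P_nincr P_unif P_cont K0 beta_lip b_le b_ge gravity bper w sab.
    exists tau; apply: ereal_sup_cvg0 => // e e0.
    have [l l0 lP] := wave_length w.
    have [d d0 dP] := @profile_unif R V0 kappa alpha c_gt0 l Lm e l0 e0.
    have [t1 t10 t1P] := tauP d d0.
    exists (Num.max t1 (- tau)); split; first exact: num_real.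
    move=> t; rewrite gt_max => /andP[/ltW tt1 ttau] x.
    have [da db] := t1P t tt1.
    have t0 : `[0, +oo[%classic t by rewrite /= in_itv/= andbT; lra.
    have -> : u x t = profile V0 (kappa * cos alpha) (kappa * sin alpha) (a t) (b t) x.
      by have := uE t t0; move/(congr1 (@^~ x)).
    by apply: dP => //; apply: lP; lra.
have [m0|m0] := ltP m 0.
  exists 1 => // beta L b0 _ _ [[x xm] _]; by move: m0; rewrite -xm ltNge b0.
have [l1 [l2 [l10 l12 l2m Pl1 Pl2]]] :=
  pinning_lengths V0_gt0 c_gt0 s_gt0 Lm_gt0 Lm_crit m0 gravity.
exists (l2 - l1); first by rewrite subr_gt0.
move=> beta L _ /lip_onP/lip_onW[K K0 KP] [[xM bM] _] [[xm bm] _] L0 bper Ll u0 u a b [_ /sl[sab _]].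
have beta_lip x y : `|beta x - beta y| <= K * `|x - y| by exact: KP.
have [xa [xb xP]] := slides_stick P_nincr K0 beta_lip bM bm bper L0 Ll l10 l2m Pl1 Pl2 sab.
by exists (xa - a 0); left => t /xP[]; rewrite addrCA subrr addr0.
Qed.
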